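(* Let $h>0$ be real, $l\in\mathbb{N}$, and let $\mathsf{M}\subset\hat{\mathbb{C}}$ have nonempty interior in $\hat{\mathbb{C}}$. If $s\in\mathbb{C}$ satisfies $\operatorname{Re}s\in(1/2,1)$, then there exists an infinite subset $\mathsf{N}\subset\mathbb{N}$ such that $\zeta(s+ih(n+k-1))\in\mathsf{M}$ for every $n\in\mathsf{N}$ and every $k\in\{1,2,\ldots,l\}$.
   Context: $\zeta$ is the Riemann zeta-function; $\hat{\mathbb{C}}=\mathbb{C}\cup\{\infty\}$ is the Riemann sphere with its usual topology. *)

(* Defs.v *)
From HB Require Import structures.
From mathcomp Require Import all_boot all_order all_algebra.
From mathcomp Require Import all_classical all_reals all_analysis.
Set Implicit Arguments.
Unset Strict Implicit.
Unset Printing Implicit Defensive.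
Import Order.TTheory GRing.Theory Num.Theory.
Import numFieldNormedType.Exports.
From mathcomp Require Import complex.
Local Open Scope classical_set_scope.
Local Open Scope ring_scope.
Local Open Scope complex_scope.

(* As a normed module over R[i], R[i]^o carries the usual topology of C, and
   derivatives of functions on it are complex derivatives. *)
Notation Cplx R := (complex R)^o.

Definition cexp (R : realType) (z : R[i]) : R[i] :=
  (expR (complex.Re z))%:C * (cos (complex.Im z) +i* sin (complex.Im z)).

(* a ^ z for a > 0, with the real logarithm of a *)
Definition cpow (R : realType) (a : R) (z : R[i]) : R[i] :=
  cexp (z * (ln a)%:C).

Definition holomorphic_on (R : realType) (D : set (Cplx R))
    (f : Cplx R -> Cplx R) : Prop :=
  forall z, D z -> derivable f z 1.

(* zeta is the analytic continuation to C \ {1} of the Dirichlet series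
   sum_(n >= 1) n ^ (- s), Re s > 1.  As C \ {1} is connected, this determines
   zeta except for its value at the pole 1, which is left arbitrary. *)
Definition is_riemann_zeta (R : realType) (zeta : Cplx R -> Cplx R) : Prop :=
  holomorphic_on [set z | z <> 1] zeta /\
  (forall s : Cplx R, 1 < complex.Re s ->
     (fun m : nat => \sum_(1 <= n < m.+1) cpow n%:R (- s) : Cplx R) @ \oo
       --> zeta s).

(* None is the point at infinity. *)
Definition riemann_sphere (R : realType) : topologicalType :=
  one_point_compactification (Cplx R).

Definition to_sphere (R : realType) (z : Cplx R) : riemann_sphere R := Some z.

(* Main.v *)
(* Put D(s) = prod_(p <= Q) (1 - p^(-s)) and s_k = s + i h k.  For Re s > 1/2 and
   large Q, D zeta is close to 1 in mean square at the points s_k + i h n, and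
   where it is, zeta(s_k + i h n) is close to 1 / D(s_k + i h n), which depends
   only on the phases p^(-i h n), p <= Q.  So two things are needed.

   Phases: for c <> 0 there are unimodular z_p with prod_(p <= Q) (1 - p^(-s_k) z_p)
   close to 1 / c for all k.  As zeta(1 + i t) <> 0, the primes with p^(-i h) close
   to a given point w of the unit circle satisfy sum p^(- Re s) = oo; with aligned
   phases they move the vector of the sums sum_p p^(-s_k) z_p in the direction
   (w^k)_k, the other primes being neutralised by balanced signs, and by
   Vandermonde such vectors span everything.

   Shifts: a non-negative trigonometric polynomial W(n) in the p^(-i h n), p <= Q,
   concentrates on the n at which these phases are close to z_p.  The numbers m
   prime to all p <= Q have m^(-i h n) asymptotically uncorrelated with W, so that
   the mean square of D zeta - 1 remains small after weighting by W.  Coincidences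
   m^(i h) = m'^(i h) involve finitely many primes only; for these z_p = 1.

   Instead of an approximate functional equation one sums by parts L times the
   Dirichlet series of (1 - 2^(1 - s)) D(s) zeta(s), whose coefficients are periodic
   of mean zero: at height T its partial sums of length T^(1 + 1/(L - 1)) suffice. *)
Require Import Defs.
From HB Require Import structures.
From mathcomp Require Import all_boot all_order all_algebra.
From mathcomp Require Import all_classical all_reals all_analysis.
Import Order.TTheory GRing.Theory Num.Theory.
Import numFieldNormedType.Exports.
From mathcomp Require Import complex.
From mathcomp Require Import ring lra zify.
Set Implicit Arguments.
Unset Strict Implicit.
Unset Printing Implicit Defensive.
Local Open Scope classical_set_scope.
Local Open Scope ring_scope.
Local Open Scope complex_scope.

(** The obstacle is that the mean [mu] of the weight W may be tiny, with nothing known about it but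
    positivity, so an error that is small on average over all shifts could still fill the good ones.
    This dictates the order of choices. The numbers prime to all p <= Q and below a cutoff [Q1]
    enter with the exact factor [mu]; Q alone makes their share small relative to 1. The numbers
    beyond [Q1] are estimated with W <= 1 only, and [Q1] is chosen after [mu]. If no large shift
    were good, the mean of W would be too small.

    Complex analysis enters through two facts: zeta agrees in the strip with the limit of the
    modified Dirichlet series, and zeta(1 + i t) is non-zero. Neither contour integrals nor power
    series are used. Goursat's argument is run on Riemann sums and yields the maximum principle at
    the centre of a circle; uniqueness of continuation follows from it by an exponential weight.
    Limits of holomorphic functions are never shown to be holomorphic: being approximable
    suffices. *)

Notation normc := ComplexField.Normc.normc.
Notation Re := complex.Re.
Notation Im := complex.Im.

(** * Complex numbers and holomorphic functions *)

Section Modulus.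
Variable R : realType.
Implicit Types (z w : R[i]).

Lemma normrC z : `|z| = (normc z)%:C.
Proof. by case: z => a b; rewrite normc_def. Qed.

Lemma normc_ge0 z : 0 <= normc z.
Proof. by case: z => a b; exact: sqrtr_ge0. Qed.

Lemma normcD z w : normc (z + w) <= normc z + normc w.
Proof. by rewrite -lecR rmorphD -!normrC ler_normD. Qed.

Lemma normcN z : normc (- z) = normc z.
Proof. by apply: complexI; rewrite -!normrC normrN. Qed.

Lemma normcBC z w : normc (z - w) = normc (w - z).
Proof. by rewrite -normcN opprB. Qed.

Lemma normcB z w : normc (z - w) <= normc z + normc w.
Proof. by rewrite -(normcN w) normcD. Qed.

Lemma normcM z w : normc (z * w) = normc z * normc w.
Proof. exact: ComplexField.Normc.normcM. Qed.

Lemma normcV z : normc z^-1 = (normc z)^-1.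
Proof. exact: ComplexField.Normc.normcV. Qed.

Lemma normc0 : normc (0 : R[i]) = 0.
Proof. exact: ComplexField.Normc.normc0. Qed.

Lemma normc1 : normc (1 : R[i]) = 1.
Proof. exact: ComplexField.Normc.normc1. Qed.

Lemma normcX z n : normc (z ^+ n) = normc z ^+ n.
Proof. by elim: n => [|n ih]; rewrite ?expr0 ?normc1 // !exprS normcM ih. Qed.

Lemma normc_eq0 z : (normc z == 0) = (z == 0).
Proof.
apply/eqP/eqP => [/ComplexField.Normc.eq0_normc //|->]; exact: normc0.
Qed.

Lemma normc_gt0 z : (0 < normc z) = (z != 0).
Proof. by rewrite lt_def normc_ge0 andbT normc_eq0. Qed.

Lemma normc_sqr z : normc z ^+ 2 = Re z ^+ 2 + Im z ^+ 2.
Proof. by case: z => a b; rewrite sqr_sqrtr // addr_ge0 ?sqr_ge0. Qed.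

Lemma normc_real (x : R) : normc x%:C = `|x|.
Proof. by rewrite /= expr0n addr0 sqrtr_sqr. Qed.

Lemma normc_nat n : normc (n%:R : R[i]) = n%:R.
Proof. by rewrite -(rmorph_nat (real_complex R)) normc_real normr_nat. Qed.

Lemma normc_prod (I : Type) (r : seq I) (P : pred I) (F : I -> R[i]) :
  normc (\prod_(i <- r | P i) F i) = \prod_(i <- r | P i) normc (F i).
Proof. by apply: (big_morph _ normcM normc1). Qed.

Lemma normc_sum (I : Type) (r : seq I) (P : pred I) (F : I -> R[i]) :
  normc (\sum_(i <- r | P i) F i) <= \sum_(i <- r | P i) normc (F i).
Proof.
elim/big_rec2: _ => [|i y x _ h]; first by rewrite normc0.
by rewrite (le_trans (normcD _ _))// lerD2l.
Qed.

Lemma normr_Re z : `|Re z| <= normc z.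
Proof.
by rewrite -ler_sqr ?nnegrE ?normc_ge0 ?normr_ge0 // normc_sqr real_normK ?num_real //
  lerDl sqr_ge0.
Qed.

Lemma normr_Im z : `|Im z| <= normc z.
Proof.
by rewrite -ler_sqr ?nnegrE ?normc_ge0 ?normr_ge0 // normc_sqr real_normK ?num_real //
  lerDr sqr_ge0.
Qed.

Lemma normc_le_ReIm z : normc z <= `|Re z| + `|Im z|.
Proof.
case: z => a b; rewrite -{1}(addr0 a) -{1}(add0r b).
have -> : (a + 0) +i* (0 + b) = a%:C + 'i%C * b%:C :> R[i].
  by rewrite [RHS]/=; simpc.
by rewrite (le_trans (normcD _ _))// normcM !normc_real /= expr0n expr1n add0r sqrtr1 mul1r.
Qed.

Lemma ReM z w : Re (z * w) = Re z * Re w - Im z * Im w.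
Proof. by case: z => a b; case: w => c d. Qed.

Lemma ImM z w : Im (z * w) = Re z * Im w + Im z * Re w.
Proof. by case: z => a b; case: w => c d. Qed.

Lemma eqC z w : Re z = Re w -> Im z = Im w -> z = w.
Proof. by case: z => a b; case: w => c d /= -> ->. Qed.

End Modulus.

Section ComplexExp.
Variable R : realType.
Implicit Types (z w : R[i]) (x y : R).

Lemma cexp0 : cexp (0 : R[i]) = 1.
Proof. by rewrite /cexp /= expR0 cos0 sin0 mul1r. Qed.

Lemma cexpD z w : cexp (z + w) = cexp z * cexp w.
Proof.
case: z => a b; case: w => c d; rewrite /cexp /= expRD cosD sinD.
by apply: eqC; rewrite /=; ring.
Qed.

Lemma normc_cexp z : normc (cexp z) = expR (Re z).
Proof.
rewrite /cexp normcM normc_real ger0_norm ?expR_ge0 //=.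
by rewrite cos2Dsin2 sqrtr1 mulr1.
Qed.

Lemma cexp_neq0 z : cexp z != 0.
Proof. by rewrite -normc_gt0 normc_cexp expR_gt0. Qed.

Lemma cexpN z : cexp (- z) = (cexp z)^-1.
Proof.
by apply: (mulfI (cexp_neq0 z)); rewrite -cexpD subrr cexp0 divff ?cexp_neq0.
Qed.

Lemma cexp_i x : cexp ('i%C * x%:C) = cos x +i* sin x.
Proof.
have -> : 'i%C * x%:C = 0 +i* x :> R[i] by apply: eqC; rewrite /=; ring.
by rewrite /cexp /= expR0 mul1r.
Qed.

Lemma cexp_nat z n : cexp (n%:R * z) = cexp z ^+ n.
Proof.
elim: n => [|n ih]; first by rewrite mul0r cexp0.
by rewrite -[in LHS]addn1 natrD mulrDl mul1r cexpD ih exprSr.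
Qed.

Lemma cexp_sum (I : Type) (r : seq I) (P : pred I) (F : I -> R[i]) :
  cexp (\sum_(i <- r | P i) F i) = \prod_(i <- r | P i) cexp (F i).
Proof. by apply: (big_morph _ cexpD cexp0). Qed.

Lemma mean_value (f df : R -> R) (a b : R) : a <= b ->
  (forall x, a <= x <= b -> is_derive x 1 f (df x)) ->
  exists2 c, a <= c <= b & f b - f a = df c * (b - a).
Proof.
move=> ab hf.
have [||c] := @MVT_segment R f df a b ab.
- by move=> x; rewrite in_itv /= => /andP[/ltW h1 /ltW h2]; apply: hf; apply/andP.
- apply: derivable_within_continuous => x; rewrite in_itv /= => h.
  exact: (@ex_derive _ _ _ _ _ _ _ (hf x h)).
- by rewrite in_itv /= => h e; exists c.
Qed.

Lemma ler_norm_sin x : `|sin x| <= `|x|.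
Proof.
wlog x0 : x / 0 <= x => [h|].
  have [/h//|/ltW x0] := leP 0 x.
  by rewrite -normrN -sinN -(normrN x) h // oppr_ge0.
have [c _] := @mean_value sin cos 0 x x0 (fun y _ => is_derive_sin y).
by rewrite sin0 !subr0 => ->; rewrite normrM ler_piMl // cos_max.
Qed.

Lemma ler_norm_cosB1 x : `|cos x - 1| <= x ^+ 2.
Proof.
wlog x0 : x / 0 <= x => [h|].
  have [/h//|/ltW x0] := leP 0 x.
  by rewrite -cosN -sqrrN h // oppr_ge0.
have [c] := @mean_value cos (fun y => - sin y) 0 x x0
  (fun y _ => is_derive_cos y).
move=> /andP[c0 cx]; rewrite cos0 !subr0 => ->.
rewrite normrM normrN expr2 (ger0_norm x0) ler_wpM2r //.
by rewrite (le_trans (ler_norm_sin _)) // ger0_norm.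
Qed.

Lemma ler_norm_sinB x : `|sin x - x| <= `|x| ^+ 3.
Proof.
wlog x0 : x / 0 <= x => [h|].
  have [/h//|/ltW x0] := leP 0 x.
  by rewrite -normrN opprD -sinN -(normrN x) h // oppr_ge0.
have [c] := @mean_value (fun y => sin y - y) (fun y => cos y - 1) 0 x x0
  (fun y _ => is_deriveB (is_derive_sin y) (is_derive_id y 1)).
move=> /andP[c0 cx]; rewrite sin0 !subr0 => ->.
rewrite normrM exprS mulrC (ger0_norm x0) ler_wpM2l //.
rewrite (le_trans (ler_norm_cosB1 _)) // lerXn2r ?nnegrE //.
Qed.

Lemma ler_norm_expRB x : `|x| <= 2^-1 -> `|expR x - 1 - x| <= 2 * x ^+ 2.
Proof.
rewrite ler_norml => /andP[x1 x2].
have h1 := expR_ge1Dx x; have h2 := expR_ge1Dx (- x).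
have e0 := expR_gt0 x; have := expRxMexpNx_1 x => h3.
have h4 : expR x * (1 - x) <= 1 by rewrite -[leRHS]h3 ler_wpM2l // ltW.
rewrite ler_norml; apply/andP; split; first by nra.
have : (expR x - 1 - x) * (1 - x) <= x ^+ 2 by nra.
nra.
Qed.

(** Follows from the real estimates for [expR], [cos] and [sin]: the pieces contribute 2, 2, 2 and 1
    times [normc z ^+ 2], rounded up to 8. *)
Lemma cexp_bound z : normc z <= 2^-1 ->
  normc (cexp z - 1 - z) <= 8 * normc z ^+ 2.
Proof.
move=> hz; have hx := normr_Re z; have hy := normr_Im z.
apply: (le_trans (normc_le_ReIm _)).
move: (normc_ge0 z) hz hx hy; set r := normc z; clearbody r; move: r.
case: z => x y r r0 hr /=.
move=> hx hy.
have hx2 := ler_norm_expRB (le_trans hx hr).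
have hc := ler_norm_cosB1 y; have hs := ler_norm_sinB y.
have hs1 := ler_norm_sin y.
have x2 : x ^+ 2 <= r ^+ 2 by rewrite -real_normK ?num_real // lerXn2r ?nnegrE.
have y2 : y ^+ 2 <= r ^+ 2 by rewrite -real_normK ?num_real // lerXn2r ?nnegrE.
have y3 : `|y| ^+ 3 <= r ^+ 2.
  apply: (@le_trans _ _ (r ^+ 3)); first by rewrite lerXn2r ?nnegrE.
  by rewrite exprS ler_piMl ?sqr_ge0 // (le_trans hr) //; lra.
have eu : expR x <= 2.
  by move: hx2; rewrite ler_norml => /andP[_]; move: (ler_norm x); nra.
have e1 : `|expR x - 1| <= 2 * r.
  have -> : expR x - 1 = (expR x - 1 - x) + x by ring.
  by rewrite (le_trans (ler_normD _ _)) //; nra.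
have -> : expR x * cos y - 0 * sin y - 1 - x
  = (expR x - 1 - x) + expR x * (cos y - 1) by ring.
have -> : expR x * sin y + 0 * cos y - 0 - y
  = (expR x - 1) * sin y + (sin y - y) by ring.
have b1 : `|expR x * (cos y - 1)| <= 2 * r ^+ 2.
  rewrite normrM (ger0_norm (expR_ge0 _)) ler_pM ?expR_ge0 //.
  exact: le_trans hc _.
have b2 : `|(expR x - 1) * sin y| <= 2 * r ^+ 2.
  rewrite normrM expr2 mulrA ler_pM //.
  exact: le_trans hs1 _.
have := ler_normD (expR x - 1 - x) (expR x * (cos y - 1)).
have := ler_normD ((expR x - 1) * sin y) (sin y - y).
have := sqr_ge0 r.
lra.
Qed.

(** The bound on the argument makes a circle the image of a compact interval in
    [cdiff_bounded_circle]; elsewhere any logarithm will do. *)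
Lemma cexp_surj z : z != 0 ->
  exists w, cexp w = z /\ - pi <= Im w <= pi.
Proof.
move=> z0; have r0 : 0 < normc z by rewrite normc_gt0.
have [x ex] := expR_total r0.
have h := normc_sqr z.
set r := normc z in r0 ex h; set a := Re z / r; set b := Im z / r.
have ab : a ^+ 2 + b ^+ 2 = 1.
  by rewrite /a /b !expr_div_n -mulrDl -h divff // expf_neq0 // gt_eqF.
have a1 : -1 <= a <= 1.
  rewrite -ler_norml -ler_sqr ?nnegrE // real_normK ?num_real // expr1n -ab.
  by rewrite lerDl sqr_ge0.
have [th [ct st hth]] : exists th, [/\ cos th = a, sin th = b & - pi <= th <= pi].
  have ca : cos (acos a) = a by rewrite acosK // in_itv.
  have : sin (acos a) ^+ 2 = b ^+ 2 by rewrite sin2cos2 ca -ab; ring.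
  have h0 := acos_ge0 a1; have h1 := acos_lepi a1; have h2 := pi_ge0 R.
  move/eqP; rewrite eqf_sqr => /orP[/eqP|/eqP] e.
    by exists (acos a); rewrite e ca; split=> //; apply/andP; split; lra.
  exists (- acos a); rewrite cosN sinN e opprK ca; split=> //.
  by apply/andP; split; lra.
exists (x +i* th); split=> //; rewrite /cexp /= ct st ex.
by apply: eqC; rewrite /= ?mul0r ?subr0 ?addr0 /a /b mulrC divfK // gt_eqF.
Qed.

End ComplexExp.

Section ComplexPower.
Variable R : realType.
Implicit Types (z w : R[i]) (x y a b : R).

Lemma cpowDr a z w : cpow a (z + w) = cpow a z * cpow a w.
Proof. by rewrite /cpow mulrDl cexpD. Qed.

Lemma cpow0 a : cpow a (0 : R[i]) = 1.
Proof. by rewrite /cpow mul0r cexp0. Qed.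

Lemma cpow1 z : cpow 1 z = 1.
Proof. by rewrite /cpow ln1 mulr0 cexp0. Qed.

Lemma cpowM a b z : 0 < a -> 0 < b -> cpow (a * b) z = cpow a z * cpow b z.
Proof. by move=> a0 b0; rewrite /cpow lnM // rmorphD mulrDr cexpD. Qed.

Lemma normc_cpow a z : 0 < a -> normc (cpow a z) = a `^ Re z.
Proof.
move=> a0; rewrite /cpow normc_cexp /powR gt_eqF // ReM /=.
by rewrite mulr0 subr0.
Qed.

Lemma cpowN a z : cpow a (- z) = (cpow a z)^-1.
Proof. by rewrite /cpow mulNr cexpN. Qed.

Lemma cpow_nat a z n : cpow a (n%:R * z) = cpow a z ^+ n.
Proof. by rewrite /cpow -mulrA cexp_nat. Qed.

Lemma cpow_real a x : 0 < a -> cpow a x%:C = (a `^ x)%:C.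
Proof.
move=> a0; rewrite /cpow -rmorphM /cexp /= cos0 sin0 /powR gt_eqF //.
by rewrite complexr0 mulr1.
Qed.

End ComplexPower.

Section Interface.
Variable R : realType.
Implicit Types (z w : R[i]) (x y a b : R).

(** Stated with a real modulus and without quotients: the non-strict inequality covers [k = 0], and
    the errors of sums, products and composites are handled by plain arithmetic. *)
Definition cdiff (f : R[i] -> R[i]) (z : R[i]) : Prop :=
  exists d : R[i], forall e : R, 0 < e -> exists2 r : R, 0 < r &
    forall k, normc k < r -> normc (f (z + k) - f z - d * k) <= e * normc k.

Definition cseq_lim (u : nat -> R[i]) (l : R[i]) : Prop :=
  forall e : R, 0 < e -> exists N, forall n, (N <= n)%N -> normc (u n - l) < e.

Lemma derivable_cdiff (f : Cplx R -> Cplx R) z : derivable f z 1 -> cdiff f z.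
Proof.
move=> /cvg_ex[/= d /cvgrPdist_lt hd]; exists d => e e0.
have e0' : 0 < e%:C :> R[i] by rewrite ltcR.
have := hd _ e0'; rewrite /= !nearE.
move=> [r /= r0 hr]; exists (Re r); first by move: r0; rewrite ltcE => /andP[].
move=> k kr; have [->|k0] := eqVneq k 0.
  by rewrite addr0 subrr mulr0 subr0 normc0 mulr0.
have rE : r = (Re r)%:C.
  by move: r0; rewrite ltcE => /andP[/eqP h _]; apply: eqC.
have := hr k; rewrite /ball_ /= sub0r normrN {1}rE !normrC ltcR => /(_ kr k0).
rewrite ltcR => /ltW h.
have -> : f (z + k) - f z - d * k = - ((d - k^-1 * (f (k * 1 + z) - f z)) * k).
  by rewrite mulr1 mulrBl mulrAC mulVf // mul1r (addrC k z) opprB.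
by rewrite normcN normcM ler_wpM2r // normc_ge0.
Qed.

Lemma cvg_cseq_lim (u : nat -> Cplx R) (l : Cplx R) : u @ \oo --> l -> cseq_lim u l.
Proof.
move=> /cvgrPdist_lt h e e0; have e0' : 0 < e%:C :> R[i] by rewrite ltcR.
have [N _ hN] := h _ e0'; exists N => n /hN /=.
by rewrite normrC ltcR normcBC.
Qed.

(** The centre has to be non-zero because Euler products can only be steered towards values [1 / c].
    A disc about 0 is replaced by the disc of radius [r / 2] about [r / 2]. *)
Lemma sphere_interior (M : set (riemann_sphere R)) : interior M !=set0 ->
  exists c : R[i], exists r : R, [/\ c != 0, 0 < r &
    forall z, normc (z - c) < r -> M (to_sphere z)].
Proof.
case=> x; rewrite /interior.
have : forall y : Cplx R, nbhs (Some y : riemann_sphere R) M ->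
   exists2 r : R, 0 < r & forall z, normc (z - y) < r -> M (to_sphere z).
  move=> y h; have {}h : nbhs y (fun t => M (Some t)) by exact: h.
  move: h => /nbhs_ballP[e /= e0 he]; exists (Re e).
    by move: e0; rewrite ltcE => /andP[].
  move=> z hz; apply: he; rewrite /ball /= normrC.
  have -> : e = (Re e)%:C.
    by move: e0; rewrite ltcE => /andP[/eqP h _]; apply: eqC.
  by rewrite ltcR normcBC.
move=> key.
have {}key : forall y : Cplx R, nbhs (Some y : riemann_sphere R) M ->
  exists c : R[i], exists r : R, [/\ c != 0, 0 < r &
    forall z, normc (z - c) < r -> M (to_sphere z)].
  move=> y /key[r r0 hr].
  have [y0|y0] := eqVneq (y : R[i]) 0; last by exists y, r.
  exists (r / 2)%:C, (r / 2); split.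
  - by rewrite -normc_gt0 normc_real normr_gt0 gt_eqF ?divr_gt0.
  - by rewrite divr_gt0.
  move=> z hz; apply: hr; rewrite y0 subr0.
  rewrite -(subrK (r / 2)%:C z) (le_lt_trans (normcD _ _)) //.
  rewrite normc_real ger0_norm ?divr_ge0 ?(ltW r0) //; lra.
(* A neighbourhood of infinity contains the complement of a closed compact [C]. Real parts are
   bounded on [C], so some finite point lies in this open complement. *)
case: x => [y|[C [cC clC] hC]]; first exact: key.
have cRe : continuous (fun z : Cplx R => Re z : R).
  move=> z A /nbhs_ballP[e /= e0 he].
  apply/nbhs_ballP; exists e%:C => /=; first by rewrite ltcR.
  move=> t; rewrite /ball /= normrC ltcR => ht; apply: he; rewrite /ball /=.
  by rewrite -raddfB (le_lt_trans (normr_Re _)).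
have [a [_ hA]] := compact_bounded (continuous_compact
  (continuous_subspaceT cRe) cC).
have [y hy] : exists y : Cplx R, ~ C y.
  exists (`|a| + 2)%:C => CB.
  have aB : a < `|a| + 1 by rewrite (le_lt_trans (ler_norm _)) // ltrDl.
  have /= := hA _ aB (`|a| + 2) (ex_intro2 _ _ _ CB erefl).
  rewrite ger0_norm; first by lra.
  by rewrite addr_ge0.
apply: (key y).
have : nbhs y (~` C) by apply: open_nbhs_nbhs; split => //; exact: closed_openC.
by apply: filterS => z hz; apply: hC; left; exists z.
Qed.

End Interface.

Section ComplexDifferentiability.
Variable R : realType.
Implicit Types (f g : R[i] -> R[i]) (z w k : R[i]).

Lemma cdiff_cont f z : cdiff f z -> forall e : R, 0 < e ->
  exists2 r : R, 0 < r & forall k, normc k < r -> normc (f (z + k) - f z) < e.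
Proof.
move=> [d hd] e e0; have [r r0 hr] := hd 1 ltr01.
have D0 : 0 < 2 + normc d by have := normc_ge0 d; lra.
exists (Num.min r (e / (2 + normc d))).
  by rewrite lt_min r0 divr_gt0.
move=> k; rewrite lt_min => /andP[kr ke].
rewrite -(subrK (d * k) (f (z + k) - f z)) (le_lt_trans (normcD _ _)) //.
rewrite normcM (le_lt_trans (lerD (hr _ kr) (lexx _))) // mul1r.
move: ke; rewrite ltr_pdivlMr //; have := normc_ge0 k; nra.
Qed.

Lemma cdiff_affine (a b : R[i]) z : cdiff (fun z => a * z + b) z.
Proof.
exists a => e e0; exists 1 => // k _.
have -> : a * (z + k) + b - (a * z + b) - a * k = 0 by ring.
by rewrite normc0 mulr_ge0 ?normc_ge0 // ltW.
Qed.

Lemma cdiff_cst (b : R[i]) z : cdiff (fun=> b) z.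
Proof.
exists 0 => e e0; exists 1 => // k _.
by rewrite subrr mul0r subrr normc0 mulr_ge0 ?normc_ge0 // ltW.
Qed.

Lemma cdiffD f g z : cdiff f z -> cdiff g z -> cdiff (fun z => f z + g z) z.
Proof.
move=> [d hd] [d' hd']; exists (d + d') => e e0.
have e2 : 0 < e / 2 by rewrite divr_gt0.
have [r r0 hr] := hd _ e2; have [r' r0' hr'] := hd' _ e2.
exists (Num.min r r'); first by rewrite lt_min r0 r0'.
move=> k; rewrite lt_min => /andP[/hr h /hr' h'].
have -> : f (z + k) + g (z + k) - (f z + g z) - (d + d') * k =
  (f (z + k) - f z - d * k) + (g (z + k) - g z - d' * k) by ring.
by rewrite (le_trans (normcD _ _)) // (splitr e) mulrDl lerD.
Qed.

Lemma cdiffM f g z : cdiff f z -> cdiff g z -> cdiff (fun z => f z * g z) z.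
Proof.
move=> cf cg; have [d hd] := cf; have [d' hd'] := cg.
exists (d * g z + f z * d') => e e0.
set A := 1 + normc (f z) + normc (g z) + normc d'.
have A0 : 0 < A.
  by rewrite /A; have := normc_ge0 (f z); have := normc_ge0 (g z);
     have := normc_ge0 d'; lra.
set u := Num.min 1 (e / (4 * A)).
have u0 : 0 < u by rewrite lt_min ltr01 divr_gt0 // mulr_gt0.
have uA : u * (4 * A) <= e by rewrite -ler_pdivlMr ?mulr_gt0 // ge_min lexx orbT.
have u1 : u <= 1 by rewrite ge_min lexx.
have [r r0 hr] := hd _ u0; have [r' r0' hr'] := hd' _ u0.
have [r2 r20 hr2] := cdiff_cont cf u0.
exists (Num.min r (Num.min r' r2)); first by rewrite !lt_min r0 r0'.
move=> k; rewrite !lt_min => /and3P[/hr h /hr' h' /hr2 /ltW h2].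
have -> : f (z + k) * g (z + k) - f z * g z - (d * g z + f z * d') * k =
  (f (z + k) - f z - d * k) * g z + f z * (g (z + k) - g z - d' * k) +
  (f (z + k) - f z) * ((g (z + k) - g z - d' * k) + d' * k) by ring.
rewrite (le_trans (normcD _ _)) // (le_trans (lerD (normcD _ _) (lexx _))) //.
rewrite !normcM.
have h3 : normc (g (z + k) - g z - d' * k + d' * k) <= (1 + normc d') * normc k.
  rewrite (le_trans (normcD _ _)) // normcM mulrDl lerD // (le_trans h') //.
  by rewrite ler_wpM2r ?normc_ge0.
have := ler_pM (normc_ge0 _) (normc_ge0 _) h2 h3.
have := ler_wpM2r (normc_ge0 (g z)) h.
have := ler_wpM2l (normc_ge0 (f z)) h'.
have := ler_wpM2r (normc_ge0 k) uA.
have : u * normc k * 0 <= u * normc k * (1 + normc (f z) + normc (g z) + normc d').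
  by rewrite ler_wpM2l ?mulr_ge0 ?normc_ge0 // ?ltW.
by rewrite /A; nra.
Qed.

Lemma cdiff_comp f g z : cdiff g z -> cdiff f (g z) -> cdiff (fun z => f (g z)) z.
Proof.
move=> cg cf; have [d hd] := cf; have [d' hd'] := cg.
exists (d * d') => e e0.
set A := 1 + normc d + normc d'.
have A0 : 0 < A by rewrite /A; have := normc_ge0 d; have := normc_ge0 d'; lra.
set u := Num.min 1 (e / (2 * A)).
have u0 : 0 < u by rewrite lt_min ltr01 divr_gt0 // mulr_gt0.
have uA : u * (2 * A) <= e by rewrite -ler_pdivlMr ?mulr_gt0 // ge_min lexx orbT.
have u1 : u <= 1 by rewrite ge_min lexx.
have [r r0 hr] := hd _ u0; have [r' r0' hr'] := hd' _ u0.
have [r2 r20 hr2] := cdiff_cont cg r0.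
exists (Num.min r' r2); first by rewrite !lt_min r0'.
move=> k; rewrite !lt_min => /andP[/hr' h' /hr2 h2].
have := hr _ h2; rewrite (addrC (g z)) subrK => h3.
have -> : f (g (z + k)) - f (g z) - d * d' * k =
  (f (g (z + k)) - f (g z) - d * (g (z + k) - g z)) +
  d * (g (z + k) - g z - d' * k) by ring.
rewrite (le_trans (normcD _ _)) // normcM.
have h4 : normc (g (z + k) - g z) <= (1 + normc d') * normc k.
  rewrite -(subrK (d' * k) (g (z + k) - g z)) (le_trans (normcD _ _)) //.
  rewrite normcM mulrDl lerD // (le_trans h') //.
  by rewrite ler_wpM2r ?normc_ge0.
have := ler_wpM2l (ltW u0) h4.
have := ler_wpM2l (normc_ge0 d) h'.
have := ler_wpM2r (normc_ge0 k) uA.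
have : u * normc k * 0 <= u * normc k * (1 + normc d + normc d').
  by rewrite ler_wpM2l ?mulr_ge0 ?normc_ge0 // ?ltW.
by rewrite /A; nra.
Qed.

Lemma cdiff_cexp z : cdiff (@cexp R) z.
Proof.
exists (cexp z) => e e0; set A := 8 * normc (cexp z) + 1.
have A0 : 0 < A by rewrite /A; have := normc_ge0 (cexp z); lra.
exists (Num.min 2^-1 (e / A)); first by rewrite lt_min invr_gt0 ltr0n divr_gt0.
move=> k; rewrite lt_min => /andP[/ltW /cexp_bound h].
rewrite ltr_pdivlMr // => h2.
have -> : cexp (z + k) - cexp z - cexp z * k = cexp z * (cexp k - 1 - k).
  by rewrite cexpD; ring.
rewrite normcM; have := ler_wpM2l (normc_ge0 (cexp z)) h.
have := ler_wpM2r (normc_ge0 k) (ltW h2).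
rewrite /A; have := normc_ge0 k; have := sqr_ge0 (normc k); nra.
Qed.

(** The extreme value theorem applied to the modulus of [f] along [a + r e^(i t)], with t in
    [[- pi, pi]]. *)
Lemma cdiff_bounded_circle f a (r : R) : 0 < r ->
  (forall z, normc (z - a) = r -> cdiff f z) ->
  exists B : R, forall z, normc (z - a) = r -> normc (f z) <= B.
Proof.
move=> r0 hf; pose p (t : R) : R[i] := a + r%:C * cexp ('i%C * t%:C).
have np t : normc (p t - a) = r.
  rewrite /p addrC addKr normcM normc_real gtr0_norm // cexp_i /=.
  by rewrite cos2Dsin2 sqrtr1 mulr1.
have cp : continuous (fun t => normc (f (p t))).
  move=> t; apply/cvgrPdist_lt => e e0.
  have [d d0 hd] := cdiff_cont (hf _ (np t)) e0.
  have : cdiff (fun z => a + r%:C * cexp ('i%C * z)) t%:C.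
    apply: cdiffD; first exact: cdiff_cst.
    apply: cdiffM; first exact: cdiff_cst.
    apply: (@cdiff_comp (@cexp R)); last exact: cdiff_cexp.
    have := cdiff_affine 'i%C 0 t%:C.
    by congr (cdiff _ _); apply: funext => y; rewrite addr0.
  move=> /cdiff_cont /(_ _ d0)[d' d'0 hd'].
  apply/nbhs_ballP; exists d' => //= t'; rewrite /ball /= => htt.
  have := hd' (t' - t)%:C; rewrite normc_real distrC => /(_ htt).
  rewrite -rmorphD (addrC t) subrK -/(p t) -/(p t') => /hd.
  rewrite (addrC (p t)) subrK; apply: le_lt_trans.
  rewrite distrC ler_norml; apply/andP; split.
    have := normcD (f (p t) - f (p t')) (f (p t')); rewrite subrK normcBC; lra.
  have := normcD (f (p t') - f (p t)) (f (p t)); rewrite subrK; lra.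
have pp : - pi <= pi :> R by have := pi_ge0 R; lra.
have [c _ hc] := EVT_max pp (continuous_subspaceT cp).
exists (normc (f (p c))) => z hz.
have z0 : (z - a) / r%:C != 0.
  by rewrite -normc_gt0 normcM normcV normc_real hz gtr0_norm // divff ?gt_eqF.
have [w [ew hw]] := cexp_surj z0.
have Rw : Re w = 0.
  apply: expR_inj; rewrite -normc_cexp ew normcM normcV normc_real hz.
  by rewrite gtr0_norm // divff ?gt_eqF // expR0.
have -> : z = p (Im w); last by apply: hc; rewrite in_itv.
rewrite /p; have -> : 'i%C * (Im w)%:C = w.
  by apply: eqC; rewrite /= ?Rw; ring.
by rewrite ew; field; rewrite -normc_gt0 normc_real normr_gt0 gt_eqF.
Qed.

Lemma cdiff_sum (I : Type) (r : seq I) (P : pred I) (F : I -> R[i] -> R[i]) z :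
  (forall i, cdiff (F i) z) -> cdiff (fun z => \sum_(i <- r | P i) F i z) z.
Proof.
move=> h; elim: r => [|i r ih].
  under [X in cdiff X]eq_fun do rewrite big_nil; exact: cdiff_cst.
under [X in cdiff X]eq_fun do rewrite big_cons.
by case: (P i) => //; apply: cdiffD.
Qed.

Lemma cdiff_prod (I : Type) (r : seq I) (P : pred I) (F : I -> R[i] -> R[i]) z :
  (forall i, cdiff (F i) z) -> cdiff (fun z => \prod_(i <- r | P i) F i z) z.
Proof.
move=> h; elim: r => [|i r ih].
  under [X in cdiff X]eq_fun do rewrite big_nil; exact: cdiff_cst.
under [X in cdiff X]eq_fun do rewrite big_cons.
by case: (P i) => //; apply: cdiffM.
Qed.

Lemma cdiff_cpowN a z : cdiff (fun z => cpow a (- z)) z.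
Proof.
apply: (@cdiff_comp (@cexp R) (fun z => - z * (ln a)%:C)); last exact: cdiff_cexp.
have -> : (fun z => - z * (ln a)%:C) = (fun z => (- (ln a)%:C) * z + 0).
  by apply: funext => y; ring.
exact: cdiff_affine.
Qed.

End ComplexDifferentiability.

(** * Goursat's theorem for Riemann sums and the maximum principle *)

Section Goursat.
Variable R : realType.
Implicit Types (g : R[i] -> R[i]) (w d z : R[i]) (n k : nat).

(** Left Riemann sum for the integral of [g] from [w] to [w + d]. With [2 ^ n] pieces, bisecting the
    segment is an exact identity, [rsum_split]. *)
Definition rsum n g w d : R[i] :=
  d / (2 ^+ n) * \sum_(0 <= j < (2 ^ n)%N) g (w + d * (j%:R / 2 ^+ n)).

(** The Riemann sum around the boundary of the parallelogram with corner [w] and sides [d], [d']. *)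
Definition bsum n g w d d' : R[i] :=
  rsum n g w d + rsum n g (w + d) d' - rsum n g (w + d') d - rsum n g w d'.

Lemma rsum_split n g w d :
  rsum n.+1 g w d = rsum n g w (d / 2) + rsum n g (w + d / 2) (d / 2).
Proof.
have h2 : 2 ^+ n != 0 :> R[i] by rewrite expf_neq0.
rewrite /rsum expnS mul2n -addnn (@big_cat_nat _ _ _ (2 ^ n)%N) ?leq_addr //=.
have -> : d / 2 ^+ n.+1 = d / 2 / 2 ^+ n by rewrite exprS; field.
rewrite mulrDr; congr (_ + _ * _).
  by congr (_ * _); apply: eq_bigr => j _; rewrite exprS; congr (g (_ + _)); field.
rewrite -{1}[(2 ^ n)%N]add0n big_addn addnK.
apply: eq_bigr => j _; congr (g _).
by rewrite natrD natrX exprS; field.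
Qed.

Lemma bsum_split n g w d d' : bsum n.+1 g w d d' =
  bsum n g w (d / 2) (d' / 2) + bsum n g (w + d / 2) (d / 2) (d' / 2) +
  bsum n g (w + d' / 2) (d / 2) (d' / 2) +
  bsum n g (w + d / 2 + d' / 2) (d / 2) (d' / 2).
Proof.
rewrite /bsum !rsum_split.
have -> : w + d / 2 + d / 2 = w + d by field.
have -> : w + d' / 2 + d' / 2 = w + d' by field.
have -> : w + d / 2 + d' / 2 + d / 2 = w + d + d' / 2 by field.
have -> : w + d / 2 + d' / 2 + d' / 2 = w + d' + d / 2 by field.
have -> : w + d' / 2 + d / 2 = w + d / 2 + d' / 2 by field.
ring.
Qed.

Lemma bsumB n g1 g2 w d d' : bsum n (fun z => g1 z - g2 z) w d d' =
  bsum n g1 w d d' - bsum n g2 w d d'.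
Proof.
have h v e : rsum n (fun z => g1 z - g2 z) v e = rsum n g1 v e - rsum n g2 v e.
  by rewrite /rsum sumrB mulrBr.
by rewrite /bsum !h; ring.
Qed.

Lemma rsum_affine n a b w d v : rsum n (fun z => a * z + b) (w + v) d =
  rsum n (fun z => a * z + b) w d + a * v * d.
Proof.
have h2 : 2 ^+ n != 0 :> R[i] by rewrite expf_neq0.
have -> : a * v * d = d / 2 ^+ n * \sum_(0 <= j < (2 ^ n)%N) (a * v).
  by rewrite sumr_const_nat subn0 -(mulr_natr (a * v)) natrX; field.
rewrite /rsum -mulrDr -big_split /=; congr (_ * _).
by apply: eq_bigr => j _; ring.
Qed.

(** Exact for every [n]: the discretisation errors on opposite sides are equal and cancel. *)
Lemma bsum_affine n a b w d d' : bsum n (fun z => a * z + b) w d d' = 0.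
Proof. by rewrite /bsum !rsum_affine; ring. Qed.

Definition in_para w d d' z := exists x y : R,
  [/\ 0 <= x <= 1, 0 <= y <= 1 & z = w + x%:C * d + y%:C * d'].

Lemma rsum_bound n g w d (M : R) :
  (forall x : R, 0 <= x <= 1 -> normc (g (w + x%:C * d)) <= M) ->
  normc (rsum n g w d) <= M * normc d.
Proof.
move=> h; rewrite /rsum normcM.
have p0 : 0 < 2 ^+ n :> R by rewrite exprn_gt0.
have -> : normc (d / 2 ^+ n) = normc d / 2 ^+ n.
  by rewrite normcM normcV normcX normc_nat.
rewrite mulrAC ler_pdivrMr // mulrC [leRHS]mulrAC ler_wpM2r ?normc_ge0 //.
rewrite (le_trans (normc_sum _ _ _)) //.
have -> : M * 2 ^+ n = \sum_(0 <= j < (2 ^ n)%N) M.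
  by rewrite sumr_const_nat subn0 -(mulr_natr M) natrX.
rewrite !big_nat; apply: ler_sum => j /andP[_ hj].
have -> : d * (j%:R / 2 ^+ n) = (j%:R / 2 ^+ n)%:C * d.
  by rewrite rmorphM fmorphV rmorphXn /= !rmorph_nat mulrC.
apply: h; rewrite divr_ge0 ?ler0n ?(ltW p0) //= ler_pdivrMr // mul1r.
by rewrite -natrX ler_nat ltnW.
Qed.

Lemma bsum_bound n g w d d' (M : R) :
  (forall z, in_para w d d' z -> normc (g z) <= M) ->
  normc (bsum n g w d d') <= 2 * M * (normc d + normc d').
Proof.
move=> h.
have h1 : normc (rsum n g w d) <= M * normc d.
  apply: rsum_bound => x hx; apply: h; exists x, 0.
  by rewrite lexx ler01 mul0r addr0.
have h2 : normc (rsum n g w d') <= M * normc d'.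
  apply: rsum_bound => x hx; apply: h; exists 0, x.
  by rewrite lexx ler01 mul0r addr0.
have h3 : normc (rsum n g (w + d) d') <= M * normc d'.
  apply: rsum_bound => x hx; apply: h; exists 1, x.
  by rewrite lexx ler01 mul1r.
have h4 : normc (rsum n g (w + d') d) <= M * normc d.
  apply: rsum_bound => x hx; apply: h; exists x, 1.
  by rewrite lexx ler01 mul1r addrAC.
rewrite /bsum (le_trans (normcB _ _)) //.
have := normcB (rsum n g w d + rsum n g (w + d) d') (rsum n g (w + d') d).
have := normcD (rsum n g w d) (rsum n g (w + d) d').
lra.
Qed.

Lemma nested_dyadic (x : nat -> R) : x 0%N = 0 ->
  (forall k, x k <= x k.+1 <= x k + 2^-1 ^+ k.+1) ->
  exists2 l : R, 0 <= l <= 1 & forall k, x k <= l <= x k + 2^-1 ^+ k.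
Proof.
move=> x0 hx.
have up j k : x k <= x (j + k)%N.
  elim: j => // j ih; rewrite (le_trans ih) // addSn.
  by case/andP: (hx (j + k)%N).
have dn j k : x (j + k)%N + 2^-1 ^+ (j + k) <= x k + 2^-1 ^+ k.
  elim: j => // j ih; rewrite (le_trans _ ih) // addSn.
  have /andP[_ h] := hx (j + k)%N.
  move: h; rewrite exprS; lra.
have ub j k : x j <= x k + 2^-1 ^+ k.
  apply: (le_trans (up k j)); rewrite addnC; apply: (le_trans _ (dn j k)).
  by rewrite lerDl exprn_ge0 // invr_ge0.
have hs : has_sup (range x).
  split; first by exists (x 0%N), 0%N.
  by exists (x 0%N + 2^-1 ^+ 0) => _ [j _ <-]; exact: ub.
have h k : x k <= sup (range x) <= x k + 2^-1 ^+ k.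
  apply/andP; split; first by apply: ub_le_sup; [case: hs|exists k].
  by apply: ge_sup; [case: hs|move=> _ [j _ <-]; exact: ub].
exists (sup (range x)) => //.
by have := h 0%N; rewrite x0 expr0 add0r.
Qed.

Let para_sub w d d' (x y : R) k (z : R[i]) :
  0 <= x <= 1 -> 0 <= y <= 1 ->
  in_para (w + x%:C * d + y%:C * d') (d / 2 ^+ k) (d' / 2 ^+ k) z ->
  forall lx ly : R, x <= lx <= x + 2^-1 ^+ k -> y <= ly <= y + 2^-1 ^+ k ->
  normc (z - (w + lx%:C * d + ly%:C * d')) <=
    (normc d + normc d') * 2^-1 ^+ k.
Proof.
move=> hx hy [a [b [ha hb ->]]] lx ly hlx hly.
have e0 : 0 < (2^-1 : R) ^+ k by rewrite exprn_gt0 // invr_gt0.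
have E : 2 ^- k = (2^-1 ^+ k : R)%:C by rewrite rmorphXn fmorphV /= rmorph_nat exprVn.
have -> : w + x%:C * d + y%:C * d' + a%:C * (d / 2 ^+ k) + b%:C * (d' / 2 ^+ k)
   - (w + lx%:C * d + ly%:C * d') =
  (x + a * 2^-1 ^+ k - lx)%:C * d + (y + b * 2^-1 ^+ k - ly)%:C * d'.
  by rewrite E !rmorphB !rmorphD !rmorphM /=; ring.
rewrite (le_trans (normcD _ _)) // !normcM !normc_real mulrDl.
move: ha hb hlx hly => /andP[a0 a1] /andP[b0 b1] /andP[l1 l2] /andP[l3 l4].
set e := (2^-1 : R) ^+ k in e0 l2 l4 *.
have ae : a * e <= e by rewrite ger_pMl.
have be : b * e <= e by rewrite ger_pMl.
have ae0 : 0 <= a * e by rewrite mulr_ge0 // ltW.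
have be0 : 0 <= b * e by rewrite mulr_ge0 // ltW.
by rewrite lerD // mulrC ler_wpM2l ?normc_ge0 // ler_norml; apply/andP; split; lra.
Qed.

(** Bisection: if the boundary sums are not eventually small, nested parallelograms shrink to a
    point with sums of order [4 ^ (- k)], while differentiability there and [bsum_affine] make them
    smaller. *)
Lemma goursat g w d d' : (forall z, in_para w d d' z -> cdiff g z) ->
  forall e : R, 0 < e ->
  exists n0, forall n, (n0 <= n)%N -> normc (bsum n g w d d') <= e.
Proof.
move=> hg e e0; apply: contrapT => hn.
(* [p] locates the corner of a parallelogram of level [k]. Requiring arbitrarily large [n] lets each
   bisection lower [n] by one. *)
pose bad k (p : R * R) := forall n0, exists2 n, (n0 <= n)%N &
  e * (4^-1) ^+ k < normc (bsum n g (w + p.1%:C * d + p.2%:C * d')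
    (d / 2 ^+ k) (d' / 2 ^+ k)).
have bad0 : bad 0%N (0, 0).
  move=> n0; apply: contrapT => h; apply: hn; exists n0 => n hnn.
  rewrite leNgt; apply/negP => h2; apply: h; exists n => //.
  by rewrite !expr0 !divr1 mulr1 !mul0r !addr0.
have badS k p : exists p' : R * R, bad k p -> [/\ bad k.+1 p',
    p.1 <= p'.1 <= p.1 + 2^-1 ^+ k.+1 & p.2 <= p'.2 <= p.2 + 2^-1 ^+ k.+1].
  have [hb|] := pselect (bad k p); last by move=> h; exists p.
  set t : R := 2^-1 ^+ k.+1.
  have t0 : 0 < t by rewrite exprn_gt0 // invr_gt0.
  have tC : t%:C = (2 ^+ k.+1)^-1 by rewrite rmorphXn fmorphV /= rmorph_nat exprVn.
  apply: contrapT => hno.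
  have sub (a b : bool) : exists n0, forall n, (n0 <= n)%N ->
      normc (bsum n g (w + p.1%:C * d + p.2%:C * d' + (a%:R * (d / 2 ^+ k.+1)) +
         (b%:R * (d' / 2 ^+ k.+1))) (d / 2 ^+ k.+1) (d' / 2 ^+ k.+1))
      <= e * (4^-1) ^+ k.+1.
    apply: contrapT => h; apply: hno.
    exists (p.1 + a%:R * t, p.2 + b%:R * t) => _; split => /=.
    - move=> n0; apply: contrapT => h2; apply: h; exists n0 => n hnn.
      rewrite leNgt; apply/negP => h3; apply: h2; exists n => //=.
      move: h3; congr (_ < normc (bsum n g _ _ _)).
      by rewrite !rmorphD !rmorphM /= !rmorph_nat tC; ring.
    - by case: a {h}; rewrite ?mul1r ?mul0r ?addr0 ?lexx ?lerDl ?ltW.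
    - by case: b {h}; rewrite ?mul1r ?mul0r ?addr0 ?lexx ?lerDl ?ltW.
  have [n1 h1] := sub false false; have [n2 h2] := sub true false.
  have [n3 h3] := sub false true; have [n4 h4] := sub true true.
  (* If none of the four quarters were bad, their bounds would add up to the bound for the whole. *)
  have [[//|n]] := hb (maxn n1 (maxn n2 (maxn n3 n4))).+1.
  rewrite ltnS !geq_max => /and4P[/h1 {}h1 /h2 {}h2 /h3 {}h3 /h4 {}h4].
  apply/negP; rewrite -leNgt bsum_split.
  have E x : x / 2 ^+ k / 2 = x / 2 ^+ k.+1 :> R[i] by rewrite exprS; field.
  rewrite !E; move: h1 h2 h3 h4; rewrite !mul1r !mul0r !addr0 (exprS (4^-1 : R)).
  move=> h1 h2 h3 h4.
  rewrite (le_trans (normcD _ _)) // (le_trans (lerD (normcD _ _) (lexx _))) //.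
  rewrite (le_trans (lerD (lerD (normcD _ _) (lexx _)) (lexx _))) //.
  have E4 : e * (4^-1 * (4^-1) ^+ k) * 4 = e * (4^-1) ^+ k by field.
  lra.
have [nx hnx] := choice (fun kp : nat * (R * R) => badS kp.1 kp.2).
pose P := fix P k := if k is k'.+1 then nx (k', P k') else (0, 0).
have hP k : bad k (P k) by elim: k => // k ih; have [] := hnx (k, P k) ih.
have [lx lx01 hlx] := @nested_dyadic (fun k => (P k).1) erefl
  (fun k => let: And3 _ h _ := hnx (k, P k) (hP k) in h).
have [ly ly01 hly] := @nested_dyadic (fun k => (P k).2) erefl
  (fun k => let: And3 _ _ h := hnx (k, P k) (hP k) in h).
set c := w + lx%:C * d + ly%:C * d'.
have [b hb] : cdiff g c by apply: hg; exists lx, ly.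
set D := normc d + normc d'.
have D0 : 0 <= D by rewrite addr_ge0 ?normc_ge0.
(* At scale [q] the remainder is at most this constant times [D q]; [bsum_bound] multiplies it by
   [2 D q], giving less than [e q ^+ 2]. *)
have e10 : 0 < e / (2 * (D ^+ 2 + 1)).
  by rewrite divr_gt0 // mulr_gt0 // ltr_wpDl ?sqr_ge0.
have [r r0 hr] := hb _ e10.
have [k hk] : exists k, D * 2^-1 ^+ k < r.
  have : ((fun k => D * 2^-1 ^+ k) @ \oo --> D * (0:R))%classic.
    by apply: cvgZr; apply: cvg_expr; rewrite ger0_norm ?invr_ge0 // invf_lt1 // ltr1n.
  rewrite mulr0 => /cvgrPdist_lt /(_ _ r0)[k _ hk]; exists k.
  have := hk k (leqnn k); rewrite /= sub0r normrN; apply: le_lt_trans.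
  exact: ler_norm.
have [n _] := hP k 0%N; apply/negP; rewrite -leNgt.
have x01 : 0 <= (P k).1 <= 1.
  have /andP[h1 _] := hlx k; case/andP: lx01 => _ h2; rewrite (le_trans h1 h2) andbT.
  elim: (k) => // j ih; apply: (le_trans ih).
  by have [_ /andP[]] := hnx (j, P j) (hP j).
have y01 : 0 <= (P k).2 <= 1.
  have /andP[h1 _] := hly k; case/andP: ly01 => _ h2; rewrite (le_trans h1 h2) andbT.
  elim: (k) => // j ih; apply: (le_trans ih).
  by have [_ _ /andP[]] := hnx (j, P j) (hP j).
set w' := w + _ + _.
rewrite -[bsum _ _ _ _ _]subr0.
rewrite -(bsum_affine n b (g c - b * c) w' (d / 2 ^+ k) (d' / 2 ^+ k)) -bsumB.
set q := (2^-1 : R) ^+ k.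
have q0 : 0 <= q by rewrite exprn_ge0 // invr_ge0.
rewrite (le_trans (@bsum_bound n _ _ _ _ (e / (2 * (D ^+ 2 + 1)) * (D * q)) _)) //.
  move=> z hz; have hz' := para_sub x01 y01 hz (hlx k) (hly k).
  have := hr (z - c) (le_lt_trans hz' hk).
  have -> : c + (z - c) = z by ring.
  have -> : g z - (b * z + (g c - b * c)) = g z - g c - b * (z - c) by ring.
  by move=> h; apply: (le_trans h); rewrite ler_wpM2l // ltW.
have nq x : normc (x / 2 ^+ k) = normc x * q.
  by rewrite normcM normcV normcX normc_nat /q exprVn.
rewrite !nq -mulrDl -/D.
have E4 : (4^-1 : R) ^+ k = q * q.
  by rewrite /q -exprMn; congr (_ ^+ _); field.
rewrite E4.
have F : e / (2 * (D ^+ 2 + 1)) * (2 * (D ^+ 2 + 1)) = e.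
  by rewrite divfK // mulf_neq0 // gt_eqF // ltr_wpDl ?sqr_ge0.
move: e10 F; set E1 := e / _ => e10 F; rewrite -[in leRHS]F.
have h0 : 0 <= E1 * (q * q) := mulr_ge0 (ltW e10) (mulr_ge0 q0 q0).
have -> : 2 * (E1 * (D * q)) * (D * q) = 2 * (E1 * (q * q)) * (D ^+ 2) by ring.
have -> : E1 * (2 * (D ^+ 2 + 1)) * (q * q) = 2 * (E1 * (q * q)) * (D ^+ 2 + 1) by ring.
by rewrite ler_wpM2l ?lerDl //; have := h0; lra.
Qed.

End Goursat.

Section MeanValue.
Variable R : realType.
Implicit Types (g : R[i] -> R[i]) (a w z : R[i]).

Let avg n g (a : R[i]) (x : R) : R[i] :=
  (2 ^+ n)^-1 * \sum_(0 <= j < (2 ^ n)%N)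
    g (a + cexp (x%:C + ('i%C * (pi *+ 2)%:C) * (j%:R / 2 ^+ n))).

Lemma cexp_2pi z : cexp (z + 'i%C * (pi *+ 2)%:C) = cexp z :> R[i].
Proof.
by rewrite cexpD cexp_i cos2pi sin2pi complexr0 mulr1.
Qed.

(* Goursat's theorem for w |-> g (a + exp w) on [x, 0] x [0, 2 pi]: the two
   horizontal sides cancel by periodicity, so that the averages of g over two
   concentric circles agree, and those over small circles tend to g a. *)
Lemma circle_max_modulus g a (r M : R) : 0 < r ->
  (forall z, normc (z - a) <= r -> cdiff g z) ->
  (forall z, normc (z - a) = r -> normc (g z) <= M) -> normc (g a) <= M.
Proof.
move=> r0 hg hM; apply/ler_addgt0Pr => e e0.
have e2 : 0 < e / 2 by rewrite divr_gt0.
have : cdiff g a by apply: hg; rewrite subrr normc0 ltW.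
move=> /cdiff_cont /(_ _ e2)[r1 r10 hr1].
(* Logarithms of the outer radius and of an inner radius on which [g] is within [e / 2] of [g a]. *)
pose x2 := ln r; pose x1 := Num.min x2 (ln (r1 / 2)).
pose d2 : R[i] := 'i%C * (pi *+ 2)%:C.
pose G w := g (a + cexp w).
have Re2 (x y : R) : normc (cexp (x%:C + d2 * y%:C)) = expR x.
  by rewrite normc_cexp; congr expR; rewrite /d2 /=; ring.
have x12 : x1 <= x2 by rewrite ge_min lexx.
have Gd z : in_para x1%:C (x2 - x1)%:C d2 z -> cdiff G z.
  move=> [s [t [/andP[s0 s1] _ ->]]].
  apply: (@cdiff_comp _ g (fun w => a + cexp w)).
    by apply: cdiffD; [exact: cdiff_cst|exact: cdiff_cexp].
  apply: hg; rewrite addrC addKr (mulrC t%:C) -rmorphM -rmorphD Re2.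
  rewrite -[leRHS](lnK (_ : r \is Num.pos)) // ler_expR.
  have : s * (x2 - x1) <= x2 - x1 by rewrite ler_piMl // subr_ge0.
  by rewrite /x2; lra.
have p20 : 0 < pi *+ 2 :> R by rewrite mulrn_wgt0 // pi_gt0.
have nd2 : normc d2 = pi *+ 2.
  by rewrite /d2 normcM normc_real ger0_norm ?(ltW p20) //= expr0n expr1n add0r sqrtr1 mul1r.
have ee : 0 < e / 2 * (pi *+ 2) by rewrite mulr_gt0.
have [n hn] := goursat Gd ee.
have := hn n (leqnn n).
have Gper w : G (w + d2) = G w by rewrite /G cexp_2pi.
have -> : bsum n G x1%:C (x2 - x1)%:C d2 = d2 * (avg n g a x2 - avg n g a x1).
  rewrite /bsum.
  have -> : rsum n G (x1%:C + d2) (x2 - x1)%:C = rsum n G x1%:C (x2 - x1)%:C.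
    by congr (_ * _); apply: eq_bigr => j _; rewrite addrAC Gper.
  have -> : x1%:C + (x2 - x1)%:C = x2%:C :> R[i] by rewrite -rmorphD addrC subrK.
  have E x : rsum n G x%:C d2 = d2 * avg n g a x by rewrite /rsum /avg mulrA.
  by rewrite !E; ring.
rewrite normcM nd2 mulrC ler_pM2r // => hav.
have p0 : 0 < 2 ^+ n :> R by rewrite exprn_gt0.
have avgB x (c : R[i]) (B : R) :
   (forall z, normc (z - a) = expR x -> normc (g z - c) <= B) ->
   normc (avg n g a x - c) <= B.
  move=> h; rewrite /avg.
  have -> : c = (2 ^+ n)^-1 * \sum_(0 <= j < (2 ^ n)%N) c.
    rewrite sumr_const_nat subn0 -(mulr_natr c) natrX.
    have q0 : 2 ^+ n != 0 :> R[i] by rewrite expf_neq0 // pnatr_eq0.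
    by field.
  rewrite -mulrBr -sumrB normcM normcV normcX normc_nat mulrC ler_pdivrMr //.
  rewrite (le_trans (normc_sum _ _ _)) //.
  have -> : B * 2 ^+ n = \sum_(0 <= j < (2 ^ n)%N) B.
    by rewrite sumr_const_nat subn0 -(mulr_natr B) natrX.
  apply: ler_sum => j _; apply: h.
  have -> : j%:R / 2 ^+ n = (j%:R / 2 ^+ n : R)%:C.
    by rewrite rmorphM fmorphV rmorphXn /= !rmorph_nat.
  by rewrite addrC addKr Re2.
have h2 : normc (avg n g a x2) <= M.
  rewrite -(subr0 (avg _ _ _ _)); apply: avgB => z; rewrite subr0.
  by rewrite lnK // => /hM.
have h1 : normc (avg n g a x1 - g a) <= e / 2.
  apply: avgB => z hz.
  have -> : z = a + (z - a) by rewrite addrC subrK.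
  apply: ltW; apply: hr1; rewrite hz (@le_lt_trans _ _ (r1 / 2)) //; last by lra.
  rewrite -[leRHS](lnK (_ : r1 / 2 \is Num.pos)) ?posrE ?divr_gt0 //.
  by rewrite ler_expR ge_min lexx orbT.
have -> : g a = avg n g a x2 - (avg n g a x2 - avg n g a x1) - (avg n g a x1 - g a).
  by ring.
have := normcB (avg n g a x2 - (avg n g a x2 - avg n g a x1)) (avg n g a x1 - g a).
have := normcB (avg n g a x2) (avg n g a x2 - avg n g a x1).
lra.
Qed.

End MeanValue.

(** * Uniqueness of continuation for limits of holomorphic functions *)

Section Continuation.
Variable R : realType.
Implicit Types (f g : R[i] -> R[i]) (a w z : R[i]).

(** Uniform approximability on discs of radius 1/4 replaces holomorphy of [f]. The margins keep
    these discs inside [Re z > 1 / 8], [Im z > T]. *)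
Definition approx_holo f (T : R) := forall a, 3 / 8 < Re a -> T + 1 / 4 < Im a ->
  forall e : R, 0 < e -> exists g, forall z, normc (z - a) <= 1 / 4 ->
    cdiff g z /\ normc (g z - f z) <= e.

(* The entire weight exp (lam (w + 2 w ^ 2)), w = z - a, is 1 at a and tends to
   0 with lam on the part Re w <= 1/16 of the circle |w| = 1/4; on the other
   part f vanishes. *)
Lemma continuation_step f (T c : R) : approx_holo f T -> 7 / 16 <= c ->
  (forall z, c < Re z -> T < Im z -> f z = 0) ->
  forall a, c - 1 / 16 < Re a -> T + 1 / 4 < Im a -> f a = 0.
Proof.
move=> hf hc f0 a ha1 ha2.
have [|hac] := ltP c (Re a); first by move=> h; apply: f0 => //; lra.
have ha3 : 3 / 8 < Re a by lra.
have r0 : 0 < 1 / 4 :> R by lra.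
have [B hB] : exists B : R, forall z, normc (z - a) = 1 / 4 -> normc (f z) <= B.
  have [g hg] := hf a ha3 ha2 1 ltr01.
  have [|B hB] := @cdiff_bounded_circle _ g a (1 / 4) r0.
    by move=> z hz; have [] := hg z; rewrite ?hz.
  exists (B + 1) => z hz.
  have [_ h] := hg z (eq_ind_r (fun x => x <= 1 / 4) (lexx _) hz).
  rewrite -(subrK (g z) (f z)) (le_trans (normcD _ _)) // addrC lerD ?hB //.
  by rewrite normcBC.
have B0 : 0 <= `|B| := normr_ge0 B.
(* The approximating [g] is chosen after [lam], so its error may be multiplied by [expR lam]. *)
have key (lam e : R) : 0 < lam -> 0 < e ->
    normc (f a) <= `|B| * expR (- (3 / 64 * lam)) + e.
  move=> l0 e0.
  have ex0 := expR_gt0 lam.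
  have e10 : 0 < e / (expR lam + 2) by rewrite divr_gt0 // addr_gt0.
  have [g hg] := hf a ha3 ha2 _ e10; set e1 := e / _ in e10 hg.
  have He1 : e1 * (expR lam + 2) = e by rewrite /e1 divfK // gt_eqF // addr_gt0.
  pose q z := cexp (lam%:C * ((z - a) + 2 * (z - a) * (z - a))).
  have qd z : cdiff q z.
    rewrite /q; apply: (@cdiff_comp _ (@cexp R)); last exact: cdiff_cexp.
    have Ea : (fun z => z - a) = (fun z => 1 * z + (- a)) by apply: funext => y; ring.
    apply: cdiffM; first exact: cdiff_cst.
    apply: cdiffD; first by rewrite Ea; exact: cdiff_affine.
    apply: cdiffM; last by rewrite Ea; exact: cdiff_affine.
    apply: cdiffM; first exact: cdiff_cst.
    by rewrite Ea; exact: cdiff_affine.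
  have qa : q a = 1 by rewrite /q subrr !mulr0 addr0 mulr0 cexp0.
  (* On this circle [x ^+ 2 + y ^+ 2 = 1 / 16], hence the real part [x + 2 (x ^+ 2 - y ^+ 2)] equals
     [x + 4 x ^+ 2 - 1 / 8]. *)
  have nq z : normc (z - a) = 1 / 4 -> normc (q z) =
      expR (lam * (Re (z - a) + 4 * Re (z - a) ^+ 2 - 1 / 8)).
    move=> hz; have := normc_sqr (z - a); rewrite hz /q normc_cexp.
    case: (z - a) => x y /= h; congr expR.
    have -> : 1 / 8 = 2 * (x ^+ 2 + y ^+ 2) by rewrite -h; field.
    ring.
  have M0 : 0 <= `|B| * expR (- (3 / 64 * lam)) by rewrite mulr_ge0 ?expR_ge0.
  have : normc (g a * q a) <= `|B| * expR (- (3 / 64 * lam)) + e1 * (expR lam + 1).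
    apply: (@circle_max_modulus _ (fun z => g z * q z) a (1 / 4)) => //.
      by move=> z hz; apply: cdiffM => //; have [] := hg z hz.
    move=> z hz; rewrite normcM.
    have [_ h] := hg z (eq_ind_r (fun x => x <= 1 / 4) (lexx _) hz).
    have gz : normc (g z) <= normc (f z) + e1.
      by rewrite -(subrK (f z) (g z)) (le_trans (normcD _ _)) // addrC lerD.
    have x1 := normr_Re (z - a); rewrite hz ler_norml in x1.
    case/andP: x1 => x1 x2.
    have [cz|cz] := ltP c (Re z).
      have fz : f z = 0.
        apply: f0 => //; have := normr_Im (z - a); rewrite hz ler_norml.
        by rewrite raddfB /= => /andP[]; lra.
      rewrite fz normc0 add0r in gz.
      apply: (@le_trans _ _ (e1 * expR lam)).
        apply: ler_pM; rewrite ?normc_ge0 // nq // ler_expR.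
        rewrite -[leRHS]mulr1 ler_wpM2l ?(ltW l0) //; nra.
      by rewrite mulrDr mulr1 ler_wpDl // lerDl ltW.
    have xz : Re (z - a) <= 1 / 16 by rewrite raddfB /=; lra.
    have qz : normc (q z) <= expR (- (3 / 64 * lam)).
      rewrite nq // ler_expR.
      (* On [[-1 / 4, 1 / 16]] the convex function [x + 4 x ^+ 2] is largest at the right end, with
         value 5/64. *)
      have : Re (z - a) + 4 * Re (z - a) ^+ 2 - 1 / 8 <= - (3 / 64) by nra.
      by move=> /(ler_wpM2l (ltW l0)); lra.
    have qz1 : normc (q z) <= 1.
      by rewrite (le_trans qz) // expR_le1; lra.
    have fB : normc (f z) <= `|B| by rewrite (le_trans (hB z hz)) // ler_norm.
    apply: (@le_trans _ _ ((normc (f z) + e1) * normc (q z))).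
      by rewrite ler_wpM2r ?normc_ge0.
    have h1 : normc (f z) * normc (q z) <= `|B| * expR (- (3 / 64 * lam)).
      by rewrite ler_pM ?normc_ge0.
    have h2 : e1 * normc (q z) <= e1 * 1 by rewrite ler_wpM2l ?(ltW e10).
    have h3 : 0 <= e1 * expR lam by rewrite mulr_ge0 ?ltW.
    by rewrite mulrDl; lra.
  rewrite qa mulr1 => hga.
  have [|_ h] := hg a; first by rewrite subrr normc0 ltW.
  rewrite -(subrK (g a) (f a)) (le_trans (normcD _ _)) // normcBC.
  by rewrite -He1; lra.
apply/eqP; rewrite -normc_eq0 eq_le normc_ge0 andbT; apply/ler_addgt0Pr => e e0.
rewrite add0r.
have e2 : 0 < e / 2 by rewrite divr_gt0.
(* Large enough for [1 + x <= expR x] to make the weighted bound at most [e / 2]. *)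
pose lam := 64 / 3 * (`|B| / (e / 2)) + 1.
have l0 : 0 < lam by rewrite /lam ltr_wpDl // mulr_ge0 // ?divr_ge0 // ltW.
have := key lam _ l0 e2.
have h1 := expR_ge1Dx (3 / 64 * lam).
have : expR (3 / 64 * lam) * expR (- (3 / 64 * lam)) = 1 by rewrite expRxMexpNx_1.
have p0 := expR_gt0 (- (3 / 64 * lam)).
have h2 : `|B| <= (e / 2) * (1 + 3 / 64 * lam).
  have -> : e / 2 * (1 + 3 / 64 * lam) = `|B| + e / 2 * (67 / 64).
    by rewrite /lam; field; rewrite gt_eqF.
  by rewrite lerDl mulr_ge0 // ltW.
move=> h3 h4.
have : `|B| * expR (- (3 / 64 * lam)) <= e / 2.
  apply: (@le_trans _ _ (e / 2 * expR (3 / 64 * lam) * expR (- (3 / 64 * lam)))).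
    rewrite ler_wpM2r ?(ltW p0) // (le_trans h2) // ler_wpM2l // ltW //.
  by rewrite -mulrA h3 mulr1.
lra.
Qed.

Lemma continuation f (T : R) : approx_holo f T ->
  (forall z, 1 < Re z -> T < Im z -> f z = 0) ->
  forall z, 1 / 2 <= Re z -> T + 9 / 4 < Im z -> f z = 0.
Proof.
move=> hf f0.
have step k : (k <= 9)%N -> forall z, 1 - k%:R / 16 < Re z ->
    T + k%:R / 4 < Im z -> f z = 0.
  elim: k => [_ z|k ih hk z].
    by rewrite !mul0r subr0 addr0; exact: f0.
  have hk8 : k%:R <= 8 :> R by rewrite ler_nat -ltnS.
  have ih' := ih (ltnW hk).
  have hf' : approx_holo f (T + k%:R / 4).
    move=> a h1 h2; apply: hf => //; have := ler0n R k; lra.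
  move=> h1 h2; apply: (@continuation_step f (T + k%:R / 4) (1 - k%:R / 16)) => //.
  - lra.
  - by move: h1; rewrite -natr1; lra.
  - by move: h2; rewrite -natr1; lra.
by move=> z h1 h2; apply: (step 9%N) => //; lra.
Qed.

End Continuation.

(** * Approximating zeta by Dirichlet polynomials *)

Section DirichletSums.
Variable R : realType.
Implicit Types (z w s : R[i]) (a : nat -> R[i]).

Definition npow s (m : nat) : R[i] := cpow m%:R (- s).

Lemma npow1 s : npow s 1 = 1.
Proof. exact: cpow1. Qed.

Lemma npowM s m n : (0 < m)%N -> (0 < n)%N -> npow s (m * n) = npow s m * npow s n.
Proof. by move=> m0 n0; rewrite /npow natrM cpowM ?ltr0n. Qed.

Lemma npowX s m n : (0 < m)%N -> npow s (m ^ n) = npow s m ^+ n.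
Proof.
move=> m0; elim: n => [|n ih]; first by rewrite expn0 npow1 expr0.
by rewrite expnS npowM ?expn_gt0 ?m0 // ih exprS.
Qed.

Lemma npowD s w m : npow (s + w) m = npow s m * npow w m.
Proof. by rewrite /npow opprD cpowDr. Qed.

Lemma normc_npow s m : (0 < m)%N -> normc (npow s m) = m%:R `^ (- Re s).
Proof. by move=> m0; rewrite /npow normc_cpow ?ltr0n // raddfN. Qed.

Definition dsum a s (X : nat) : R[i] := \sum_(1 <= m < X.+1) a m * npow s m.

Lemma sum_dvdn (T : nmodType) (F : nat -> T) (q X : nat) : (0 < q)%N ->
  \sum_(1 <= m < X.+1 | (q %| m)%N) F m =
  \sum_(1 <= u < (X %/ q).+1) F (q * u)%N.
Proof.
move=> q0; elim: X => [|X ih]; first by rewrite div0n !big_geq.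
rewrite big_mkcond big_nat_recr //= -big_mkcond ih divnS //.
case: ifPn => h; last by rewrite add0n addr0.
rewrite (_ : (true + X %/ q = (X %/ q).+1)%N) // [in RHS]big_nat_recr //=.
by congr (_ + F _); rewrite -{1}(divnK h) mulnC divnS // h.
Qed.

(** Multiplication of a Dirichlet series by [1 - c q ^ (- s)], exact for partial sums once the
    second one stops at [X %/ q]. It serves for the Euler factors and for [1 - 2 ^ (1 - s)]. *)
Lemma dsum_sieve a s (c : R[i]) (q X : nat) : (0 < q)%N ->
  dsum (fun m => a m - c * (if (q %| m)%N then a (m %/ q)%N else 0)) s X =
  dsum a s X - c * npow s q * dsum a s (X %/ q).
Proof.
move=> q0; rewrite /dsum.
have -> : \sum_(1 <= m < (X %/ q).+1) a m * npow s m =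
  \sum_(1 <= m < (X %/ q).+1) a ((q * m) %/ q)%N * npow s m.
  by apply: eq_bigr => m _; rewrite mulKn.
rewrite big_distrr /=.
have -> : \sum_(1 <= i < (X %/ q).+1)
    c * npow s q * (a (q * i %/ q)%N * npow s i) =
  \sum_(1 <= i < (X %/ q).+1) c * a (q * i %/ q)%N * npow s (q * i).
  rewrite !big_nat; apply: eq_bigr => i /andP[i0 _].
  by rewrite npowM //; ring.
rewrite -(@sum_dvdn _ (fun m => c * a (m %/ q)%N * npow s m)) //.
rewrite [X in _ - X]big_mkcond /= -sumrB; apply: eq_bigr => m _.
by case: ifP => _; ring.
Qed.

Lemma cseq_limB (u v : nat -> R[i]) (x y : R[i]) :
  cseq_lim u x -> cseq_lim v y -> cseq_lim (fun n => u n - v n) (x - y).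
Proof.
move=> hu hv e e0; have e2 : 0 < e / 2 by rewrite divr_gt0.
have [N1 h1] := hu _ e2; have [N2 h2] := hv _ e2.
exists (maxn N1 N2) => n; rewrite geq_max => /andP[/h1 {}h1 /h2 {}h2].
have -> : u n - v n - (x - y) = (u n - x) - (v n - y) by ring.
by rewrite (le_lt_trans (normcB _ _)) // (splitr e) ltrD.
Qed.

Lemma cseq_limZ (c : R[i]) (u : nat -> R[i]) (x : R[i]) :
  cseq_lim u x -> cseq_lim (fun n => c * u n) (c * x).
Proof.
move=> hu e e0; have c0 : 0 < normc c + 1 by rewrite ltr_wpDl ?normc_ge0.
have [N h] := hu _ (divr_gt0 e0 c0); exists N => n /h.
rewrite -mulrBr normcM ltr_pdivlMr // => h1.
have := normc_ge0 (u n - x); nra.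
Qed.

Lemma cseq_lim_divn (u : nat -> R[i]) (x : R[i]) q : (0 < q)%N ->
  cseq_lim u x -> cseq_lim (fun n => u (n %/ q)%N) x.
Proof.
move=> q0 hu e e0; have [N h] := hu _ e0; exists (N * q)%N => n hn.
by apply: h; rewrite leq_divRL.
Qed.

Lemma cseq_lim_eq (u v : nat -> R[i]) (x : R[i]) :
  u =1 v -> cseq_lim u x -> cseq_lim v x.
Proof.
by move=> uv hu e e0; have [N h] := hu _ e0; exists N => n /h; rewrite uv.
Qed.

Lemma cseq_lim_norm (u : nat -> R[i]) (x : R[i]) (B : R) (N : nat) :
  cseq_lim u x -> (forall n, (N <= n)%N -> normc (u n) <= B) -> normc x <= B.
Proof.
move=> hu hB; apply/ler_addgt0Pr => e e0; have [N' h] := hu _ e0.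
have := h (maxn N N') (leq_maxr _ _); have := hB (maxn N N') (leq_maxl _ _).
set y := u _ => h1 h2.
have -> : x = y - (y - x) by ring.
by rewrite (le_trans (normcB _ _)) // lerD // ltW.
Qed.

Lemma cseq_lim_unique (u : nat -> R[i]) (x y : R[i]) :
  cseq_lim u x -> cseq_lim u y -> x = y.
Proof.
move=> hx hy; apply/eqP; rewrite -subr_eq0 -normc_eq0 eq_le normc_ge0 andbT.
have h := cseq_limB hx hy; apply: (cseq_lim_norm (N := 0%N) h) => n _.
by rewrite subrr normc0.
Qed.

Lemma cauchy_cseq_lim (u : nat -> R[i]) :
  (forall e : R, 0 < e -> exists N, forall n, (N <= n)%N ->
    normc (u n - u N) <= e) -> exists l, cseq_lim u l.
Proof.
move=> hu.
have key (v : nat -> R) : (forall n m, `|v n - v m| <= normc (u n - u m)) ->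
    cvgn v.
  move=> hv; apply: cauchy_cvg; apply/cauchy_ballP => e e0.
  have e4 : 0 < e / 2 / 2 by rewrite !divr_gt0.
  have [N hN] := hu _ e4.
  exists (v @` [set n | (N <= n)%N], v @` [set n | (N <= n)%N]).
    split; rewrite nbhs_filterE; exists N => // n /= hn; by exists n.
  move=> [_ _] [/= [n hn <-] [m hm <-]]; rewrite /ball /=.
  have -> : v n - v m = (v n - v N) - (v m - v N) by ring.
  rewrite (le_lt_trans (ler_normB _ _)) //.
  have h1 := le_trans (hv n N) (hN n hn); have h2 := le_trans (hv m N) (hN m hm).
  by lra.
have /cvg_ex[x hx] := key (fun n => Re (u n))
  (fun n m => eq_ind _ (fun t => `|t| <= _) (normr_Re _) _ (raddfB _ _ _)).
have /cvg_ex[y hy] := key (fun n => Im (u n))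
  (fun n m => eq_ind _ (fun t => `|t| <= _) (normr_Im _) _ (raddfB _ _ _)).
exists (x +i* y) => e e0; have e2 : 0 < e / 2 by rewrite divr_gt0.
move/cvgrPdist_lt: hx => /(_ _ e2)[N1 _ h1].
move/cvgrPdist_lt: hy => /(_ _ e2)[N2 _ h2].
exists (maxn N1 N2) => n; rewrite geq_max => /andP[/h1 /= {}h1 /h2 /= {}h2].
rewrite (le_lt_trans (normc_le_ReIm _)) // (splitr e) !raddfB /=.
by rewrite distrC (distrC (Im _)) ltrD.
Qed.

Definition primorial (Q : nat) : nat := \prod_(0 <= p < Q.+1 | prime p) p.

(** The Dirichlet coefficients of [eulerD Q s * zeta s]. *)
Definition cop (Q m : nat) : R[i] := (coprime m (primorial Q))%:R.

Definition eulerD (Q : nat) s : R[i] := \prod_(0 <= p < Q.+1 | prime p) (1 - npow s p).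

Lemma primorial_gt0 Q : (0 < primorial Q)%N.
Proof. by apply: prodn_cond_gt0 => p /prime_gt0. Qed.

Lemma primorialS Q : primorial Q.+1 =
  (if prime Q.+1 then primorial Q * Q.+1 else primorial Q)%N.
Proof.
rewrite /primorial big_mkcond big_nat_recr //= -big_mkcond /=.
by case: ifP => _; rewrite ?muln1.
Qed.

Lemma eulerDS Q s : eulerD Q.+1 s =
  if prime Q.+1 then eulerD Q s * (1 - npow s Q.+1) else eulerD Q s.
Proof.
rewrite /eulerD big_mkcond big_nat_recr //= -big_mkcond /=.
by case: ifP => _; rewrite ?mulr1.
Qed.

Lemma prime_dvd_primorial p Q : prime p -> (p %| primorial Q)%N = (p <= Q)%N.
Proof.
move=> pp; elim: Q => [|Q ih].
  by rewrite /primorial big_mkcond big_nat1 /= dvdn1 leqn0; case: p pp => [|[|]].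
rewrite primorialS leq_eqVlt ltnS; case: ifPn => pQ.
  by rewrite Euclid_dvdM // ih dvdn_prime2 // orbC.
rewrite ih; case: eqVneq => // pQ'; by rewrite -pQ' pp in pQ.
Qed.

Lemma coprime_primorialP m Q : (0 < m)%N ->
  reflect (forall p, prime p -> (p %| m)%N -> (Q < p)%N) (coprime m (primorial Q)).
Proof.
move=> m0; apply: (iffP idP) => [cm p pp pm|h].
  rewrite ltnNge -(prime_dvd_primorial _ pp); apply/negP => pQ.
  have : (p %| gcdn m (primorial Q))%N by rewrite dvdn_gcd pm.
  by rewrite (eqP cm) dvdn1; case: p pp {pm pQ} => [|[|]].
rewrite /coprime; apply/negP => /negP g1.
have g0 : (1 < gcdn m (primorial Q))%N.
  by rewrite ltn_neqAle eq_sym g1 gcdn_gt0 m0.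
have := h _ (pdiv_prime g0) (dvdn_trans (pdiv_dvd _) (dvdn_gcdl _ _)).
rewrite ltnNge -(prime_dvd_primorial _ (pdiv_prime g0)).
by rewrite (dvdn_trans (pdiv_dvd _) (dvdn_gcdr _ _)).
Qed.

Lemma copS Q m : prime Q.+1 -> (0 < m)%N ->
  cop Q.+1 m = cop Q m - 1 * (if (Q.+1 %| m)%N then cop Q (m %/ Q.+1) else 0).
Proof.
move=> pQ m0; rewrite /cop primorialS pQ coprimeMr mul1r.
rewrite (coprime_sym m Q.+1) (prime_coprime _ pQ).
case: ifPn => [dm|ndm]; last by rewrite andbT subr0.
rewrite andbF -{1}(divnK dm) coprimeMl (prime_coprime _ pQ).
rewrite (prime_dvd_primorial _ pQ) ltnn andbT.
by rewrite subrr.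
Qed.

Lemma eq_dsum a b s X : (forall m, (0 < m)%N -> a m = b m) -> dsum a s X = dsum b s X.
Proof.
by move=> h; rewrite /dsum !big_nat; apply: eq_bigr => m /andP[m0 _]; rewrite h.
Qed.

Lemma cop_lim (Q : nat) s x : cseq_lim (dsum (fun=> 1) s) x ->
  cseq_lim (dsum (cop Q) s) (eulerD Q s * x).
Proof.
move=> hx; elim: Q => [|Q ih].
  rewrite /eulerD big_mkcond big_nat1 /= !mul1r.
  apply: cseq_lim_eq hx => X; apply: eq_dsum => m m0.
  by rewrite /cop /primorial big_mkcond big_nat1 /= coprimen1.
rewrite eulerDS; case: ifPn => pQ; last first.
  apply: cseq_lim_eq ih => X; apply: eq_dsum => m m0.
  by rewrite /cop primorialS (negbTE pQ).
have -> : eulerD Q s * (1 - npow s Q.+1) * x =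
  eulerD Q s * x - npow s Q.+1 * (eulerD Q s * x) by ring.
have := cseq_limB ih (cseq_limZ (npow s Q.+1) (cseq_lim_divn (ltn0Sn Q) ih)).
apply: cseq_lim_eq => X; rewrite -(mul1r (npow s Q.+1)) -dsum_sieve //.
by apply: eq_dsum => m m0; rewrite copS.
Qed.

End DirichletSums.

(** * Summation by parts with periodic coefficients *)

Section Periodic.
Variable R : realType.
Implicit Types (f : nat -> R).

Definition periodic0 (q : nat) f :=
  (forall m, f (m + q)%N = f m) /\ \sum_(0 <= m < q) f m = 0.

Lemma periodic_mod q f : (forall m, f (m + q)%N = f m) -> forall m, f m = f (m %% q)%N.
Proof.
move=> h m; rewrite {1}(divn_eq m q) addnC; elim: (m %/ q)%N => [|k ih].
  by rewrite mul0n addn0.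
by rewrite mulSn addnCA addnC h.
Qed.

Lemma periodic_bounded q f : (0 < q)%N -> (forall m, f (m + q)%N = f m) ->
  exists2 B : R, 0 <= B & forall m, `|f m| <= B.
Proof.
move=> q0 h; exists (\sum_(0 <= i < q) `|f i|); first exact: sumr_ge0.
move=> m; rewrite (periodic_mod h) big_mkord.
have hm : (m %% q < q)%N by rewrite ltn_mod.
by rewrite (bigD1 (Ordinal hm)) //= lerDl sumr_ge0.
Qed.

Lemma periodic_primitive q f : (0 < q)%N -> periodic0 q f ->
  exists2 g : nat -> R, periodic0 q g & forall m, g m.+1 - g m = f m.+1.
Proof.
move=> q0 [hf f0].
have shift k : \sum_(k <= i < k + q) f i = 0.
  elim: k => // k ih; move: ih; rewrite big_ltn; last by rewrite -{1}(addn0 k) ltn_add2l.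
  by rewrite addSn big_nat_recr /= ?hf 1?addrC // -addn1 leq_add2l.
pose g m := \sum_(0 <= i < m.+1) f i.
have hg m : g (m + q)%N = g m.
  rewrite /g (@big_cat_nat _ _ _ m.+1) //= ?ltnS ?leq_addr //.
  by rewrite -addSn shift addr0.
pose c := (q%:R)^-1 * \sum_(0 <= m < q) g m.
exists (fun m => g m - c); last first.
  move=> m; rewrite /g big_nat_recr //=; ring.
split=> [m|]; first by rewrite hg.
rewrite sumrB sumr_const_nat subn0 /c -mulrnAl -(mulr_natl q%:R^-1 q).
by rewrite divff ?mul1r ?subrr // pnatr_eq0 -lt0n.
Qed.

Lemma sum_by_parts (f g : nat -> R) (u : nat -> R[i]) (X Z : nat) : (X <= Z)%N ->
  (forall m, g m.+1 - g m = f m.+1) ->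
  \sum_(X.+1 <= m < Z.+1) (f m)%:C * u m =
  (g Z)%:C * u Z.+1 - (g X)%:C * u X.+1 +
  \sum_(X.+1 <= m < Z.+1) (g m)%:C * (u m - u m.+1).
Proof.
move=> XZ h; rewrite -(subnK XZ); elim: (Z - X)%N => [|k ih].
  by rewrite add0n !big_geq // subrr addr0.
have step (F : nat -> R[i]) : \sum_(X.+1 <= m < (k.+1 + X).+1) F m =
    \sum_(X.+1 <= m < (k + X).+1) F m + F (k + X).+1.
  by rewrite addSn big_nat_recr // ltnS leq_addl.
rewrite !step ih -h rmorphB addSn /=; ring.
Qed.

End Periodic.

Section Differences.
Variable R : realType.
Implicit Types (s : R[i]) (x : R).

Definition cder (f : R -> R[i]) (x : R) (d : R[i]) : Prop :=
  is_derive x 1 (fun y => Re (f y)) (Re d) /\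
  is_derive x 1 (fun y => Im (f y)) (Im d).

(** The mean value theorem gives different intermediate points for the real and the imaginary part;
    hence the factor 2. *)
Lemma cder_lipschitz (f : R -> R[i]) (df : R -> R[i]) (a b B : R) : a <= b ->
  (forall x, a <= x <= b -> cder f x (df x)) ->
  (forall x, a <= x <= b -> normc (df x) <= B) ->
  normc (f b - f a) <= 2 * B * (b - a).
Proof.
move=> ab hf hB; apply: (le_trans (normc_le_ReIm _)).
have ba : 0 <= b - a by rewrite subr_ge0.
have [c1 hc1 e1] := @mean_value _ (fun y => Re (f y)) (fun y => Re (df y)) a b ab
  (fun x hx => (hf x hx).1).
have [c2 hc2 e2] := @mean_value _ (fun y => Im (f y)) (fun y => Im (df y)) a b ab
  (fun x hx => (hf x hx).2).
rewrite !raddfB /= e1 e2 !normrM (ger0_norm ba).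
have := ler_wpM2r ba (le_trans (normr_Re _) (hB _ hc1)).
have := ler_wpM2r ba (le_trans (normr_Im _) (hB _ hc2)).
lra.
Qed.

Lemma cderB f g x d e : cder f x d -> cder g x e ->
  cder (fun y => f y - g y) x (d - e).
Proof.
move=> [h1 h2] [h3 h4]; split; rewrite raddfB /=.
  have -> : (fun y => Re (f y - g y)) = (fun y => Re (f y)) - (fun y => Re (g y)).
    by apply: funext => y; rewrite raddfB.
  exact: is_deriveB.
have -> : (fun y => Im (f y - g y)) = (fun y => Im (f y)) - (fun y => Im (g y)).
  by apply: funext => y; rewrite raddfB.
exact: is_deriveB.
Qed.

Lemma cderZ f x c d : cder f x d -> cder (fun y => c * f y) x (c * d).
Proof.
move=> [h1 h2]; split; rewrite ?ReM ?ImM.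
  have -> : (fun y => Re (c * f y)) =
      Re c *: (fun y => Re (f y)) - Im c *: (fun y => Im (f y)).
    by apply: funext => y; rewrite ReM.
  exact: is_deriveB (is_deriveZ _ h1) (is_deriveZ _ h2).
have -> : (fun y => Im (c * f y)) =
    Re c *: (fun y => Im (f y)) + Im c *: (fun y => Re (f y)).
  by apply: funext => y; rewrite ImM.
exact: is_deriveD (is_deriveZ _ h2) (is_deriveZ _ h1).
Qed.

Lemma cder_shift f x c d : cder f (x + c) d -> cder (fun y => f (y + c)) x d.
Proof.
have h (g : R -> R) e : is_derive (x + c) 1 g e -> is_derive x 1 (fun y => g (y + c)) e.
  move=> hg; have hs : is_derive x 1 (fun y => y + c) 1.
    by apply: is_derive_eq; rewrite addr0.
  by have := @is_derive1_comp _ g (fun y => y + c) x e 1 hg hs; rewrite mulr1.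
by move=> [h1 h2]; split; apply: (h (fun y => _ (f y))).
Qed.

Lemma cder_cpow s x : 0 < x -> cder (fun y => cpow y s) x (s * cpow x (s - 1)).
Proof.
move=> x0; case: s => a b.
have hl := is_derive1_ln x0.
have he : is_derive x 1 (fun y => expR (a * ln y)) (a * x^-1 * expR (a * ln x)).
  have h1 : is_derive x 1 (fun y => a * ln y) (a * x^-1).
    exact: (is_deriveZ a hl).
  have := @is_derive1_comp _ expR (fun y => a * ln y) x _ _ (is_derive_expR (a * ln x)) h1.
  by rewrite mulrC.
have hb : is_derive x 1 (fun y => b * ln y) (b * x^-1) by exact: (is_deriveZ b hl).
have hc : is_derive x 1 (fun y => cos (b * ln y)) (- sin (b * ln x) * (b * x^-1)).
  exact: (@is_derive1_comp _ cos (fun y => b * ln y) x _ _ (is_derive_cos (b * ln x)) hb).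
have hs : is_derive x 1 (fun y => sin (b * ln y)) (cos (b * ln x) * (b * x^-1)).
  exact: (@is_derive1_comp _ sin (fun y => b * ln y) x _ _ (is_derive_sin (b * ln x)) hb).
have -> : cpow x (a +i* b - 1) = (x^-1)%:C * cpow x (a +i* b).
  by rewrite cpowDr cpowN (_ : 1 = 1%:C) // cpow_real // powRr1 ?ltW // fmorphV mulrC.
have E y : cpow y (a +i* b) =
    (expR (a * ln y) * cos (b * ln y)) +i* (expR (a * ln y) * sin (b * ln y)).
  rewrite /cpow /cexp; apply: eqC; rewrite /=; do ?[rewrite !mulr0].
    by rewrite subr0 add0r mul0r subr0.
  by rewrite subr0 add0r mul0r addr0.
split.
  have -> : (fun y => Re (cpow y (a +i* b))) =
    (fun y => expR (a * ln y)) * (fun y => cos (b * ln y)).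
    by apply: funext => y; rewrite E.
  apply: (is_derive_eq (is_deriveM he hc)).
  by rewrite E /= /GRing.scale /=; ring.
have -> : (fun y => Im (cpow y (a +i* b))) =
  (fun y => expR (a * ln y)) * (fun y => sin (b * ln y)).
  by apply: funext => y; rewrite E.
apply: (is_derive_eq (is_deriveM he hs)).
by rewrite E /= /GRing.scale /=; ring.
Qed.

(** The k-th difference of [x ^ (- s)], which is what k summations by parts leave of it. *)
Fixpoint dpow (k : nat) s (x : R) : R[i] :=
  if k is k'.+1 then dpow k' s x - dpow k' s (x + 1) else cpow x (- s).

Lemma cder_dpow k s x : 0 < x -> cder (dpow k s) x (- s * dpow k (s + 1) x).
Proof.
elim: k x => [|k ih] x x0 /=.
  by rewrite opprD; exact: cder_cpow.
rewrite mulrBr; apply: cderB; first exact: ih.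
by apply: cder_shift; apply: ih; rewrite addr_gt0.
Qed.

(** The derivative of [dpow k s] is [- s * dpow k (s + 1)], so each difference gains a factor of
    order [normc s / x]. The induction moves from s to s + 1, which [L] absorbs; the 2 comes from
    [cder_lipschitz]. *)
Lemma dpow_bound (L k : nat) s x : (k <= L)%N -> 0 <= Re s -> 0 < x ->
  normc (dpow k s x) <= (2 * (normc s + L%:R) / x) ^+ k * x `^ (- Re s).
Proof.
suff h (A : R) : 0 <= Re s -> 0 < x -> 2 * (normc s + k%:R) <= A ->
    normc (dpow k s x) <= (A / x) ^+ k * x `^ (- Re s).
  move=> kL s0 x0; apply: h => //.
  by rewrite ler_wpM2l // lerD2l ler_nat.
elim: k s x A => [|k ih] s x A s0 x0 hA.
  by rewrite expr0 mul1r -/(cpow x (- s)) normc_cpow // raddfN.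
rewrite /= normcBC.
have A0 : 0 <= A by have := normc_ge0 s; have := ler0n R k.+1; lra.
pose B := normc s * ((A / x) ^+ k * x `^ (- Re s - 1)).
have xx : x <= x + 1 by rewrite lerDl.
have h : normc (dpow k s (x + 1) - dpow k s x) <= 2 * B * (x + 1 - x).
  apply: (@cder_lipschitz _ (fun y => - s * dpow k (s + 1) y)) => //.
    by move=> y /andP[xy _]; apply: cder_dpow; apply: lt_le_trans xy.
  move=> y /andP[xy _]; have y0 : 0 < y := lt_le_trans x0 xy.
  rewrite normcM normcN /B ler_wpM2l ?normc_ge0 //.
  apply: (@le_trans _ _ ((A / y) ^+ k * y `^ (- Re (s + 1)))).
    apply: ih => //; first by rewrite raddfD addr_ge0.
    have := normcD s 1; rewrite normc1; move: hA; rewrite -natr1; lra.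
  rewrite raddfD /= opprD.
  apply: ler_pM; rewrite ?exprn_ge0 ?divr_ge0 ?powR_ge0 ?(ltW y0) //.
    rewrite lerXn2r ?nnegrE ?divr_ge0 ?(ltW y0) ?(ltW x0) //.
    by rewrite ler_wpM2l // lef_pV2 ?posrE.
  have -> : - Re s - 1 = - (Re s + 1) by ring.
  rewrite !powRN lef_pV2 ?posrE ?powR_gt0 //.
  by apply: ge0_ler_powR; rewrite ?nnegrE ?(ltW x0) ?(ltW y0) // addr_ge0.
rewrite (le_trans h) // addrAC subrr add0r mulr1 /B exprS.
have E : x `^ (- Re s - 1) = x `^ (- Re s) / x.
  by rewrite powRB ?powRr1 ?(ltW x0) //; apply/implyP => _; rewrite gt_eqF.
rewrite E.
have p0 : 0 <= (A / x) ^+ k * (x `^ (- Re s) / x).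
  by rewrite mulr_ge0 ?exprn_ge0 ?divr_ge0 ?powR_ge0 ?(ltW x0).
have -> : A / x * (A / x) ^+ k * x `^ (- Re s) = A * ((A / x) ^+ k * (x `^ (- Re s) / x)).
  by ring.
rewrite mulrA ler_wpM2r //; have := ler0n R k.+1; lra.
Qed.

End Differences.

Section TailEstimate.
Variable R : realType.
Implicit Types (s : R[i]) (f : nat -> R).

Lemma sum_invsqr_tail (X Z : nat) : (0 < X)%N ->
  \sum_(X.+1 <= m < Z.+1) (m%:R ^- 2 : R) <= X%:R^-1.
Proof.
move=> X0; have [ZX|XZ] := leqP Z X.
  by rewrite big_geq // invr_ge0.
suff : \sum_(X.+1 <= m < Z.+1) (m%:R ^- 2 : R) <= X%:R^-1 - Z%:R^-1.
  by move=> h; apply: (le_trans h); rewrite gerBl invr_ge0.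
rewrite -(subnK (ltnW XZ)); elim: (Z - X)%N => [|k ih].
  by rewrite add0n big_geq // subrr.
rewrite addSn big_nat_recr ?ltnS ?leq_addl //=.
apply: (le_trans (lerD ih (lexx _))).
have k0 : 0 < (k + X)%:R :> R by rewrite ltr0n (leq_trans X0) // leq_addl.
rewrite -addrA lerD2l -[(k + X).+1%:R]natr1; set t := (k + X)%:R in k0 *; clearbody t.
have t1 : 0 < t + 1 by rewrite addr_gt0.
rewrite -subr_ge0.
have -> : - (t + 1)^-1 - (- t^-1 + (t + 1) ^- 2) = (t * (t + 1) ^+ 2)^-1.
  have tn : t != 0 by rewrite gt_eqF.
  have tn1 : t + 1 != 0 by rewrite gt_eqF.
  by field; rewrite ?tn ?tn1.
by rewrite invr_ge0 mulr_ge0 ?sqr_ge0 // ltW.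
Qed.

(** [(1 + y) ^+ L] covers the boundary terms of the summations by parts, [X y ^+ L] the sum left
    after [L] of them. The bracket stays bounded once [X] reaches the order of
    [normc s ^ (1 + 1 / (L - 1))]. *)
Definition tail_bound (L : nat) s (X : nat) : R :=
  let y := 2 * (normc s + L%:R) / X%:R in
  X%:R `^ (- Re s) * ((1 + y) ^+ L + X%:R * y ^+ L).

(* Summation by parts, L times: a primitive of a periodic sequence of mean zero
   can again be chosen periodic of mean zero. *)
Lemma periodic_tail (q L j : nat) f : (0 < q)%N -> (2 <= L)%N -> (j <= L)%N ->
  periodic0 q f -> exists2 C : R, 0 <= C & forall s (X Z : nat), 0 <= Re s ->
    (0 < X)%N -> (X <= Z)%N ->
    normc (\sum_(X.+1 <= m < Z.+1) (f m)%:C * dpow j s m%:R) <=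
    C * tail_bound L s X.
Proof.
move=> q0 L2 jL; rewrite -(subKn jL); move: (leq_subr j L).
(* Induction on [L - j]: for [j = L] the terms are summed absolutely, by comparison with [m ^- 2] as
   [2 <= L]; each further step sums by parts once. *)
elim: (L - j)%N f => [|k ih] f kL hf.
  rewrite subn0; have [B B0 hB] := periodic_bounded q0 hf.1.
  exists B => // s X Z s0 X0 XZ; set A := 2 * (normc s + L%:R).
  have A0 : 0 <= A by rewrite mulr_ge0 // addr_ge0 ?normc_ge0.
  have X0' : 0 < X%:R :> R by rewrite ltr0n.
  apply: (@le_trans _ _ (\sum_(X.+1 <= m < Z.+1)
      (B * (X%:R `^ (- Re s) * (A ^+ L / X%:R ^+ (L - 2)))) * m%:R ^- 2)).
    rewrite (le_trans (normc_sum _ _ _)) // !big_nat; apply: ler_sum => m /andP[Xm _].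
    have m0 : 0 < m%:R :> R by rewrite ltr0n (leq_trans _ Xm).
    have Xm' : X%:R <= m%:R :> R by rewrite ler_nat ltnW.
    rewrite normcM normc_real -mulrA ler_pM ?normc_ge0 //.
    apply: (le_trans (dpow_bound (leqnn L) s0 m0)); rewrite -/A mulrC -mulrA.
    apply: ler_pM; rewrite ?powR_ge0 ?exprn_ge0 ?divr_ge0 ?(ltW m0) //.
      rewrite !powRN lef_pV2 ?posrE ?powR_gt0 //.
      by apply: ge0_ler_powR; rewrite ?nnegrE ?(ltW X0') ?(ltW m0).
    rewrite expr_div_n -mulrA ler_wpM2l ?exprn_ge0 // -invfM.
    rewrite lef_pV2 ?posrE ?mulr_gt0 ?exprn_gt0 // -{2}(subnK L2) exprD.
    by rewrite ler_wpM2r ?exprn_ge0 ?(ltW m0) // lerXn2r ?nnegrE ?(ltW m0) ?(ltW X0').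
  rewrite -big_distrr /= -mulrA ler_wpM2l //.
  rewrite /tail_bound -/A -mulrA ler_wpM2l ?powR_ge0 //.
  have h := sum_invsqr_tail Z X0.
  have c0 : 0 <= A ^+ L / X%:R ^+ (L - 2).
    by rewrite divr_ge0 ?exprn_ge0 ?(ltW X0').
  apply: (le_trans (ler_wpM2l c0 h)).
  have -> : A ^+ L / X%:R ^+ (L - 2) / X%:R = X%:R * (A / X%:R) ^+ L.
    rewrite expr_div_n.
    have -> : X%:R ^+ L = X%:R ^+ (L - 2) * X%:R ^+ 2 :> R by rewrite -exprD subnK.
    have u0 : X%:R ^+ (L - 2) != 0 :> R by rewrite expf_neq0 // gt_eqF.
    have x0 : X%:R != 0 :> R by rewrite gt_eqF.
    by field; rewrite ?u0 ?x0.
  by rewrite lerDr exprn_ge0 // addr_ge0 // divr_ge0 ?(ltW X0').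
have [g hg hgf] := periodic_primitive q0 hf.
have [B B0 hB] := periodic_bounded q0 hg.1.
have [C C0 hC] := ih g (ltnW kL) hg.
have e1 : (L - k = (L - k.+1).+1)%N by rewrite subnSK.
move: (subnSK kL) hC; rewrite e1; set i := (L - k.+1)%N => _ hC.
exists (2 * B + C); first by rewrite addr_ge0 // mulr_ge0.
move=> s X Z s0 X0 XZ.
rewrite (sum_by_parts _ XZ hgf) mulrDl.
rewrite (le_trans (normcD _ _)) // lerD //; last first.
  have := hC s X Z s0 X0 XZ.
  rewrite (_ : \sum_(X.+1 <= m < Z.+1) (g m)%:C * dpow i.+1 s m%:R =
     \sum_(X.+1 <= m < Z.+1) (g m)%:C * (dpow i s m%:R - dpow i s m.+1%:R)) //.
  by apply: eq_bigr => m _; rewrite -[m.+1%:R]natr1.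
have iL : (i <= L)%N by rewrite leq_subr.
have X0' : 0 < X%:R :> R by rewrite ltr0n.
set A := 2 * (normc s + L%:R).
have A0 : 0 <= A by rewrite mulr_ge0 // addr_ge0 ?normc_ge0.
have y0 : 0 <= A / X%:R by rewrite divr_ge0 // ltW.
have hb m : (X <= m)%N -> normc ((g m)%:C * dpow i s m.+1%:R) <= B * tail_bound L s X.
  move=> Xm; rewrite normcM normc_real ler_pM ?normc_ge0 //.
  have m0 : 0 < m.+1%:R :> R by rewrite ltr0n.
  have Xm' : X%:R <= m.+1%:R :> R by rewrite ler_nat ltnW.
  apply: (le_trans (dpow_bound iL s0 m0)); rewrite -/A mulrC /tail_bound -/A.
  apply: ler_pM; rewrite ?powR_ge0 ?exprn_ge0 ?divr_ge0 ?(ltW m0) //.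
    rewrite !powRN lef_pV2 ?posrE ?powR_gt0 //.
    by apply: ge0_ler_powR; rewrite ?nnegrE ?(ltW X0') ?(ltW m0).
  apply: (@le_trans _ _ ((1 + A / X%:R) ^+ L)); last first.
    by rewrite lerDl mulr_ge0 ?exprn_ge0 // ltW.
  apply: (@le_trans _ _ ((1 + A / X%:R) ^+ i)); last first.
    by apply: ler_weXn2l => //; rewrite lerDl.
  rewrite lerXn2r ?nnegrE ?divr_ge0 ?addr_ge0 ?(ltW m0) //.
  apply: (@le_trans _ _ (A / X%:R)); last by rewrite lerDr.
  by rewrite ler_wpM2l // lef_pV2 ?posrE.
rewrite (le_trans (normcB _ _)) //.
have := hb Z XZ; have := hb X (leqnn X); lra.
Qed.

Lemma tail_bound_cvg0 L s : (0 < L)%N -> 0 < Re s -> forall e : R, 0 < e ->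
  exists2 N, (0 < N)%N & forall X, (N <= X)%N -> tail_bound L s X <= e.
Proof.
move=> L0 s0 e e0; set A := 2 * (normc s + L%:R).
have A0 : 0 <= A by rewrite mulr_ge0 // addr_ge0 ?normc_ge0.
set D := (1 + A) ^+ L + A ^+ L.
have D0 : 0 < D by rewrite ltr_pwDl ?exprn_ge0 ?exprn_gt0 // ltr_pwDl.
pose t := (D / e) `^ (Re s)^-1.
have t0 : 0 <= t by exact: powR_ge0.
exists (Num.truncn t).+1 => // X hX.
have X1 : 1 <= X%:R :> R by rewrite ler1n (leq_trans _ hX).
have X0 : 0 < X%:R :> R by rewrite (lt_le_trans ltr01).
have tX : t <= X%:R.
  by rewrite ltW // (lt_le_trans (truncnS_gt _)) // ler_nat.
have h1 : D / e <= X%:R `^ Re s.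
  have -> : D / e = t `^ Re s.
    by rewrite /t -powRrM mulVf ?gt_eqF // powRr1 // divr_ge0 // ltW.
  by apply: ge0_ler_powR; rewrite ?nnegrE // ltW.
rewrite /tail_bound -/A powRN mulrC ler_pdivrMr ?powR_gt0 //.
apply: (@le_trans _ _ D); last first.
  by rewrite mulrC -ler_pdivrMr.
have yA : A / X%:R <= A by rewrite ler_pdivrMr // ler_peMr.
have y0 : 0 <= A / X%:R by rewrite divr_ge0 // ltW.
rewrite /D lerD //.
  by rewrite lerXn2r ?nnegrE ?addr_ge0 // lerD2l.
rewrite -(prednK L0) exprS (exprS A) mulrA.
have -> : X%:R * (A / X%:R) = A by rewrite mulrC divfK // gt_eqF.
by rewrite ler_wpM2l // lerXn2r ?nnegrE.
Qed.

(** The limit [F] comes from Cauchy's criterion and choice, with no claim of holomorphy; the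
    explicit rate later provides [approx_holo]. *)
Lemma periodic_dsum_approx (q L : nat) f : (0 < q)%N -> (2 <= L)%N ->
  periodic0 q f -> exists2 C : R, 0 <= C & exists F : R[i] -> R[i],
    forall s, 0 < Re s -> cseq_lim (dsum (fun m => (f m)%:C) s) (F s) /\
      forall X, (0 < X)%N ->
        normc (F s - dsum (fun m => (f m)%:C) s X) <= C * tail_bound L s X.
Proof.
move=> q0 L2 hf; have [C C0 hC] := periodic_tail q0 L2 (leq0n L) hf.
have split_ (s : R[i]) X Z : (X <= Z)%N -> dsum (fun m => (f m)%:C) s Z -
    dsum (fun m => (f m)%:C) s X = \sum_(X.+1 <= m < Z.+1) (f m)%:C * dpow 0 s m%:R.
  by move=> XZ; rewrite /dsum (@big_cat_nat _ _ _ X.+1) //= addrAC subrr add0r.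
exists C => //.
have ex s : exists l, 0 < Re s -> cseq_lim (dsum (fun m => (f m)%:C) s) l.
  have [s0|] := ltP 0 (Re s); last by exists 0.
  have [e|l hl] := @cauchy_cseq_lim _ (dsum (fun m => (f m)%:C) s); last by exists l.
  move=> e0; have C1 : 0 < C + 1 by rewrite ltr_wpDl.
  have [N N0 hN] := tail_bound_cvg0 (ltnW L2) s0 (divr_gt0 e0 C1).
  exists N => n Nn; rewrite split_ // (le_trans (hC _ _ _ (ltW s0) N0 Nn)) //.
  apply: (@le_trans _ _ (C * (e / (C + 1)))); first by rewrite ler_wpM2l // hN.
  by rewrite mulrCA ler_piMr ?(ltW e0) // ler_pdivrMr // mul1r lerDl.
have [F hF] := choice ex; exists F => s s0; split; first exact: hF.
move=> X X0; rewrite normcBC.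
have hc : cseq_lim (fun=> dsum (fun m => (f m)%:C) s X)
    (dsum (fun m => (f m)%:C) s X).
  by move=> e e0; exists 0%N => n _; rewrite subrr normc0.
rewrite normcBC; apply: (cseq_lim_norm (N := X) (cseq_limB (hF s s0) hc)) => n Xn.
by rewrite split_ // hC // ltW.
Qed.

End TailEstimate.

(** * Dirichlet polynomials for zeta in the strip *)

Section Zeta.
Variable R : realType.
Variable zeta : Cplx R -> Cplx R.
Hypothesis zetaP : is_riemann_zeta zeta.
Implicit Types (s : R[i]).

Lemma zeta_lim s : 1 < Re s -> cseq_lim (dsum (fun=> 1) s) (zeta s).
Proof.
move=> /(zetaP.2 s) /cvg_cseq_lim; apply: cseq_lim_eq => X.
by apply: eq_bigr => m _; rewrite mul1r.
Qed.

Lemma zeta_cdiff s : s != 1 -> cdiff zeta s.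
Proof. by move=> /eqP /(zetaP.1 s) /derivable_cdiff. Qed.

(* The coefficients of (1 - 2 ^ (1 - s)) zeta(s) prod_(p <= Q) (1 - p ^ (- s)). *)
Definition acop (Q m : nat) : R :=
  (coprime m (primorial Q))%:R -
  2 * (if (2 %| m)%N then (coprime (m %/ 2) (primorial Q))%:R else 0).

Lemma coprime_periodic (P m : nat) : coprime (m + P) P = coprime m P.
Proof. by rewrite /coprime !(gcdnC _ P) gcdnDr. Qed.

Lemma sum_coprime_double (P : nat) :
  \sum_(0 <= m < P * 2) (coprime m P)%:R = 2 * \sum_(0 <= m < P) (coprime m P)%:R :> R.
Proof.
rewrite muln2 -addnn (@big_cat_nat _ _ _ P) ?leq_addr //=.
rewrite -{3}(add0n P) big_addn addnK mulr_natl mulr2n; congr (_ + _).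
by apply: eq_bigr => m _; rewrite coprime_periodic.
Qed.

(** Over two periods of the coprimality pattern the first term meets every residue twice; the
    second, of weight 2, meets it once, through the even [m]. So the mean is zero. *)
Lemma acop_periodic Q : periodic0 (primorial Q * 2) (acop Q).
Proof.
set P := primorial Q; split=> [m|].
  rewrite /acop -/P.
  have -> : coprime (m + P * 2) P = coprime m P.
    by rewrite muln2 -addnn addnA !coprime_periodic.
  rewrite dvdn_addl ?dvdn_mull //; case: ifP => // h.
  by rewrite divnDl // mulnK // coprime_periodic.
rewrite /acop sumrB -/P sum_coprime_double -big_distrr /=.
apply/eqP; rewrite subr_eq0; apply/eqP; congr (_ * _).
elim: {1 3}P => [|k ih]; first by rewrite !big_geq.
rewrite mulSn addnC addn2 !big_nat_recr //= ih.
have -> : (2 %| (k * 2).+1)%N = false by rewrite dvdn2 /= oddM andbF.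
by rewrite dvdn_mull // mulnK // addr0.
Qed.

Lemma dsum_acop Q s X : dsum (fun m => (acop Q m)%:C) s X =
  dsum (@cop R Q) s X - 2 * npow s 2 * dsum (@cop R Q) s (X %/ 2).
Proof.
rewrite -dsum_sieve //; apply: eq_dsum => m _.
rewrite /acop /cop rmorphB rmorphM /= !rmorph_nat.
by case: ifP => _; rewrite ?rmorph_nat // rmorph0.
Qed.

(** The difference of both sides' limits is approximable by holomorphic functions in [Im s > 0],
    away from the pole, and vanishes for [Re s > 1]; [continuation] with [T = 0] carries this to the
    strip above height 9/4. *)
Lemma zeta_approx (Q L : nat) : (2 <= L)%N ->
  exists2 C : R, 0 <= C & forall s X, 1 / 2 <= Re s -> 9 / 4 < Im s -> (0 < X)%N ->
    normc ((1 - 2 * npow s 2) * eulerD Q s * zeta s -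
           dsum (fun m => (acop Q m)%:C) s X) <= C * tail_bound L s X.
Proof.
move=> L2.
have q0 : (0 < primorial Q * 2)%N by rewrite muln_gt0 primorial_gt0.
have [C C0 [F hF]] := periodic_dsum_approx q0 L2 (acop_periodic Q).
exists C => // s X s0 s1 X0.
pose H s := (1 - 2 * npow s 2) * eulerD Q s * zeta s.
suff E : H s - F s = 0.
  move/eqP: E; rewrite subr_eq0 /H => /eqP ->.
  by apply: (hF s _).2 => //; lra.
pose T : R := 0; have T0 : T = 0 by [].
apply: (@continuation _ (fun s => H s - F s) T) => //; last by rewrite T0 add0r.
  move=> a a0 a1 e e0.
  have L0 : (0 < L)%N := ltnW L2.
  have C1 : 0 < C + 1 by rewrite ltr_wpDl.
  pose B := normc a + 1.
  have B0 : 0 <= B by rewrite addr_ge0 ?normc_ge0.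
  (* Its real part is at most, and its modulus at least, that of any point of the disc. Thus
     [tail_bound] at [w] dominates the whole disc and one [N] serves all of it. *)
  pose w : R[i] := (1 / 8) +i* B.
  have w0 : 0 < Re w by rewrite /=; lra.
  have [N N0 hN] := tail_bound_cvg0 L0 w0 (divr_gt0 e0 C1).
  exists (fun s => H s - dsum (fun m => (acop Q m)%:C) s N) => z hz.
  have hz1 := normr_Re (z - a); have hz2 := normr_Im (z - a).
  rewrite raddfB /= in hz1; rewrite raddfB /= in hz2.
  move: (le_trans hz1 hz) (le_trans hz2 hz); rewrite !ler_norml /=.
  move=> /andP[z1 _] /andP[z3 _].
  have z0 : 1 / 8 <= Re z by lra.
  have zi : 0 < Im z by move: a1; rewrite T0; lra.
  split.
    rewrite /H; apply: cdiffD.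
      apply: cdiffM.
        apply: cdiffM.
          apply: cdiffD; first exact: cdiff_cst.
          have := cdiffM (cdiff_cst (-1) z) (cdiffM (cdiff_cst 2 z) (cdiff_cpowN 2%:R z)).
          by congr (cdiff _ _); apply: funext => y; rewrite mulN1r.
        rewrite /eulerD; apply: cdiff_prod => p.
        apply: cdiffD; first exact: cdiff_cst.
        have := cdiffM (cdiff_cst (-1) z) (cdiff_cpowN p%:R z).
        by congr (cdiff _ _); apply: funext => y; rewrite mulN1r.
      apply: zeta_cdiff; apply/eqP => z1E; move: zi.
      by rewrite z1E /= ltxx.
    have : cdiff (fun s => \sum_(1 <= m < N.+1) ((-1) * (acop Q m)%:C) * npow s m) z.
      apply: cdiff_sum => m; apply: cdiffM; first exact: cdiff_cst.
      exact: cdiff_cpowN.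
    congr (cdiff _ _); apply: funext => y; rewrite /dsum -sumrN.
    by apply: eq_bigr => m _; ring.
  have -> : H z - dsum (fun m => (acop Q m)%:C) z N - (H z - F z) =
    F z - dsum (fun m => (acop Q m)%:C) z N by ring.
  have z00 : 0 < Re z by lra.
  rewrite (le_trans ((hF z z00).2 N N0)) //.
  apply: (@le_trans _ _ (C * tail_bound L w N)).
    rewrite ler_wpM2l // /tail_bound.
    have N0' : 0 < N%:R :> R by rewrite ltr0n.
    have nz : normc z <= normc w.
      apply: (@le_trans _ _ B).
        rewrite /B -{1}(subrK a z) (le_trans (normcD _ _)) // addrC lerD2l.
        by apply: (le_trans hz); lra.
      have := normr_Im w; rewrite /= (ger0_norm B0); exact.
    have y0 : 0 <= 2 * (normc z + L%:R) / N%:R.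
      by rewrite divr_ge0 ?mulr_ge0 ?addr_ge0 ?normc_ge0 // ltW.
    have yw : 2 * (normc z + L%:R) / N%:R <= 2 * (normc w + L%:R) / N%:R.
      by rewrite ler_pM2r ?invr_gt0 // ler_wpM2l // lerD2r.
    have y1 : 0 <= 1 + 2 * (normc z + L%:R) / N%:R by rewrite addr_ge0.
    apply: ler_pM; rewrite ?powR_ge0 ?addr_ge0 ?exprn_ge0 ?mulr_ge0 ?exprn_ge0 ?(ltW N0') //.
      by apply: ler_powR; rewrite ?ler1n // lerN2.
    have y2 : 0 <= 2 * (normc w + L%:R) / N%:R := le_trans y0 yw.
    apply: lerD; first by rewrite lerXn2r ?nnegrE ?addr_ge0 // lerD2l.
    by rewrite ler_wpM2l ?(ltW N0') // lerXn2r ?nnegrE.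
  apply: (@le_trans _ _ (C * (e / (C + 1)))); first by rewrite ler_wpM2l // hN.
  by rewrite mulrCA ler_piMr ?(ltW e0) // ler_pdivrMr // mul1r lerDl.
move=> z z1 _; apply/eqP; rewrite subr_eq0; apply/eqP.
have z0 : 0 < Re z by lra.
have := (hF z z0).1; apply: cseq_lim_unique.
have hc := cop_lim Q (zeta_lim z1).
have := cseq_limB hc (cseq_limZ (2 * npow z 2) (cseq_lim_divn (isT : (0 < 2)%N) hc)).
have -> : eulerD Q z * zeta z - 2 * npow z 2 * (eulerD Q z * zeta z) = H z.
  by rewrite /H; ring.
by apply: cseq_lim_eq => X'; rewrite dsum_acop.
Qed.

End Zeta.

(** * Sums over primes *)

Section PowerSums.
Variable R : realType.
Implicit Types (x y a b : R).

Lemma ler_sum_nat_cond (m n : nat) (P : pred nat) (F G : nat -> R) :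
  (forall i, (m <= i < n)%N -> P i -> F i <= G i) ->
  \sum_(m <= i < n | P i) F i <= \sum_(m <= i < n | P i) G i.
Proof.
move=> h; rewrite big_nat_cond [leRHS]big_nat_cond.
by apply: ler_sum => i /andP[hi Pi]; exact: h.
Qed.

Lemma powR_decay a (e : R) : 0 < a -> 0 < e ->
  exists2 N, (0 < N)%N & forall X, (N <= X)%N -> X%:R `^ (- a) <= e.
Proof.
move=> a0 e0; pose t := e^-1 `^ a^-1.
exists (Num.truncn t).+1 => // X hX.
have X0 : 0 < X%:R :> R by rewrite ltr0n (leq_trans _ hX).
have tX : t <= X%:R by rewrite ltW // (lt_le_trans (truncnS_gt _)) // ler_nat.
rewrite powRN -[leRHS]invrK lef_pV2 ?posrE ?powR_gt0 ?invr_gt0 //.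
have -> : e^-1 = t `^ a.
  by rewrite /t -powRrM mulVf ?gt_eqF // powRr1 // invr_ge0 ltW.
by apply: ge0_ler_powR; rewrite ?nnegrE ?powR_ge0 // ltW.
Qed.

(** Integral comparison over [[x, x + 1]] through the mean value theorem. The left inequality bounds
    tails, the right one makes [zeta (1 + e)] large. *)
Lemma powR_step a x : 1 < a -> 0 < x ->
  (x + 1) `^ (- a) <= (x `^ (1 - a) - (x + 1) `^ (1 - a)) / (a - 1) <= x `^ (- a).
Proof.
move=> a1 x0; have a0 : 0 < a - 1 by rewrite subr_gt0.
have E y b : 0 < y -> y `^ b = expR (b * ln y) by move=> y0; rewrite /powR gt_eqF.
have xx : x <= x + 1 by rewrite lerDl.
have x10 : 0 < x + 1 by rewrite addr_gt0.
have [c /andP[c1 c2]] := @mean_value R (fun y => expR ((1 - a) * ln y))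
  (fun y => expR ((1 - a) * ln y) * ((1 - a) * y^-1)) x (x + 1) xx
  (fun y hy => @is_derive1_comp _ expR (fun y => (1 - a) * ln y) y _ _
    (is_derive_expR _) (is_deriveZ (1 - a) (is_derive1_ln (lt_le_trans x0 (proj1 (andP hy)))))).
have c0 : 0 < c := lt_le_trans x0 c1.
rewrite -!E // addrAC subrr add0r mulr1 => h.
rewrite ler_pdivlMr // ler_pdivrMr //.
have -> : x `^ (1 - a) - (x + 1) `^ (1 - a) = c `^ (- a) * (a - 1).
  rewrite -opprB h; have -> : c `^ (1 - a) = c * c `^ (- a).
    by rewrite powRD ?powRr1 ?(ltW c0) //; apply/implyP => _; rewrite gt_eqF.
  by field; rewrite gt_eqF.
have a00 : 0 <= a by lra.
rewrite !ler_pM2r // !powRN !lef_pV2 ?posrE ?powR_gt0 //.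
by apply/andP; split; apply: ge0_ler_powR;
  rewrite ?nnegrE ?(ltW c0) ?(ltW x0) ?(ltW x10).
Qed.

Lemma sum_powR_tail a (X Z : nat) : 1 < a -> (0 < X)%N ->
  \sum_(X.+1 <= m < Z.+1) (m%:R `^ (- a) : R) <= X%:R `^ (1 - a) / (a - 1).
Proof.
move=> a1 X0; have a0 : 0 < a - 1 by rewrite subr_gt0.
have [ZX|XZ] := leqP Z X.
  by rewrite big_geq // divr_ge0 ?powR_ge0 // ltW.
suff : \sum_(X.+1 <= m < Z.+1) (m%:R `^ (- a) : R) <=
    (X%:R `^ (1 - a) - Z%:R `^ (1 - a)) / (a - 1).
  move=> h; apply: (le_trans h).
  by rewrite ler_pM2r ?invr_gt0 // gerBl powR_ge0.
rewrite -(subnK (ltnW XZ)); elim: (Z - X)%N => [|k ih].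
  by rewrite add0n big_geq // subrr mul0r.
rewrite addSn big_nat_recr ?ltnS ?leq_addl //= -[(k + X).+1%:R]natr1.
have kX : 0 < (k + X)%:R :> R by rewrite ltr0n (leq_trans X0) // leq_addl.
have /andP[h _] := powR_step a1 kX.
apply: (le_trans (lerD ih h)).
by rewrite -mulrDl addrA subrK.
Qed.

Lemma sum_powR_bound a (Z : nat) : 1 < a ->
  \sum_(1 <= m < Z.+1) (m%:R `^ (- a) : R) <= 1 + (a - 1)^-1.
Proof.
move=> a1; have a0 : 0 < a - 1 by rewrite subr_gt0.
case: Z => [|Z]; first by rewrite big_geq // addr_ge0 // invr_ge0 ltW.
rewrite big_nat_recl // powR1 lerD2l.
have h := @sum_powR_tail a 1 Z.+1 a1 isT.
by rewrite big_add1 powR1 mul1r in h.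
Qed.

Lemma ln_le_powR a x : 0 < a -> 0 < x -> ln x <= x `^ a / a.
Proof.
move=> a0 x0; rewrite ler_pdivlMr // mulrC -ln_powR.
by apply: ltW; apply: ln_sublinear; rewrite powR_gt0.
Qed.

End PowerSums.

(** * The Euler product and the line Re s = 1 *)

Section EulerProduct.
Variable R : realType.
Variable zeta : Cplx R -> Cplx R.
Hypothesis zetaP : is_riemann_zeta zeta.
Implicit Types (s : R[i]) (t e : R).

(** Apart from 1, a number without prime factor up to [Q] exceeds [Q], so only a tail of the series
    remains. *)
Lemma dsum_cop_tail Q s (X : nat) : (0 < Q)%N -> 1 < Re s -> (0 < X)%N ->
  normc (dsum (@cop R Q) s X - 1) <= Q%:R `^ (1 - Re s) / (Re s - 1).
Proof.
move=> Q0 s1 X0.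
rewrite /dsum big_nat_recl // npow1 mulr1 {1}/cop coprime1n addrAC subrr add0r.
apply: (le_trans (normc_sum _ _ _)).
have h0 : 0 < Re s - 1 by rewrite subr_gt0.
have term i : normc (@cop R Q i.+1 * npow s i.+1) <= 
    if (Q < i.+1)%N then i.+1%:R `^ (- Re s) else (i == 0%N)%:R.
  rewrite normcM normc_npow // /cop normc_nat.
  have [cp|_] := boolP (coprime i.+1 (primorial Q)); last first.
    by rewrite mul0r; case: ifP; rewrite ?powR_ge0 ?ler0n.
  rewrite mul1r; case: ifPn => // Qi; case: i cp Qi => [|i] cp Qi.
    by rewrite powR1.
  have := elimT (coprime_primorialP _ _) cp (pdiv i.+2) (pdiv_prime _) (pdiv_dvd _).
  move=> /(_ isT isT); rewrite ltnNge; case/negP.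
  by rewrite (leq_trans (pdiv_leq _)) // leqNgt.
rewrite big_nat.
apply: (@le_trans _ _ (\sum_(1 <= i < X | (Q <= i)%N) i.+1%:R `^ (- Re s))).
  rewrite [leRHS]big_mkcond [leRHS]big_nat; apply: ler_sum => i /andP[i0 _].
  by apply: (le_trans (term i)); rewrite ltnS; case: ifP => // _; rewrite gtn_eqF.
have [XQ|QX] := leqP X Q.
  rewrite big_nat_cond big_pred0; first by rewrite divr_ge0 ?powR_ge0 // ltW.
  by move=> i; apply/negP => /andP[/andP[_ h1] h2]; have := leq_trans (leq_trans h1 XQ) h2;
    rewrite ltnn.
have := @sum_powR_tail R (Re s) Q X s1 Q0; apply: le_trans.
rewrite [leRHS]big_add1 /= (@big_cat_nat _ _ _ Q) //= ?(ltnW QX) //.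
rewrite big_nat_cond big_pred0 ?add0r; last first.
  by move=> i; apply/negP => /andP[/andP[_ h1] h2]; have := leq_trans h1 h2; rewrite ltnn.
by rewrite big_mkcond !big_nat; apply: ler_sum => i /andP[-> _].
Qed.

Lemma euler_lim s : 1 < Re s -> forall e, 0 < e -> exists2 Q0, (0 < Q0)%N &
  forall Q, (Q0 <= Q)%N -> normc (eulerD Q s * zeta s - 1) <= e.
Proof.
move=> s1 e e0; have a0 : 0 < Re s - 1 by rewrite subr_gt0.
have [N N0 hN] := powR_decay a0 (mulr_gt0 e0 a0).
exists N => // Q NQ; have Q0 : (0 < Q)%N := leq_trans N0 NQ.
have h1 : cseq_lim (fun=> 1) (1 : R[i]).
  by move=> d d0; exists 0%N => n _; rewrite subrr normc0.
apply: (cseq_lim_norm (N := 1%N) (cseq_limB (cop_lim Q (zeta_lim zetaP s1)) h1)).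
move=> X X0; apply: (le_trans (dsum_cop_tail Q0 s1 X0)).
by rewrite ler_pdivrMr // -opprB hN.
Qed.

Lemma zeta_real_le e : 0 < e -> normc (zeta (1 + e)%:C) <= 1 + e^-1.
Proof.
move=> e0; have s1 : 1 < Re ((1 + e)%:C : R[i]) by rewrite /= ltrDl.
apply: (cseq_lim_norm (N := 0%N) (zeta_lim zetaP s1)) => X _.
apply: (le_trans (normc_sum _ _ _)).
have := @sum_powR_bound R (1 + e) X s1; rewrite addrAC subrr add0r; apply: le_trans.
rewrite !big_nat; apply: ler_sum => m /andP[m0 _].
by rewrite mul1r normc_npow.
Qed.

Lemma sum_prime_sqr_le (Q : nat) :
  \sum_(0 <= p < Q.+1 | prime p) (p%:R ^- 2 : R) <= 2.
Proof.
apply: (@le_trans _ _ (\sum_(1 <= m < Q.+1) (m%:R `^ (- 2) : R))).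
  rewrite big_mkcond big_nat_recl //= add0r big_add1 /=; apply: ler_sum => m _.
  by case: ifP => _; rewrite ?powR_ge0 // powR_invn.
have h : 1 < 2 :> R by rewrite ltr1n.
apply: (le_trans (sum_powR_bound Q h)).
by have -> : 2 - 1 = 1 :> R by [ring]; rewrite invr1.
Qed.

(** Takes the place of the logarithm of an Euler factor; it is [1 + x <= expR x]. *)
Lemma normc_1B_sqr (z : R[i]) : normc (1 - z) ^+ 2 <= expR (- 2 * Re z + normc z ^+ 2).
Proof.
rewrite normc_sqr; apply: le_trans (expR_ge1Dx _); rewrite normc_sqr.
by case: z => a b /=; lra.
Qed.

(** Mertens' inequality [3 + 4 cos x + cos (2 x) >= 0], with doubled exponents so that only squared
    moduli occur. It is applied to finite Euler products, inverse to zeta in the limit. The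
    second-order terms add up to [8 p ^- 2] per prime, and [sum_prime_sqr_le] turns this into 16. *)
Lemma mertens_341 e t : 0 < e ->
  expR (- 16) <= normc (zeta (1 + e)%:C) ^+ 6 * normc (zeta ((1 + e) +i* t)) ^+ 8 *
    normc (zeta ((1 + e) +i* (t *+ 2))) ^+ 2.
Proof.
move=> e0.
pose s (j : nat) : R[i] := (1 + e) +i* (t *+ j).
have s1 j : 1 < Re (s j) by rewrite /= ltrDl.
have gen (u v w a b c : R) : u ^+ 2 <= a -> v ^+ 2 <= b -> w ^+ 2 <= c ->
    (u ^+ 2) ^+ 3 * (v ^+ 2) ^+ 4 * w ^+ 2 <= a ^+ 3 * b ^+ 4 * c.
  move=> ha hb hc; have u0 := sqr_ge0 u; have v0 := sqr_ge0 v; have w0 := sqr_ge0 w.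
  have a0 := le_trans u0 ha; have b0 := le_trans v0 hb.
  have h1 : (u ^+ 2) ^+ 3 <= a ^+ 3 by rewrite lerXn2r ?nnegrE.
  have h2 : (v ^+ 2) ^+ 4 <= b ^+ 4 by rewrite lerXn2r ?nnegrE.
  apply: ler_pM => //; first by apply: mulr_ge0; apply: exprn_ge0.
  by apply: ler_pM => //; apply: exprn_ge0.
rewrite -[(1 + e)%:C]/(s 0%N) -[(1 + e) +i* t]/(s 1%N) -[_ +i* (t *+ 2)]/(s 2%N).
have D Q : normc (eulerD Q (s 0%N)) ^+ 6 * normc (eulerD Q (s 1%N)) ^+ 8 *
   normc (eulerD Q (s 2%N)) ^+ 2 <= expR 16.
  have pw (u : R[i]) k : normc u ^+ (2 * k) = (normc u ^+ 2) ^+ k by rewrite exprM.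
  rewrite (pw _ 3%N) (pw _ 4%N) (pw _ 1%N) expr1 /eulerD !normc_prod -!prodrXl.
  rewrite -!big_split /=.
  apply: (@le_trans _ _ (\prod_(0 <= p < Q.+1 | prime p) expR (8 * p%:R ^- 2))).
    apply: ler_prod => p pp; rewrite !mulr_ge0 ?exprn_ge0 ?normc_ge0 //=.
    have p0 := prime_gt0 pp; have p0' : 0 < p%:R :> R by rewrite ltr0n.
    have pr j : npow (s j) p = (p%:R `^ (- (1 + e)))%:C * (cos ((t * ln p%:R) *+ j) +i* (- sin
      ((t * ln p%:R) *+ j))).
      have -> : s j = (1 + e)%:C + 'i%C * (t *+ j)%:C by apply: eqC; rewrite /=; ring.
      rewrite npowD /npow -rmorphN cpow_real //; congr (_ * _).
      have -> : - ('i%C * (t *+ j)%:C) = 'i%C * (- (t *+ j))%:C :> R[i] by rewrite rmorphN mulrN.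
      rewrite /cpow -mulrA -rmorphM cexp_i mulNr cosN sinN -mulrnAl.
      by [].
    set y := p%:R `^ (- (1 + e)) in pr *; set th := t * ln p%:R in pr *.
    have y0 : 0 <= y by exact: powR_ge0.
    have nj j : normc (npow (s j) p) ^+ 2 = y ^+ 2 by rewrite normc_npow // raddfN.
    have y2 : y ^+ 2 <= p%:R ^- 2.
      rewrite -exprVn lerXn2r ?nnegrE ?invr_ge0 ?(ltW p0') // -powR_inv1 ?(ltW p0') //.
      by apply: ler_powR; rewrite ?ler1n // lerN2 lerDl ltW.
    have h j : normc (1 - npow (s j) p) ^+ 2 <= expR (- 2 * (y * cos (th *+ j)) + y ^+ 2).
      apply: (le_trans (normc_1B_sqr _)); rewrite nj ler_expR lerD2r.
      by rewrite pr /= mul0r subr0.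
    apply: (le_trans (gen _ _ _ _ _ _ (h 0%N) (h 1%N) (h 2%N))).
    rewrite -!expRM_natl -!expRD ler_expR mulr0n mulr1n cos0 cos_mulr2n.
    have : 0 <= y * (1 + cos th) ^+ 2 by rewrite mulr_ge0 ?sqr_ge0.
    have -> : cos th ^+ 2 *+ 2 = 2 * cos th ^+ 2 by rewrite mulr_natl.
    rewrite expr2; lra.
  rewrite -expR_sum ler_expR -big_distrr /=.
  by have := sum_prime_sqr_le Q; lra.
apply/ler_addgt0Pr => d d0.
set z0 := normc (zeta (s 0%N)); set z1 := normc (zeta (s 1%N)).
set z2 := normc (zeta (s 2%N)).
(* [r] is the distance allowed between each product [eulerD * zeta] and 1; 16 = 6 + 8 + 2, and
   Bernoulli's inequality bounds the loss. *)
have [r r0 hr] : exists2 r : R, 0 < r < 1 & expR (- 16) * (1 - (1 - r) ^+ 16) <= d.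
  have E := expR_gt0 (- 16 : R).
  pose r := Num.min (1 / 2) (d / (16 * expR (- 16))) : R.
  have r0 : 0 < r by rewrite lt_min divr_gt0 //= divr_gt0 // mulr_gt0.
  have r1 : r <= 1 / 2 by rewrite ge_min lexx.
  have r2 : r * (16 * expR (- 16)) <= d by rewrite -ler_pdivlMr ?mulr_gt0 // ge_min lexx orbT.
  exists r; first by apply/andP; split=> //; lra.
  have B n : 1 - n%:R * r <= (1 - r) ^+ n.
    elim: n => [|n ih]; first by rewrite mul0r subr0 expr0.
    rewrite exprS -natr1 mulrDl mul1r.
    have h1 : 0 <= 1 - r by lra.
    have := ler_wpM2l h1 ih; have : 0 <= n%:R * r ^+ 2 by rewrite mulr_ge0 ?sqr_ge0.
    by rewrite expr2; lra.
  have := B 16%N; nra.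
case/andP: r0 => r0 r1.
have [Q0 _ h0] := euler_lim (s1 0%N) r0.
have [Q1 _ h1] := euler_lim (s1 1%N) r0.
have [Q2 _ h2] := euler_lim (s1 2%N) r0.
pose Q := maxn Q0 (maxn Q1 Q2).
have lo (u : R[i]) : normc (u - 1) <= r -> 1 - r <= normc u.
  move=> h; have := normcB u (u - 1); rewrite opprB addrC subrK normc1; lra.
have {}h0 := lo _ (h0 Q (leq_maxl _ _)).
have {}h1 := lo _ (h1 Q (leq_trans (leq_maxl _ _) (leq_maxr _ _))).
have {}h2 := lo _ (h2 Q (leq_trans (leq_maxr _ _) (leq_maxr _ _))).
rewrite !normcM -/z0 -/z1 -/z2 in h0 h1 h2.
have r1' : 0 <= 1 - r by lra.
have P : (1 - r) ^+ 16 <= expR 16 * (z0 ^+ 6 * z1 ^+ 8 * z2 ^+ 2).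
  have -> : (1 - r) ^+ 16 = (1 - r) ^+ 6 * (1 - r) ^+ 8 * (1 - r) ^+ 2 by rewrite -!exprD.
  have g0 := normc_ge0; have gz0 : 0 <= z0 by exact: g0.
  have gz1 : 0 <= z1 by exact: g0. have gz2 : 0 <= z2 by exact: g0.
  apply: (@le_trans _ _ ((normc (eulerD Q (s 0%N)) * z0) ^+ 6 *
     (normc (eulerD Q (s 1%N)) * z1) ^+ 8 * (normc (eulerD Q (s 2%N)) * z2) ^+ 2)).
    by rewrite !ler_pM ?mulr_ge0 ?exprn_ge0 // lerXn2r ?nnegrE ?mulr_ge0.
  rewrite !exprMn.
  set A0 := _ ^+ 6 in D *; set A1 := normc (eulerD Q (s 1%N)) ^+ 8.
  set A2 := normc (eulerD Q (s 2%N)) ^+ 2.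
  have := ler_wpM2r (_ : 0 <= z0 ^+ 6 * z1 ^+ 8 * z2 ^+ 2) (D Q).
  rewrite -/A0 -/A1 -/A2 => /(_ _)/wrap[]; first by rewrite !mulr_ge0 ?exprn_ge0.
  by apply: le_trans; rewrite le_eqVlt; apply/orP; left; apply/eqP; ring.
have EE : expR (- 16) * expR 16 = 1 :> R by rewrite -expRD addNr expR0.
have := ler_wpM2l (expR_ge0 (- 16)) P; rewrite (mulrA (expR (- 16)) (expR 16)) EE mul1r; lra.
Qed.

(** A zero would contribute [e ^+ 8] against [e ^- 6] from the pole, so the product in [mertens_341]
    would tend to 0 with [e]. *)
Lemma zeta_1_neq0 t : t != 0 -> zeta (1 +i* t) != 0.
Proof.
move=> t0; apply/eqP => z0.
have n1 : (1 +i* t : R[i]) != 1.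
  by apply/eqP => -[/eqP]; rewrite (negbTE t0).
have n2 : (1 +i* (t *+ 2) : R[i]) != 1.
  by apply/eqP => -[/eqP]; rewrite mulrn_eq0 /= (negbTE t0).
have [d hd] := zeta_cdiff zetaP n1.
have [r r0 hr] := hd 1 ltr01.
have [r' r0' hr'] := cdiff_cont (zeta_cdiff zetaP n2) ltr01.
set B := 1 + normc (zeta (1 +i* (t *+ 2))).
set A := 1 + normc d.
have B0 : 0 < B by rewrite ltr_pwDl ?normc_ge0.
have A0 : 0 < A by rewrite ltr_pwDl ?normc_ge0.
set K := 2 ^+ 6 * A ^+ 8 * B ^+ 2.
have K0 : 0 < K by rewrite !mulr_gt0 ?exprn_gt0.
pose e := Num.min (Num.min 1 (expR (- 16) / (K * 2))) (Num.min (r / 2) (r' / 2)) : R.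
have E0 := expR_gt0 (- 16 : R).
have e0 : 0 < e by rewrite !lt_min ltr01 !divr_gt0 // mulr_gt0.
have e1 : e <= 1 by rewrite !ge_min lexx.
have e2 : e <= expR (- 16) / (K * 2) by rewrite !ge_min lexx !orbT.
have e3 : e < r by rewrite (@le_lt_trans _ _ (r / 2)) // ?ge_min ?lexx ?orbT //; lra.
have e4 : e < r' by rewrite (@le_lt_trans _ _ (r' / 2)) // ?ge_min ?lexx ?orbT //; lra.
have ne : normc (e%:C : R[i]) = e by rewrite normc_real gtr0_norm.
have h0 : normc (zeta (1 + e)%:C) <= 2 / e.
  apply: (le_trans (zeta_real_le e0)); rewrite ler_pdivlMr // mulrDl mulVf ?gt_eqF //; lra.
have h1 : normc (zeta ((1 + e) +i* t)) <= A * e.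
  have -> : (1 + e) +i* t = (1 +i* t) + e%:C :> R[i] by apply: eqC; rewrite /= ?addr0.
  have := hr e%:C; rewrite ne z0 subr0 => /(_ e3) h.
  rewrite -(subrK (d * e%:C) (zeta _)) (le_trans (normcD _ _)) // normcM ne.
  by rewrite /A mulrDl lerD.
have h2 : normc (zeta ((1 + e) +i* (t *+ 2))) <= B.
  have -> : (1 + e) +i* (t *+ 2) = (1 +i* (t *+ 2)) + e%:C :> R[i] by apply: eqC; rewrite /= ?addr0.
  have := hr' e%:C; rewrite ne => /(_ e4) h.
  rewrite -(subrK (zeta (1 +i* (t *+ 2))) (zeta _)) (le_trans (normcD _ _)) //.
  by rewrite /B lerD2r ltW.
have := mertens_341 t e0; apply/negP; rewrite -ltNge.
apply: (@le_lt_trans _ _ ((2 / e) ^+ 6 * (A * e) ^+ 8 * B ^+ 2)).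
  by rewrite !ler_pM ?mulr_ge0 ?exprn_ge0 ?normc_ge0 //
    lerXn2r ?nnegrE ?normc_ge0 ?divr_ge0 ?mulr_ge0 ?(ltW A0) ?(ltW B0) ?(ltW e0).
have -> : (2 / e) ^+ 6 * (A * e) ^+ 8 * B ^+ 2 = K * e * e.
  by rewrite /K; field; rewrite gt_eqF.
have : K * e <= expR (- 16) / 2.
  move: e2; rewrite ler_pdivlMr ?mulr_gt0 //; lra.
nra.
Qed.

End EulerProduct.

(** * Prime sums from the logarithmic derivative of zeta *)

Section LogSums.
Variable R : realType.
Implicit Types (s w : R[i]) (x y e t : R).

Lemma ln_prod_nat (r : seq nat) (F : nat -> nat) : (forall i, (0 < F i)%N) ->
  ln ((\prod_(i <- r) F i)%N%:R : R) = \sum_(i <- r) ln ((F i)%:R : R).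
Proof.
move=> hF; elim: r => [|i r ih]; first by rewrite !big_nil ln1.
rewrite !big_cons natrM lnM ?posrE ?ltr0n ?hF ?ih //.
by rewrite prodn_gt0.
Qed.

Lemma sum_nat_le (T : nmodType) (c : T) (L N : nat) : (L <= N)%N ->
  \sum_(1 <= k < N.+1 | (k <= L)%N) c = c *+ L.
Proof.
move=> LN; rewrite (@big_cat_nat _ _ _ L.+1) //= [X in _ + X]big_nat_cond.
rewrite [X in _ + X]big_pred0 ?addr0; last first.
  by move=> i; apply/negP => /andP[/andP[h1 _] h2]; have := leq_trans h1 h2; rewrite ltnn.
rewrite big_nat_cond (eq_bigl (fun i => (1 <= i < L.+1)%N)); last first.
  by move=> i; rewrite !ltnS; case: (1 <= i)%N => //=; rewrite andbb.
by rewrite -big_nat sumr_const_nat subn1.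
Qed.

Lemma ln_logn (n N : nat) : (0 < n <= N)%N -> ln (n%:R : R) =
  \sum_(0 <= p < N.+1 | prime p) \sum_(1 <= k < N.+1 | (p ^ k %| n)%N) ln p%:R.
Proof.
move=> /andP[n0 nN].
have E : n = (\prod_(0 <= p < n.+1) p ^ logn p n)%N by rewrite -{1}(partnT n0).
have L0 p : (n < p)%N -> logn p n = 0%N.
  move=> np; rewrite lognE n0 /=; case: (prime p) => //=; case: ifP => // h.
  by have := dvdn_leq n0 h; rewrite leqNgt np.
rewrite {1}E ln_prod_nat; last first.
  move=> p; rewrite expn_gt0; case: p => //=; by rewrite lognE.
rewrite [RHS](@big_cat_nat _ _ _ n.+1) //= [X in _ + X]big_nat_cond.
rewrite [X in _ + X]big1 ?addr0; last first.
  move=> p /andP[/andP[h1 _] pp]; rewrite big_nat_cond big_pred0 // => k.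
  apply/negP => /andP[/andP[k0 _] h].
  have := dvdn_leq n0 h; rewrite leqNgt (leq_trans h1) //.
  by rewrite -{1}(expn1 p) leq_pexp2l // prime_gt0.
rewrite [RHS]big_mkcond; apply: eq_bigr => p _.
case: ifPn => pp; last by rewrite lognE (negbTE pp) expn0 ln1.
rewrite natrX lnXn ?ltr0n ?prime_gt0 //.
rewrite -(@sum_nat_le _ (ln p%:R) (logn p n) N) ?(leq_trans _ nN) ?(ltnW (ltn_logl _ n0)) //.
by apply: eq_bigl => k; rewrite pfactor_dvdn.
Qed.

(** Partial sums of the series of [- zeta']. Comparing them with [zeta s * ppsum s N] gives access
    to the logarithmic derivative without differentiating zeta. *)
Definition lnsum s (N : nat) : R[i] := \sum_(1 <= n < N.+1) (ln n%:R)%:C * npow s n.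

Lemma lnsum_conv s (N : nat) : lnsum s N =
  \sum_(0 <= p < N.+1 | prime p) \sum_(1 <= k < N.+1)
    (ln p%:R)%:C * npow s (p ^ k) * dsum (fun=> 1) s (N %/ p ^ k).
Proof.
have -> : lnsum s N = \sum_(1 <= n < N.+1) \sum_(0 <= p < N.+1 | prime p)
   \sum_(1 <= k < N.+1 | (p ^ k %| n)%N) (ln p%:R)%:C * npow s n.
  rewrite /lnsum !big_nat; apply: eq_bigr => n hn.
  rewrite (ln_logn hn) rmorph_sum big_distrl /=; apply: eq_bigr => p _.
  by rewrite rmorph_sum big_distrl.
rewrite exchange_big /=; apply: eq_bigr => p pp.
rewrite (exchange_big_dep xpredT) //=; apply: eq_bigr => k _.
have q0 : (0 < p ^ k)%N by rewrite expn_gt0 prime_gt0.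
rewrite (@sum_dvdn _ (fun n => (ln p%:R)%:C * npow s n)) // /dsum big_distrr /=.
rewrite !big_nat; apply: eq_bigr => u /andP[u0 _].
by rewrite npowM //; ring.
Qed.

Lemma sum_geometric (x : R) (k n : nat) : 0 <= x <= 1 / 2 ->
  \sum_(k <= j < n) x ^+ j <= 2 * x ^+ k.
Proof.
move=> /andP[x0 x1]; have [nk|kn] := leqP n k.
  by rewrite big_geq // mulr_ge0 ?exprn_ge0.
suff : \sum_(k <= j < n) x ^+ j <= 2 * x ^+ k - 2 * x ^+ n.
  by move=> h; apply: (le_trans h); rewrite gerBl mulr_ge0 ?exprn_ge0.
rewrite -(subnK (ltnW kn)); elim: (n - k)%N => [|m ih].
  by rewrite add0n big_geq // subrr.
rewrite addSn big_nat_recr ?leq_addl //= exprS.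
have := ler_wpM2r (exprn_ge0 (m + k) x0) x1; lra.
Qed.

Lemma ln_nat_ge0 (n : nat) : 0 <= ln (n%:R : R).
Proof. by case: n => [|n]; [rewrite ln0|rewrite ln_ge0 // ler1n]. Qed.

Definition psum s (N : nat) : R[i] :=
  \sum_(0 <= p < N.+1 | prime p) (ln p%:R)%:C * npow s p.

Definition ppsum s (N : nat) : R[i] :=
  \sum_(0 <= p < N.+1 | prime p) \sum_(1 <= k < N.+1 | (p ^ k <= N)%N)
    (ln p%:R)%:C * npow s (p ^ k).

Lemma sum_ln_powR (N : nat) (a : R) : 0 < a ->
  \sum_(1 <= n < N.+1) ln (n%:R : R) * n%:R `^ (- (1 + a)) <= 2 / a * (1 + 2 / a).
Proof.
move=> a0; have a2 : 0 < a / 2 by rewrite divr_gt0.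
apply: (@le_trans _ _ (\sum_(1 <= n < N.+1) 2 / a * n%:R `^ (- (1 + a / 2)))).
  rewrite !big_nat; apply: ler_sum => n /andP[n0 _].
  have n0' : 0 < n%:R :> R by rewrite ltr0n.
  have := ln_le_powR a2 n0'; rewrite invf_div mulrC => h.
  apply: (le_trans (ler_wpM2r (powR_ge0 _ _) h)).
  rewrite -(mulrA (2 / a)) -powRD; last by apply/implyP => _; rewrite gt_eqF.
  by have -> : a / 2 + - (1 + a) = - (1 + a / 2) by field.
rewrite -big_distrr /= ler_wpM2l ?divr_ge0 ?(ltW a0) //.
have h : 1 < 1 + a / 2 by rewrite ltrDl.
apply: (le_trans (sum_powR_bound N h)).
by rewrite addrAC subrr add0r invf_div.
Qed.

(** The higher powers of [p] form a geometric series of size at most [2 p ^- 2], and [sum_ln_powR]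
    at [a = 1] gives 6. *)
Lemma ppsum_psum s (N : nat) : 1 <= Re s -> normc (ppsum s N - psum s N) <= 12.
Proof.
move=> s1; rewrite /ppsum /psum -sumrB.
apply: (@le_trans _ _ (\sum_(0 <= p < N.+1 | prime p)
   2 * (ln p%:R * p%:R `^ (- (1 + 1))))).
  apply: (le_trans (normc_sum _ _ _)); rewrite big_nat_cond [leRHS]big_nat_cond.
  apply: ler_sum => p /andP[/andP[_ pN] pp].
  have p0 := prime_gt0 pp; have p0' : 0 < p%:R :> R by rewrite ltr0n.
  have N1 : (1 < N.+1)%N by rewrite ltnS (leq_trans p0).
  rewrite big_mkcond big_ltn // expn1 -ltnS pN addrAC subrr add0r.
  apply: (le_trans (normc_sum _ _ _)).
  set x : R := p%:R^-1.
  have x0 : 0 <= x by rewrite invr_ge0 ltW.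
  have x2 : x <= 1 / 2.
    by rewrite div1r lef_pV2 ?posrE // ler_nat prime_gt1.
  apply: (@le_trans _ _ (\sum_(2 <= k < N.+1) ln p%:R * x ^+ k)).
    apply: ler_sum => k _; case: ifP => _; last first.
      by rewrite normc0 mulr_ge0 ?ln_nat_ge0 ?exprn_ge0.
    rewrite normcM normc_real ger0_norm ?ln_nat_ge0 // ler_wpM2l ?ln_nat_ge0 //.
    rewrite npowX // normcX lerXn2r ?nnegrE ?normc_ge0 // normc_npow //.
    rewrite /x -powR_inv1 ?(ltW p0') //.
    by apply: ler_powR; rewrite ?ler1n // lerN2.
  rewrite -big_distrr /= mulrCA ler_wpM2l ?ln_nat_ge0 //.
  have -> : p%:R `^ (- (1 + 1)) = x ^+ 2.
    by rewrite -[1 + 1]/(2%:R) powR_invn ?(ltW p0') // exprVn.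
  by apply: sum_geometric; rewrite x0.
rewrite -big_distrr /=; have := sum_ln_powR N ltr01.
suff : \sum_(0 <= p < N.+1 | prime p) ln p%:R * p%:R `^ (- (1 + 1)) <=
  \sum_(1 <= n < N.+1) ln (n%:R : R) * n%:R `^ (- (1 + 1)) by rewrite divr1; lra.
rewrite big_mkcond big_nat_recl //= add0r big_add1 /=; apply: ler_sum => m _.
by case: ifP => _; rewrite // mulr_ge0 ?powR_ge0 ?ln_nat_ge0.
Qed.

Lemma cpowB1 w x : 0 < x -> cpow x (w - 1) = (x^-1)%:C * cpow x w.
Proof.
by move=> x0; rewrite cpowDr cpowN (_ : 1 = 1%:C) // cpow_real // powRr1 ?ltW // fmorphV mulrC.
Qed.

Lemma cder_ln_cpow w x : 0 < x -> cder (fun y => (ln y)%:C * cpow y w) x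
  (cpow x (w - 1) + (ln x)%:C * (w * cpow x (w - 1))).
Proof.
move=> x0; have [h1 h2] := cder_cpow w x0; have hl := is_derive1_ln x0.
rewrite {1}cpowB1 //; split.
  have -> : (fun y => Re ((ln y)%:C * cpow y w)) = (fun y : R => ln y) * (fun y => Re (cpow y w)).
    by apply: funext => y; rewrite ReM [Re _%:C]/= [Im _%:C]/= mul0r subr0.
  apply: (is_derive_eq (is_deriveM hl h1)).
  by move: (w * _) (cpow x w) => [a b] [c d]; rewrite /GRing.scale /=; ring.
have -> : (fun y => Im ((ln y)%:C * cpow y w)) = (fun y : R => ln y) * (fun y => Im (cpow y w)).
  by apply: funext => y; rewrite ImM [Re _%:C]/= [Im _%:C]/= mul0r addr0.
apply: (is_derive_eq (is_deriveM hl h2)).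
by move: (w * _) (cpow x w) => [a b] [c d]; rewrite /GRing.scale /=; ring.
Qed.

Lemma cder_linear (c : R[i]) x : cder (fun y => y%:C * c) x c.
Proof.
split.
  have -> : (fun y : R => Re (y%:C * c)) = Re c *: (@idfun R).
    by apply: funext => y; rewrite ReM /= mul0r subr0 mulrC.
  by apply: (is_derive_eq (is_deriveZ _ (is_derive_id x 1))); rewrite /GRing.scale /= mulr1.
have -> : (fun y : R => Im (y%:C * c)) = Im c *: (@idfun R).
  by apply: funext => y; rewrite ImM /= mul0r addr0 mulrC.
by apply: (is_derive_eq (is_deriveZ _ (is_derive_id x 1))); rewrite /GRing.scale /= mulr1.
Qed.

(* Comparison with an explicit primitive of ln x * x ^ (- s). *)
Lemma lnsum_bounded s : 1 < Re s -> exists N0, forall N, (N0 <= N)%N ->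
  normc (lnsum s N) <= normc (1 - s) ^- 2 + 1 + 12 * (1 + 2 * normc s).
Proof.
move=> s1; set w := 1 - s.
have w0 : w != 0.
  by rewrite subr_eq0; apply/eqP => e; move: s1; rewrite -e /= ltxx.
(* The primitive obtained by partial integration. Its value at 1 produces the term
   [normc (1 - s) ^- 2]. *)
pose A (x : R) := w^-1 * ((ln x)%:C * cpow x w) - w ^- 2 * cpow x w.
pose g (x : R) := (ln x)%:C * cpow x (- s).
have wE : w - 1 = - s by rewrite /w; ring.
have Ad x : 0 < x -> cder A x (g x).
  move=> x0.
  have -> : g x = w^-1 * (cpow x (w - 1) + (ln x)%:C * (w * cpow x (w - 1))) -
     w ^- 2 * (w * cpow x (w - 1)).
    by rewrite /g wE; field.
  by apply: cderB; apply: cderZ; [exact: cder_ln_cpow|exact: cder_cpow].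
have n0 : 0 <= normc s := normc_ge0 s.
have step (n : nat) : (0 < n)%N -> normc (g n%:R - (A n.+1%:R - A n%:R)) <=
    4 * (1 + 2 * normc s) * n%:R `^ (- (3 / 2)).
  move=> hn; have n0' : 0 < n%:R :> R by rewrite ltr0n.
  have nn : n%:R <= n%:R + 1 :> R by rewrite lerDl.
  set D := (1 + 2 * normc s) * n%:R `^ (- (3 / 2)).
  have D0 : 0 <= D by rewrite mulr_ge0 ?powR_ge0 // addr_ge0 // mulr_ge0.
  have gd y : n%:R <= y -> normc (- s * 0 + (cpow y (- s - 1) + (ln y)%:C * (- s * cpow y (- s
    - 1)))) <= D.
    move=> ny; have y0 : 0 < y := lt_le_trans n0' ny.
    have y1 : 1 <= y by rewrite (le_trans _ ny) // ler1n.
    rewrite mulr0 add0r.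
    have -> : cpow y (- s - 1) + (ln y)%:C * (- s * cpow y (- s - 1)) =
      (1 - (ln y)%:C * s) * cpow y (- s - 1) by ring.
    rewrite normcM normc_cpow // raddfB raddfN /=.
    apply: (@le_trans _ _ ((1 + 2 * normc s) * y `^ (1 / 2) * y `^ (- 2))).
      apply: ler_pM; rewrite ?normc_ge0 ?powR_ge0 //.
        rewrite (le_trans (normcB _ _)) // normc1 normcM normc_real.
        rewrite ger0_norm ?ln_ge0 //.
        have h2 : 0 < 1 / 2 :> R by lra.
        have := ln_le_powR h2 y0; rewrite invf_div divr1 => hl.
        have p1 : 1 <= y `^ (1 / 2) by rewrite -{1}(powRr0 y) ler_powR //; lra.
        have := ler_wpM2r n0 hl; lra.
      by apply: ler_powR => //; lra.
    rewrite -(mulrA (1 + 2 * normc s)) -powRD; last by apply/implyP => _; rewrite gt_eqF.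
    rewrite /D ler_wpM2l ?addr_ge0 ?mulr_ge0 //.
    have -> : 1 / 2 + - 2 = - (3 / 2) :> R by field.
    rewrite !powRN lef_pV2 ?posrE ?powR_gt0 //.
    by apply: ge0_ler_powR; rewrite ?nnegrE ?(ltW y0) ?(ltW n0') //; lra.
  have gl y : n%:R <= y <= n%:R + 1 -> normc (g y - g n%:R) <= 2 * D.
    move=> /andP[ny yn].
    have := @cder_lipschitz R g (fun y => cpow y (- s - 1) + (ln y)%:C * (- s * cpow y (- s -
      1))) n%:R y D ny.
    move=> /(_ _ _)/wrap[].
      by move=> x /andP[nx _]; apply: cder_ln_cpow; apply: lt_le_trans nx.
      by move=> x /andP[nx _]; have := gd x nx; rewrite mulr0 add0r.
    move=> h; apply: (le_trans h).
    by rewrite -[leRHS]mulr1 ler_wpM2l ?mulr_ge0 //; lra.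
  (* Subtracting the linear function reduces the error of one step to the oscillation of [g] on
     [[n, n + 1]]. *)
  have := @cder_lipschitz R (fun y => A y - y%:C * g n%:R) (fun y => g y - g n%:R) n%:R (n%:R +
    1) (2 * D) nn.
  move=> /(_ _ gl)/wrap[].
    move=> x /andP[nx _]; apply: cderB; last exact: cder_linear.
    by apply: Ad; apply: lt_le_trans nx.
  have -> : n%:R + 1 - n%:R = 1 :> R by ring.
  rewrite mulr1 -[n.+1%:R]natr1 rmorphD /=.
  set x := (X in normc X <= _) => h.
  have -> : g n%:R - (A (n%:R + 1) - A n%:R) = - x by rewrite /x; ring.
  by rewrite normcN (le_trans h) // /D; lra.
have key N : normc (lnsum s N - (A N.+1%:R - A 1)) <= 12 * (1 + 2 * normc s).
  apply: (@le_trans _ _ (\sum_(1 <= n < N.+1) 4 * (1 + 2 * normc s) * n%:R `^ (- (3 / 2)))).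
    have -> : A N.+1%:R - A 1 = \sum_(1 <= n < N.+1) (A n.+1%:R - A n%:R).
      by rewrite (@telescope_sumr _ _ _ (fun n => A n%:R)).
    rewrite /lnsum -sumrB (le_trans (normc_sum _ _ _)) // !big_nat.
    by apply: ler_sum => n /andP[hn _]; exact: step.
  rewrite -big_distrr /=.
  have h : 1 < 3 / 2 :> R by lra.
  have := sum_powR_bound N h.
  have -> : (3 / 2 - 1)^-1 = 2 :> R by field.
  have : 0 <= 4 * (1 + 2 * normc s) by rewrite !(mulr_ge0, addr_ge0).
  by move=> h1 /(ler_wpM2l h1); lra.
have nw0 : 0 < normc w by rewrite normc_gt0.
pose a := Re s - 1.
have a0 : 0 < a by rewrite subr_gt0.
pose K := normc w^-1 * (2 / a) + normc (w ^- 2).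
have K0 : 0 <= K by rewrite addr_ge0 ?normc_ge0 // mulr_ge0 ?normc_ge0 // divr_ge0 // ltW.
have K1 : 0 < K + 1 by rewrite ltr_wpDl.
have K2 : 0 < (K + 1)^-1 by rewrite invr_gt0.
have a2 : 0 < a / 2 by rewrite divr_gt0.
(* [N0] depends on [Re s - 1], the final bound does not; this is what allows letting [Re s] tend to
   1. *)
have [N0 _ hN] := powR_decay a2 K2.
exists N0 => N NN; have N0' : 0 < N.+1%:R :> R by rewrite ltr0n.
have AN : normc (A N.+1%:R) <= 1.
  have Rw : Re w = - a by rewrite /w /a raddfB /=; ring.
  have h1 : N.+1%:R `^ (- (a / 2)) <= (K + 1)^-1 by apply: hN; rewrite leqW.
  have h2 : N.+1%:R `^ (- a) <= N.+1%:R `^ (- (a / 2)).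
    by apply: ler_powR; rewrite ?ler1n // lerN2; lra.
  have h3 : ln N.+1%:R * N.+1%:R `^ (- a) <= 2 / a * N.+1%:R `^ (- (a / 2)).
    have := ln_le_powR a2 N0'; rewrite invf_div mulrC => h.
    apply: (le_trans (ler_wpM2r (powR_ge0 _ _) h)).
    rewrite -(mulrA (2 / a)) -powRD; last by apply/implyP => _; rewrite gt_eqF.
    by have -> : a / 2 + - a = - (a / 2) by field.
  apply: (@le_trans _ _ (K * N.+1%:R `^ (- (a / 2)))).
    rewrite /A; apply: (le_trans (normcB _ _)).
    rewrite (normcM w^-1) (normcM (w ^- 2)) (normcM (ln _)%:C) normc_real.
    rewrite ger0_norm ?ln_nat_ge0 // normc_cpow // Rw /K mulrDl -mulrA.
    by rewrite lerD // ler_wpM2l ?normc_ge0.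
  apply: (@le_trans _ _ (K * (K + 1)^-1)); first by rewrite ler_wpM2l.
  by rewrite ler_pdivrMr // mul1r lerDl.
have A1 : normc (A 1) <= normc w ^- 2.
  rewrite /A ln1 mul0r mulr0 add0r normcN cpow1 mulr1.
  by rewrite normcV normcX.
have hu := key N.
have E : lnsum s N = (lnsum s N - (A N.+1%:R - A 1)) + A N.+1%:R - A 1 by ring.
rewrite {}E; move: hu; set u := lnsum s N - _ => hu.
have := normcB (u + A N.+1%:R) (A 1); have := normcD u (A N.+1%:R).
lra.
Qed.

End LogSums.

Section PrimeSums.
Variable R : realType.
Variable zeta : Cplx R -> Cplx R.
Hypothesis zetaP : is_riemann_zeta zeta.
Implicit Types (s : R[i]) (t e : R).

Lemma zeta_dsum_tail s (Y : nat) : 1 < Re s -> (0 < Y)%N ->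
  normc (zeta s - dsum (fun=> 1) s Y) <= Y%:R `^ (1 - Re s) / (Re s - 1).
Proof.
move=> s1 Y0.
have hc : cseq_lim (fun=> dsum (fun=> 1) s Y) (dsum (fun=> 1) s Y).
  by move=> d d0; exists 0%N => n _; rewrite subrr normc0.
apply: (cseq_lim_norm (N := Y) (cseq_limB (zeta_lim zetaP s1) hc)) => Z YZ.
have -> : dsum (fun=> 1) s Z - dsum (fun=> 1) s Y = \sum_(Y.+1 <= m < Z.+1) npow s m.
  rewrite /dsum (@big_cat_nat _ _ _ Y.+1) //= addrAC subrr add0r.
  by apply: eq_bigr => m _; rewrite mul1r.
have := sum_powR_tail Z s1 Y0; apply: le_trans.
apply: (le_trans (normc_sum _ _ _)); rewrite !big_nat.
apply: ler_sum => m /andP[Ym _]; rewrite normc_npow //.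
exact: leq_trans Ym.
Qed.

(** A power of [N] in place of the true order [ln N] is enough, as [zeta_ppsum] has a power to
    spare. *)
Lemma sum_prime_pow_ln (N : nat) (a : R) : 0 < a ->
  \sum_(0 <= p < N.+1 | prime p) \sum_(1 <= k < N.+1) ln (p%:R : R) * p%:R ^- k <=
  N%:R `^ a * (2 * (2 / a * (1 + 2 / a))).
Proof.
move=> a0.
apply: (@le_trans _ _ (\sum_(0 <= p < N.+1 | prime p)
    N%:R `^ a * (2 * (ln (p%:R : R) * p%:R `^ (- (1 + a)))))).
  rewrite big_nat_cond [leRHS]big_nat_cond; apply: ler_sum => p /andP[/andP[_ pN] pp].
  have p0 := prime_gt0 pp; have p0' : 0 < p%:R :> R by rewrite ltr0n.
  have N0' : 0 < N%:R :> R by rewrite ltr0n (leq_trans p0).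
  rewrite -big_distrr /=.
  have h : \sum_(1 <= k < N.+1) (p%:R ^- k : R) <= 2 * p%:R^-1.
    under eq_bigr do rewrite -exprVn.
    have := @sum_geometric R p%:R^-1 1 N.+1; rewrite expr1; apply.
    by rewrite invr_ge0 ltW //= div1r lef_pV2 ?posrE // ler_nat prime_gt1.
  apply: (le_trans (ler_wpM2l (ln_nat_ge0 R p) h)).
  have -> : N%:R `^ a * (2 * (ln p%:R * p%:R `^ (- (1 + a)))) =
    ln p%:R * (2 * (N%:R `^ a * p%:R `^ (- (1 + a)))) by ring.
  rewrite ler_wpM2l ?ln_nat_ge0 // ler_wpM2l //.
  have -> : - (1 + a) = - 1 + - a by ring.
  rewrite powRD; last by apply/implyP => _; rewrite gt_eqF.
  rewrite mulrCA powR_inv1 ?(ltW p0') // ler_peMr ?invr_ge0 ?(ltW p0') //.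
  rewrite powRN -/(_ / _) ler_pdivlMr ?powR_gt0 // mul1r.
  by apply: ge0_ler_powR; rewrite ?nnegrE ?(ltW a0) ?(ltW p0') ?(ltW N0') // ler_nat.
rewrite -!big_distrr /= ler_wpM2l ?powR_ge0 // ler_wpM2l //.
apply: le_trans (sum_ln_powR N a0).
rewrite big_mkcond big_nat_recl //= add0r big_add1 /=; apply: ler_sum => m _.
by case: ifP => _; rewrite // mulr_ge0 ?powR_ge0 ?ln_nat_ge0.
Qed.

(** With [a = Re s - 1] and [q = p ^ k], replacing the partial sum up to [N %/ q] by zeta costs at
    most [(2 q / N) ^ a / a]. The factor [q ^ a] turns [q ^ (- Re s)] into [1 / q], and the total is
    of order [N ^ (- a / 2)]. *)
Lemma zeta_ppsum s : 1 < Re s -> exists N0, forall N, (N0 <= N)%N ->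
  normc (zeta s * ppsum s N - lnsum s N) <= 1.
Proof.
move=> s1; set a := Re s - 1.
have a0 : 0 < a by rewrite subr_gt0.
have a2 : 0 < a / 2 by rewrite divr_gt0.
pose K := 2 `^ a / a * (2 * (2 / (a / 2) * (1 + 2 / (a / 2)))).
have K0 : 0 <= K.
  have a2' : 0 <= 2 / (a / 2) := divr_ge0 (ler0n _ 2) (ltW a2).
  rewrite /K; apply: mulr_ge0; first exact: divr_ge0 (powR_ge0 _ _) (ltW a0).
  by apply: mulr_ge0 => //; apply: mulr_ge0 => //; apply: addr_ge0.
have K1 : 0 < (K + 1)^-1 by rewrite invr_gt0 ltr_wpDl.
have [N0 N00 hN] := powR_decay a2 K1.
exists N0 => N NN; have N0' : 0 < N%:R :> R by rewrite ltr0n (leq_trans N00).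
suff : normc (zeta s * ppsum s N - lnsum s N) <=
    2 `^ a / a * N%:R `^ (- a) * (N%:R `^ (a / 2) * (2 * (2 / (a / 2) * (1 + 2 / (a / 2))))).
  move=> h; apply: (le_trans h).
  have -> : 2 `^ a / a * N%:R `^ (- a) * (N%:R `^ (a / 2) * (2 * (2 / (a / 2) * (1 + 2 / (a /
    2))))) =
    K * (N%:R `^ (- a) * N%:R `^ (a / 2)) by rewrite /K; ring.
  rewrite -powRD; last by apply/implyP => _; rewrite gt_eqF.
  have -> : - a + a / 2 = - (a / 2) by field.
  apply: (@le_trans _ _ (K * (K + 1)^-1)); first by rewrite ler_wpM2l // hN.
  by rewrite ler_pdivrMr ?ltr_wpDl // mul1r lerDl.
have c0 : 0 <= 2 `^ a / a * N%:R `^ (- a).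
  by rewrite !mulr_ge0 ?powR_ge0 ?invr_ge0 ?(ltW a0).
apply: (le_trans _ (ler_wpM2l c0 (sum_prime_pow_ln N a2))).
rewrite lnsum_conv /ppsum !big_distrr /= -sumrB (le_trans (normc_sum _ _ _)) //.
apply: ler_sum_nat_cond => p /andP[_ pN] pp.
have p0 := prime_gt0 pp; have p0' : 0 < p%:R :> R by rewrite ltr0n.
rewrite big_mkcond !big_distrr /= -sumrB (le_trans (normc_sum _ _ _)) //.
apply: ler_sum => k _; set q := (p ^ k)%N.
have q0 : (0 < q)%N by rewrite expn_gt0 p0.
have q0' : 0 < q%:R :> R by rewrite ltr0n.
have -> : p%:R ^- k = q%:R^-1 :> R by rewrite natrX.
case: ifPn => qN; last first.
  rewrite divn_small ?ltnNge // /dsum big_geq // !mulr0 subr0 normc0.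
  by rewrite !mulr_ge0 ?ln_nat_ge0 ?invr_ge0 ?powR_ge0 ?(ltW a0) ?(ltW q0').
have -> : zeta s * ((ln p%:R)%:C * npow s q) - (ln p%:R)%:C * npow s q * dsum (fun=> 1) s (N %/ q) =
  (ln p%:R)%:C * npow s q * (zeta s - dsum (fun=> 1) s (N %/ q)) by ring.
have Y0 : (0 < N %/ q)%N by rewrite divn_gt0.
have Y0' : 0 < (N %/ q)%:R :> R by rewrite ltr0n.
rewrite (normcM ((ln _)%:C * _)) (normcM (ln _)%:C) normc_real ger0_norm ?ln_nat_ge0 //.
rewrite normc_npow //.
have h := zeta_dsum_tail s1 Y0; rewrite -/a in h.
have e1 : 1 - Re s = - a by rewrite /a; ring.
rewrite e1 in h.
have p1 : 0 <= ln p%:R * q%:R `^ (- Re s) by rewrite mulr_ge0 ?ln_nat_ge0 ?powR_ge0.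
apply: (le_trans (ler_wpM2l p1 h)).
have -> : 2 `^ a / a * N%:R `^ (- a) * (ln p%:R / q%:R) =
  ln p%:R * (q%:R^-1 * 2 `^ a * N%:R `^ (- a) / a) by field; rewrite !gt_eqF.
rewrite -(mulrA (ln _)) ler_wpM2l ?ln_nat_ge0 // (mulrA (q%:R `^ _)) ler_pM2r ?invr_gt0 //.
have -> : - Re s = - 1 + - a by rewrite /a; ring.
rewrite powRD; last by apply/implyP => _; rewrite gt_eqF.
rewrite powR_inv1 ?(ltW q0') // -!mulrA ler_pM2l ?invr_gt0 // !powRN.
rewrite -invfM -powRM ?(ltW q0') ?(ltW Y0') // ler_pdivlMr ?powR_gt0 // mulrC.
rewrite ler_pdivrMr ?powR_gt0 ?mulr_gt0 // -powRM ?mulr_ge0 ?(ltW q0') ?(ltW Y0') //.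
apply: ge0_ler_powR; rewrite ?nnegrE ?(ltW a0) ?mulr_ge0 ?(ltW q0') ?(ltW Y0') ?(ltW N0') //.
(* For [q <= N] the remainder is at most [q * (N %/ q)]; hence the factor 2. *)
rewrite -!natrM ler_nat {1}(divn_eq N q) mulnC.
by rewrite mul2n -addnn leq_add // ltnW // (leq_trans (ltn_pmod _ q0)) // leq_pmulr.
Qed.

(** The consequence of [zeta_1_neq0] used below: near [1 + i t] zeta is bounded away from 0, so the
    prime sum stays bounded as [e] tends to 0. [C] is uniform in [e], only [N0] is not. *)
Lemma psum_bounded t : t != 0 -> exists C : R, exists2 e0 : R, 0 < e0 &
  forall e, 0 < e < e0 -> exists N0, forall N, (N0 <= N)%N ->
    normc (psum ((1 + e) +i* t) N) <= C.
Proof.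
move=> t0; pose z1 : R[i] := 1 +i* t.
have c0 : 0 < normc (zeta z1) by rewrite normc_gt0 zeta_1_neq0.
have n1 : z1 != 1 by apply/eqP => -[/eqP]; rewrite (negbTE t0).
have c2 : 0 < normc (zeta z1) / 2 by rewrite divr_gt0.
have [r r0 hr] := cdiff_cont (zeta_cdiff zetaP n1) c2.
pose B := t ^- 2 + 1 + 12 * (1 + 2 * (2 + `|t|)).
exists ((B + 1) / (normc (zeta z1) / 2) + 12), (Num.min r 1); first by rewrite lt_min r0 ltr01.
move=> e; rewrite lt_min => /and3P[e0 er e1]; pose s : R[i] := (1 + e) +i* t.
have s1 : 1 < Re s by rewrite /= ltrDl.
have [N1 h1] := zeta_ppsum s1; have [N2 h2] := lnsum_bounded s1.
exists (maxn N1 N2) => N; rewrite geq_max => /andP[/h1 {}h1 /h2 {}h2].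
have hz : normc (zeta z1) / 2 <= normc (zeta s).
  have ne : normc (e%:C : R[i]) = e by rewrite normc_real gtr0_norm.
  have := hr e%:C; rewrite ne => /(_ er).
  have -> : z1 + e%:C = s by apply: eqC; rewrite /= ?addr0.
  have := normcB (zeta s) (zeta s - zeta z1).
  have -> : zeta s - (zeta s - zeta z1) = zeta z1 by ring.
  lra.
have hB : normc (lnsum s N) <= B.
  apply: (le_trans h2); rewrite /B lerD //.
    rewrite lerD2r; have tn : 0 < `|t| by rewrite normr_gt0.
    have ht : `|t| <= normc (1 - s).
      have := normr_Im (1 - s); rewrite /s /= sub0r normrN; exact.
    rewrite -(real_normK (num_real t)) lef_pV2 ?posrE ?exprn_gt0 // ?(lt_le_trans tn) //.
    by rewrite lerXn2r ?nnegrE ?normc_ge0.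
  rewrite ler_wpM2l // lerD2l ler_wpM2l // (le_trans (normc_le_ReIm _)) //= lerD2r.
  rewrite ger0_norm; lra.
have hp : normc (ppsum s N) <= (B + 1) / (normc (zeta z1) / 2).
  rewrite ler_pdivlMr //.
  have : normc (zeta s * ppsum s N) <= B + 1.
    rewrite -(subrK (lnsum s N) (zeta s * _)) (le_trans (normcD _ _)) // addrC lerD //.
  rewrite normcM mulrC; apply: le_trans.
  by rewrite ler_wpM2l ?normc_ge0.
have := @ppsum_psum R s N (ltW s1).
have := normcB (ppsum s N) (ppsum s N - psum s N).
have -> : ppsum s N - (ppsum s N - psum s N) = psum s N by ring.
rewrite /s; lra.
Qed.

Lemma zeta_real_ge e : 0 < e -> (2 * e)^-1 <= normc (zeta (1 + e)%:C).
Proof.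
move=> e0; have s1 : 1 < Re ((1 + e)%:C : R[i]) by rewrite /= ltrDl.
have h2 : 0 < (1 / 2 : R) by lra.
have [M M0 hM] := powR_decay e0 h2.
apply/ler_addgt0Pr => d d0.
have [N hN] := zeta_lim zetaP s1 d0.
have {hN} := hN (maxn M N) (leq_maxr _ _); set X := maxn M N => hX.
have X0 : (0 < X)%N by rewrite (leq_trans M0) // leq_maxl.
have E : (2 * e)^-1 <= \sum_(1 <= m < X.+1) (m%:R `^ (- (1 + e)) : R).
  have key Z : (1 - Z.+1%:R `^ (- e)) / e <= \sum_(1 <= m < Z.+1) (m%:R `^ (- (1 + e)) : R).
    elim: Z => [|Z ih]; first by rewrite powR1 subrr mul0r big_geq.
    rewrite big_nat_recr //=; have Z0 : 0 < Z.+1%:R :> R by rewrite ltr0n.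
    have a1 : 1 < 1 + e by rewrite ltrDl.
    have /andP[_ h] := powR_step a1 Z0.
    apply: le_trans (lerD ih h); rewrite -[Z.+2%:R]natr1.
    have -> : 1 - (1 + e) = - e by ring.
    have -> : 1 + e - 1 = e by ring.
    by rewrite -mulrDl addrA subrK.
  apply: le_trans (key X).
  rewrite invfM mulrC [leRHS]mulrC ler_pM2l ?invr_gt0 //.
  have : X.+1%:R `^ (- e) <= 1 / 2 by apply: hM; rewrite leqW // leq_maxl.
  lra.
apply: (le_trans E).
have -> : \sum_(1 <= m < X.+1) (m%:R `^ (- (1 + e)) : R) = Re (dsum (fun=> 1) (1 + e)%:C X).
  rewrite /dsum raddf_sum !big_nat; apply: eq_bigr => m /andP[m0 _].
  by rewrite mul1r /npow -rmorphN cpow_real // ltr0n.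
rewrite (le_trans (ler_norm _)) // (le_trans (normr_Re _)) //.
rewrite -(subrK (zeta (1 + e)%:C) (dsum _ _ _)) (le_trans (normcD _ _)) // addrC lerD2l.
exact: ltW.
Qed.

(** Euler's argument: a bound [K] gives [normc (eulerD Q) >= expR (- (2 K))] through
    [1 - x >= expR (- 2 x)] on [[0, 1 / 2]], contradicting the growth of [zeta (1 + e)]; the chosen
    [e] makes the product at least 4. *)
Lemma sum_prime_inv_unbounded (K : R) :
  exists N, K <= \sum_(0 <= p < N.+1 | prime p) (p%:R^-1 : R).
Proof.
apply: contrapT => hn.
have h N : \sum_(0 <= p < N.+1 | prime p) (p%:R^-1 : R) <= K.
  by rewrite leNgt; apply/negP => h; apply: hn; exists N; rewrite ltW.
pose e : R := (8 * expR (2 * K))^-1.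
have E0 := expR_gt0 (2 * K).
have e0 : 0 < e by rewrite invr_gt0 mulr_gt0.
have s1 : 1 < Re ((1 + e)%:C : R[i]) by rewrite /= ltrDl.
have [Q Q0 /(_ Q (leqnn Q)) hQ] := euler_lim zetaP s1 ltr01.
have D : expR (- (2 * K)) <= normc (eulerD Q (1 + e)%:C).
  apply: (@le_trans _ _ (expR (\sum_(0 <= p < Q.+1 | prime p) - (2 * p%:R^-1)))).
    by rewrite ler_expR sumrN lerN2 -big_distrr /= ler_wpM2l.
  rewrite expR_sum /eulerD normc_prod; apply: ler_prod => p pp.
  rewrite expR_ge0 andTb; have p0 := prime_gt0 pp.
  have p0' : 0 < p%:R :> R by rewrite ltr0n.
  have x2 : p%:R^-1 <= 1 / 2 :> R by rewrite div1r lef_pV2 ?posrE // ler_nat prime_gt1.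
  have x0 : 0 < p%:R^-1 :> R by rewrite invr_gt0.
  have n1 : normc (npow (1 + e)%:C p) <= p%:R^-1 :> R.
    rewrite normc_npow //= -powR_inv1 ?(ltW p0') //.
    by apply: ler_powR; rewrite ?ler1n // lerN2 lerDl ltW.
  have := normcB 1 (npow (1 + e)%:C p : R[i]).
  have := normcD (1 - npow (1 + e)%:C p) (npow (1 + e)%:C p : R[i]); rewrite subrK normc1 => h1 _.
  have h2 := expR_ge1Dx (2 * p%:R^-1 : R).
  have h3 : expR (2 * p%:R^-1) * expR (- (2 * p%:R^-1)) = 1 :> R by rewrite expRxMexpNx_1.
  have h4 := expR_gt0 (- (2 * p%:R^-1) : R).
  apply: (@le_trans _ _ (1 - p%:R^-1)); last by lra.
  set x := p%:R^-1 in x2 x0 h2 h3 h4 *; set y := expR (- _) in h3 h4 *.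
  have : (1 + 2 * x) * y <= 1 by rewrite -[leRHS]h3 ler_pM2r.
  nra.
have hz := zeta_real_ge e0.
have : normc (eulerD Q (1 + e)%:C * zeta (1 + e)%:C) <= 2.
  rewrite -(subrK 1 (_ * _)) (le_trans (normcD _ _)) // normc1.
  by apply: (le_trans (lerD hQ (lexx _))).
apply/negP; rewrite -ltNge normcM.
apply: (@lt_le_trans _ _ (expR (- (2 * K)) * (2 * e)^-1)); last first.
  by rewrite ler_pM ?expR_ge0 // invr_ge0 mulr_ge0 // ltW.
have -> : (2 * e)^-1 = 4 * expR (2 * K) by rewrite /e invfM invrK; field.
by rewrite mulrCA -expRD addNr expR0 mulr1 ltr_nat.
Qed.

Lemma psum_unbounded (K e0 : R) : 0 < e0 -> exists2 e, 0 < e < e0 &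
  exists N0, forall N, (N0 <= N)%N ->
    K <= \sum_(0 <= p < N.+1 | prime p) ln (p%:R : R) * p%:R `^ (- (1 + e)).
Proof.
move=> e00; have l2 : 0 < ln (2 : R) by rewrite ln_gt0 // ltr1n.
have [M hM] := sum_prime_inv_unbounded (`|K| / (ln 2 / 2)).
have lM := ln_nat_ge0 R M.
(* So small that [p ^ (- e) >= 1 - e ln p >= 1 / 2] for all [p <= M]. *)
pose e : R := Num.min (e0 / 2) (1 / (2 * (ln M%:R + 1))).
have lM1 : 0 < ln (M%:R : R) + 1 by rewrite ltr_wpDl.
have e_gt0 : 0 < e by rewrite lt_min !divr_gt0 // mulr_gt0.
have eM : e * (ln M%:R + 1) <= 1 / 2.
  have : e <= 1 / (2 * (ln M%:R + 1)) by rewrite ge_min lexx orbT.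
  rewrite ler_pdivlMr ?mulr_gt0 //; lra.
exists e; first by rewrite e_gt0 gt_min; apply/orP; left; lra.
exists M => N MN.
apply: (@le_trans _ _ (\sum_(0 <= p < M.+1 | prime p) ln (p%:R : R) * p%:R `^ (- (1 + e))));
  last first.
  rewrite [leRHS](@big_cat_nat _ _ _ M.+1) //= lerDl sumr_ge0 // => p _.
  by rewrite mulr_ge0 ?powR_ge0 ?ln_nat_ge0.
apply: (@le_trans _ _ (\sum_(0 <= p < M.+1 | prime p) ln 2 / 2 * p%:R^-1)).
  rewrite -big_distrr /= (le_trans (ler_norm _)) //.
  by move: hM; rewrite ler_pdivrMr ?divr_gt0 // mulrC.
rewrite big_nat_cond [leRHS]big_nat_cond; apply: ler_sum => p /andP[/andP[_ pM] pp].
have p0' : 0 < p%:R :> R by rewrite ltr0n prime_gt0.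
have -> : - (1 + e) = - 1 + - e by ring.
rewrite powRD; last by apply/implyP => _; rewrite gt_eqF.
rewrite powR_inv1 ?(ltW p0') //.
rewrite (_ : ln p%:R * (p%:R^-1 * p%:R `^ (- e)) = ln p%:R * p%:R `^ (- e) / p%:R); last by ring.
rewrite ler_pM2r ?invr_gt0 //.
apply: ler_pM; rewrite ?(ltW l2) // ?invr_ge0 //.
  by rewrite ler_ln ?posrE // ler_nat prime_gt1.
rewrite /powR gt_eqF //; apply: le_trans (expR_ge1Dx _).
have : ln (p%:R : R) <= ln M%:R by rewrite ler_ln ?posrE ?ltr0n ?(leq_trans (prime_gt0 pp)) //
  ler_nat.
move=> /(ler_wpM2l (ltW e_gt0)).
have : 2^-1 * 2 = 1 :> R by rewrite mulVf.
lra.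
Qed.

End PrimeSums.

Arguments ComplexField.Normc.normc : simpl never.

(** * Choosing the phases of the primes *)

Section Kernel.
Variable R : realType.
Implicit Types (z w : R[i]) (r : nat).

Lemma conjc_unit z : normc z = 1 -> z^*%C = z^-1.
Proof.
move=> h; have z0 : z != 0 by rewrite -normc_gt0 h.
apply: (mulfI z0); rewrite divff //.
have := normc_sqr z; rewrite h expr1n; case: z {h z0} => a b /= e.
by apply: eqC; rewrite /=; [rewrite [RHS]e|]; ring.
Qed.

Lemma normc_sqrC z : (normc z ^+ 2)%:C = z * z^*%C.
Proof. by rewrite normc_sqr; case: z => a b; apply: eqC; rewrite /=; ring. Qed.

Lemma normc_1D_unit z : normc z = 1 -> normc (1 + z) ^+ 2 = 4 - normc (z - 1) ^+ 2.
Proof.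
move=> h; have := normc_sqr z; rewrite h expr1n !normc_sqr; case: z {h} => a b /= h.
by have -> : 4 = 2 + 2 * 1 :> R by [ring]; rewrite h; ring.
Qed.

Definition kcoef r (i : nat) : R := 'C(r, i)%:R / 2 ^+ r.

Lemma kcoef_ge0 r i : 0 <= kcoef r i.
Proof. by rewrite divr_ge0 ?exprn_ge0. Qed.

Lemma sum_kcoef r : \sum_(i < r.+1) kcoef r i = 1.
Proof.
rewrite -big_distrl /= -natr_sum.
have -> : (\sum_(i < r.+1) 'C(r, i) = 2 ^ r)%N.
  have := expnDn 1 1 r; rewrite addn1 => ->.
  by apply: eq_bigr => i _; rewrite !exp1n !muln1.
by rewrite natrX divff // expf_neq0.
Qed.

Lemma kcoef_le1 r (i : 'I_r.+1) : kcoef r i <= 1.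
Proof.
rewrite -(sum_kcoef r) (bigD1 i) //= lerDl sumr_ge0 // => j _; exact: kcoef_ge0.
Qed.

Lemma sum_sqr_ge (n : nat) (u : 'I_n.+1 -> R) :
  (\sum_i u i) ^+ 2 <= n.+1%:R * \sum_i u i ^+ 2.
Proof.
have h : 0 <= \sum_i \sum_j (u i - u j) ^+ 2.
  by apply: sumr_ge0 => i _; apply: sumr_ge0 => j _; exact: sqr_ge0.
have E : \sum_i \sum_j (u i - u j) ^+ 2 =
    2 * (n.+1%:R * \sum_i u i ^+ 2 - (\sum_i u i) ^+ 2).
  have -> : \sum_i \sum_j (u i - u j) ^+ 2 =
     \sum_i \sum_j (u i ^+ 2 + u j ^+ 2 - 2 * (u i * u j)).
    by apply: eq_bigr => i _; apply: eq_bigr => j _; ring.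
  have -> : \sum_i \sum_j (u i ^+ 2 + u j ^+ 2 - 2 * (u i * u j)) =
     \sum_i (n.+1%:R * u i ^+ 2 + \sum_j u j ^+ 2 - 2 * (u i * \sum_j u j)).
    apply: eq_bigr => i _; rewrite sumrB big_split /= sumr_const card_ord.
    by rewrite mulr_natl -!big_distrr.
  rewrite sumrB big_split /= -!big_distrr /= sumr_const card_ord -big_distrl /=.
  by rewrite -[_ *+ n.+1]mulr_natl; ring.
by move: h; rewrite E pmulr_rge0 // subr_ge0.
Qed.

(** The sum is the mean over the unit circle of the kernel [normc (((1 + z) / 2) ^+ r) ^+ 2]. It is
    only polynomially small in [r], while [kernel_small] is exponential: this is the concentration
    near [z = 1]. *)
Lemma sum_kcoef_sqr r : r.+1%:R^-1 <= \sum_(i < r.+1) kcoef r i ^+ 2.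
Proof.
have := @sum_sqr_ge r (fun i => kcoef r i); rewrite sum_kcoef expr1n => h.
by rewrite -div1r ler_pdivrMr ?ltr0n // mulrC.
Qed.

Lemma kernel_expand r z : ((1 + z) / 2) ^+ r = \sum_(i < r.+1) (kcoef r i)%:C * z ^+ i.
Proof.
rewrite expr_div_n addrC exprDn big_distrl /=.
have -> : \sum_(i < r.+1) (kcoef r i)%:C * z ^+ i =
   \sum_(i < r.+1) (kcoef r (r - i)%N)%:C * z ^+ (r - i)%N.
  rewrite (reindex_inj rev_ord_inj) /=; apply: eq_bigr => i _.
  by rewrite subSS.
apply: eq_bigr => i _; have hi : (i <= r)%N by rewrite -ltnS.
rewrite expr1n mulr1 /kcoef bin_sub //.
rewrite rmorphM fmorphV rmorphXn /= !rmorph_nat -mulr_natl; ring.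
Qed.

Lemma kernel_sqr_expand r z : normc z = 1 ->
  (normc (((1 + z) / 2) ^+ r) ^+ 2)%:C =
  \sum_(i < r.+1) \sum_(j < r.+1) (kcoef r i * kcoef r j)%:C * (z ^+ i * z^-1 ^+ j).
Proof.
move=> z1; rewrite normc_sqrC kernel_expand rmorph_sum /= big_distrl /=.
apply: eq_bigr => i _; rewrite big_distrr /=; apply: eq_bigr => j _.
have -> : ((kcoef r j)%:C * z ^+ j)^*%C = (kcoef r j)%:C * z^-1 ^+ j.
  by rewrite -(conjc_unit z1) rmorphM rmorphXn; congr (_ * _); exact: conjc_real.
by rewrite (rmorphM _ (kcoef r i) (kcoef r j)) mulrACA.
Qed.

Lemma kernel_small r z (d : R) : normc z = 1 -> 0 <= d -> d <= normc (z - 1) ->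
  normc (((1 + z) / 2) ^+ r) ^+ 2 <= (1 - d ^+ 2 / 4) ^+ r.
Proof.
move=> z1 d0 dz; rewrite normcX -exprM mulnC exprM.
have d2 : d ^+ 2 <= normc (z - 1) ^+ 2 by rewrite lerXn2r ?nnegrE ?normc_ge0.
have E : normc ((1 + z) / 2) ^+ 2 = 1 - normc (z - 1) ^+ 2 / 4.
  by rewrite normcM exprMn normc_1D_unit // normcV normc_nat; field.
rewrite E lerXn2r ?nnegrE -?E ?sqr_ge0 // ?E; last by rewrite lerD2l lerN2; lra.
by rewrite (@le_trans _ _ (normc ((1 + z) / 2) ^+ 2)) ?sqr_ge0 // E; lra.
Qed.

Lemma kernel_le1 r z : normc z = 1 -> normc (((1 + z) / 2) ^+ r) ^+ 2 <= 1.
Proof.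
move=> z1; have := @kernel_small r z 0 z1 (lexx _) (normc_ge0 _).
by rewrite expr0n mul0r subr0 expr1n.
Qed.

Lemma expr_poly_decay (m : nat) (k e : R) : 0 < k < 1 -> 0 < e ->
  exists r : nat, r.+1%:R ^+ m * k ^+ r <= e.
Proof.
move=> /andP[k0 k1] e0.
have l0 : 0 < - ln k by rewrite oppr_gt0 ln_lt0 // k0.
set lam := - ln k in l0.
pose C := 2 ^+ m * (m.+1)`!%:R / lam ^+ m.+1.
have C0 : 0 < C by rewrite divr_gt0 ?mulr_gt0 ?exprn_gt0 // ltr0n fact_gt0.
pose r := (Num.truncn (C / e)).+1.
exists r; have r0 : 0 < r%:R :> R by rewrite ltr0n.
have rC : C / e <= r%:R by rewrite ltW // truncnS_gt.
have E : k ^+ r * expR (lam * r%:R) = 1.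
  rewrite /lam mulrC mulNr expRN expRM_natr lnK // mulVf // expf_neq0 // gt_eqF //.
have h1 : (lam * r%:R) ^+ m.+1 / m.+1`!%:R <= expR (lam * r%:R).
  have := @expR_ge1Dxn R (lam * r%:R) m (mulr_ge0 (ltW l0) (ltW r0)).
  by apply: le_trans; rewrite lerDr.
have kr0 : 0 < k ^+ r by rewrite exprn_gt0.
have f0 : 0 < (m.+1)`!%:R :> R by rewrite ltr0n fact_gt0.
have h2 : k ^+ r <= m.+1`!%:R / (lam * r%:R) ^+ m.+1.
  have lr : 0 < (lam * r%:R) ^+ m.+1 by rewrite exprn_gt0 // mulr_gt0.
  rewrite ler_pdivrMr // in h1.
  rewrite ler_pdivlMr //; apply: (le_trans (ler_wpM2l (ltW kr0) h1)).
  by rewrite mulrA E mul1r.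
have h3 : r.+1%:R ^+ m <= (2 * r%:R) ^+ m :> R.
  rewrite lerXn2r ?nnegrE ?mulr_ge0 // -natrM ler_nat mul2n -addnn -addn1.
  by rewrite leq_add2l.
apply: (@le_trans _ _ ((2 * r%:R) ^+ m * (m.+1`!%:R / (lam * r%:R) ^+ m.+1))).
  by rewrite ler_pM // ?exprn_ge0 // ltW.
have -> : (2 * r%:R) ^+ m * (m.+1`!%:R / (lam * r%:R) ^+ m.+1) = C / r%:R.
  rewrite /C !exprMn exprS (exprS r%:R); field.
  by rewrite !expf_neq0 ?gt_eqF // (gt_eqF l0).
by rewrite ler_pdivrMr // mulrC -ler_pdivrMr.
Qed.

End Kernel.

Section Characters.
Variable R : realType.
Implicit Types (s z w : R[i]) (h t : R).

(* m ^ (- i h) *)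
Definition chi h (m : nat) : R[i] := npow ('i%C * h%:C) m.

Lemma normc_chi h m : normc (chi h m) = 1.
Proof.
rewrite /chi /npow normc_cexp.
have -> : - ('i%C * h%:C) * (ln m%:R)%:C = 'i%C * (- h * ln m%:R)%:C :> R[i].
  by rewrite rmorphM rmorphN /=; ring.
by rewrite ReM /= mul0r mulr0 subr0 expR0.
Qed.

Lemma chi_neq0 h m : chi h m != 0.
Proof. by rewrite -normc_gt0 normc_chi. Qed.

Lemma npow_shift s h (k : nat) m :
  npow (s + 'i%C * h%:C * k%:R) m = npow s m * chi h m ^+ k.
Proof.
rewrite npowD; congr (_ * _); rewrite /chi /npow -cpow_nat.
by congr cpow; ring.
Qed.

Lemma npow_real s m : npow s m = npow (Re s)%:C m * chi (Im s) m.
Proof. by rewrite /chi -npowD -complexE. Qed.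

Lemma npow_realE (a : R) m : (0 < m)%N -> npow a%:C m = (m%:R `^ (- a))%:C.
Proof. by move=> m0; rewrite /npow -rmorphN cpow_real // ltr0n. Qed.

Lemma chi_ratio h m (i j : nat) : chi h m ^+ i * (chi h m)^-1 ^+ j =
  chi (h * (i%:R - j%:R)) m.
Proof.
rewrite /chi /npow -cpowN -!cpow_nat -cpowDr; congr cpow.
by rewrite rmorphM rmorphB /= !rmorph_nat; ring.
Qed.

Lemma chiM h m n : (0 < m)%N -> (0 < n)%N -> chi h (m * n) = chi h m * chi h n.
Proof. exact: npowM. Qed.

Lemma chi1 h : chi h 1 = 1.
Proof. exact: npow1. Qed.

End Characters.

Section EulerNonzero.
Variable R : realType.
Implicit Types (s : R[i]).

Lemma npow_lt1 s m : 0 < Re s -> (1 < m)%N -> normc (npow s m) < 1.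
Proof.
move=> s0 m1; rewrite normc_npow ?(ltnW m1) // powRN invf_lt1 ?powR_gt0 ?ltr0n ?(ltnW m1) //.
rewrite [X in X < _](_ : 1 = 1 `^ Re s); last by rewrite powR1.
apply: gt0_ltr_powR => //; rewrite ?nnegrE //.
by rewrite ltr1n.
Qed.

Lemma eulerD_neq0 Q s : 0 < Re s -> eulerD Q s != 0.
Proof.
move=> s0; rewrite prodf_seq_neq0; apply/allP => p _; apply/implyP => pp.
rewrite subr_eq0; apply/eqP => /(congr1 (@normc _)); rewrite normc1 => E.
by have := npow_lt1 s0 (prime_gt1 pp); rewrite -E ltxx.
Qed.

Lemma Re_shift s (h : R) (k : nat) : Re (s + 'i%C * h%:C * k%:R) = Re s.
Proof. by rewrite -!mulrA -(rmorph_nat (real_complex R)) -rmorphM; case: s => a b /=; ring. Qed.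

End EulerNonzero.

(** * Primes with p^(-i h) near a given point *)

Section PrimeClasses.
Variable R : realType.
Variable zeta : Cplx R -> Cplx R.
Hypothesis zetaP : is_riemann_zeta zeta.
Implicit Types (h t e : R).

Lemma psum_bounded_seq (ts : seq R) : all (fun t => t != 0) ts ->
  exists2 C : R, 0 <= C & exists2 e0 : R, 0 < e0 &
  forall e, 0 < e < e0 -> exists N0, forall N t, (N0 <= N)%N -> t \in ts ->
    normc (psum ((1 + e) +i* t) N) <= C.
Proof.
elim: ts => [|t ts ih] /=; first by move=> _; exists 0 => //; exists 1 => // e _; exists 0%N.
move=> /andP[t0 /ih[C C0 [e0 e00 hC]]].
have [C' [e1 e10 hC']] := psum_bounded zetaP t0.
exists (Num.max C C'); first by rewrite le_max C0.
exists (Num.min e0 e1); first by rewrite lt_min e00.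
move=> e; rewrite lt_min => /and3P[ep eE0 eE1].
have [|N0 h0] := hC e; first by rewrite ep.
have [|N1 h1] := hC' e; first by rewrite ep.
exists (maxn N0 N1) => N t'; rewrite geq_max inE => /andP[hN0 hN1] /orP[/eqP->|ht'].
  by rewrite le_max h1 // orbT.
by rewrite le_max h0.
Qed.

(* Weighting the primes by ((1 + cos)/2) ^ r, a non-negative trigonometric
   polynomial in h ln p concentrated near the chosen phase, reduces the claim to
   psum_bounded for the non-zero frequencies. *)
Lemma prime_class h (w : R[i]) (d a K : R) (T : nat) : h != 0 -> normc w = 1 ->
  0 < d -> a < 1 ->
  exists N, K <= \sum_(T.+1 <= p < N.+1 | prime p && (normc (chi h p - w) < d))
    (p%:R `^ (- a) : R).
Proof.
move=> h0 w1 d0 a1; apply: contrapT => hno.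
have hK N : \sum_(T.+1 <= p < N.+1 | prime p && (normc (chi h p - w) < d))
    (p%:R `^ (- a) : R) <= K.
  by rewrite leNgt; apply/negP => hl; apply: hno; exists N; rewrite ltW.
pose d' := Num.min d 1.
have d'0 : 0 < d' by rewrite lt_min d0 ltr01.
have d'1 : d' <= 1 by rewrite ge_min lexx orbT.
have d'd : d' <= d by rewrite ge_min lexx.
pose k := 1 - d' ^+ 2 / 4.
have k01 : 0 < k < 1.
  have : 0 < d' ^+ 2 by rewrite exprn_gt0.
  have : d' ^+ 2 <= 1 by rewrite exprn_ile1 // ltW.
  by rewrite /k => ? ?; apply/andP; split; lra.
have h2 : 0 < 1 / 2 :> R by lra.
(* Off the class the kernel is at most [k ^+ r], now at most half of the lower bound [1 / (r + 1)]
   for its mean. *)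
have [r hr] := expr_poly_decay 1 k01 h2; rewrite expr1 in hr.
pose ts : seq R := [seq h * ((ij.1 : nat)%:R - (ij.2 : nat)%:R) |
  ij : 'I_r.+1 * 'I_r.+1 <- enum [pred ij : 'I_r.+1 * 'I_r.+1 | ij.1 != ij.2]].
have ts0 : all (fun t => t != 0) ts.
  apply/allP => t /mapP[[i j]]; rewrite mem_enum inE /= => ij ->.
  by rewrite mulf_neq0 // subr_eq0 eqr_nat.
have [C C0 [e0 e00 hC]] := psum_bounded_seq ts0.
have w0 : w != 0 by rewrite -normc_gt0 w1.
pose u p := w^-1 * chi h p.
have u1 p : normc (u p) = 1 by rewrite normcM normcV w1 normc_chi invr1 mulr1.
have ud p : normc (u p - 1) = normc (chi h p - w).
  have -> : u p - 1 = w^-1 * (chi h p - w) by rewrite /u mulrBr mulVf.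
  by rewrite normcM normcV w1 invr1 mul1r.
pose ker p := normc (((1 + u p) / 2) ^+ r) ^+ 2.
have kerE p : (ker p)%:C = \sum_(i < r.+1) \sum_(j < r.+1)
   (kcoef R r i * kcoef R r j)%:C * (w^-1 ^+ i * w ^+ j) * chi (h * (i%:R - j%:R)) p.
  rewrite /ker (kernel_sqr_expand r (u1 p)).
  apply: eq_bigr => i _; apply: eq_bigr => j _.
  by rewrite -chi_ratio /u invfM invrK !exprMn; ring.
pose CT : R := \sum_(0 <= p < T.+1 | prime p) ln p%:R.
have CT0 : 0 <= CT by apply: sumr_ge0 => p _; exact: ln_nat_ge0.
have K0 : 0 <= K.
  by apply: le_trans (hK 0%N); apply: sumr_ge0 => p _; exact: powR_ge0.
have a0 : 0 < 1 - a by rewrite subr_gt0.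
pose B := 2 * r.+1%:R * (r.+1%:R ^+ 2 * C + CT + K / (1 - a)).
have [e /andP[ep ee] [N1 hN1]] := psum_unbounded zetaP (B + 1) e00.
have [|N2 hN2] := hC e; first by rewrite ep.
have := hN1 (maxn N1 N2) (leq_maxl _ _).
have {hN2} := hN2 (maxn N1 N2) _ (leq_maxr _ _); set N := maxn N1 N2 => hN2.
set A := (X in _ <= X) => hA.
pose g (p : nat) : R := ln p%:R * p%:R `^ (- (1 + e)).
have g0 p : 0 <= g p by rewrite mulr_ge0 ?ln_nat_ge0 ?powR_ge0.
pose S := \sum_(0 <= p < N.+1 | prime p) g p * ker p.
have psumE t : psum ((1 + e) +i* t) N =
    \sum_(0 <= p < N.+1 | prime p) (g p)%:C * chi t p.
  apply: eq_bigr => p /prime_gt0 p0.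
  by rewrite npow_real /= npow_realE // rmorphM mulrA.
(* Equal indices give [A] times the mean of the kernel; all others are prime sums at the frequencies
   [ts], bounded by [C]. *)
have lower : A / r.+1%:R - r.+1%:R ^+ 2 * C <= S.
  have SE : S%:C = \sum_(i < r.+1) \sum_(j < r.+1)
     (kcoef R r i * kcoef R r j)%:C * (w^-1 ^+ i * w ^+ j) *
       psum ((1 + e) +i* (h * (i%:R - j%:R))) N.
    rewrite /S rmorph_sum /=.
    under eq_bigr do rewrite rmorphM /= kerE big_distrr /=.
    rewrite exchange_big /=; apply: eq_bigr => i _.
    under eq_bigr do rewrite big_distrr /=.
    rewrite exchange_big /=; apply: eq_bigr => j _.
    by rewrite psumE big_distrr /=; apply: eq_bigr => p _; ring.
  pose D := A * \sum_(i < r.+1) kcoef R r i ^+ 2.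
  have AC : A%:C = \sum_(0 <= p < N.+1 | prime p) (g p)%:C * chi 0 p.
    rewrite /A rmorph_sum; apply: eq_bigr => p _.
    by rewrite /chi rmorph0 mulr0 /npow oppr0 cpow0 mulr1.
  have dif : normc (S%:C - D%:C) <= r.+1%:R ^+ 2 * C.
    have -> : D%:C = \sum_(i < r.+1) \sum_(j < r.+1)
       (if i == j then (kcoef R r i ^+ 2)%:C * A%:C else 0) :> R[i].
      rewrite /D mulrC rmorphM rmorph_sum big_distrl /=; apply: eq_bigr => i _.
      by rewrite -big_mkcond (big_pred1 i) // => j; rewrite eq_sym.
    rewrite SE -sumrB (le_trans (normc_sum _ _ _)) //.
    have -> : r.+1%:R ^+ 2 * C = \sum_(i < r.+1) \sum_(j < r.+1) C.
      by rewrite !sumr_const card_ord -(mulr_natl (C *+ _)) -(mulr_natl C) mulrA expr2.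
    apply: ler_sum => i _; rewrite -sumrB (le_trans (normc_sum _ _ _)) //.
    apply: ler_sum => j _; case: eqVneq => [<-|ij].
      rewrite psumE subrr mulr0 -AC exprVn mulVf ?expf_neq0 // mulr1 expr2 subrr normc0 //.
    rewrite subr0 !normcM normc_real !normcX normcV w1 invr1 !expr1n !mulr1.
    have tin : h * (i%:R - j%:R) \in ts.
      by apply/mapP; exists (i, j) => //; rewrite mem_enum inE.
    apply: (@le_trans _ _ (1 * C)); last by rewrite mul1r.
    rewrite ler_pM ?normc_ge0 ?hN2 // ger0_norm ?mulr_ge0 ?kcoef_ge0 //.
    by rewrite mulr_ile1 ?kcoef_ge0 ?kcoef_le1.
  have : A / r.+1%:R <= D.
    rewrite /D ler_wpM2l ?sum_kcoef_sqr //.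
    by apply: sumr_ge0 => p _; exact: g0.
  have : `|S - D| <= r.+1%:R ^+ 2 * C by rewrite -normc_real rmorphB.
  rewrite ler_norml => /andP[h3 _] h4.
  by rewrite lerBlDr (le_trans h4) // -lerBlDl -opprB lerNl.
(* Three kinds of primes: those up to [T]; the class, where [ln p <= p ^ (1 - a) / (1 - a)]; and the
   rest, where the kernel is small. *)
have upper : S <= CT + K / (1 - a) + k ^+ r * A.
  have hp p : (0 <= p < N.+1)%N -> prime p -> g p * ker p <=
    (if (p <= T)%N then ln p%:R else 0) +
    (if (T < p)%N && (normc (chi h p - w) < d) then p%:R `^ (- a) / (1 - a) else 0) +
    k ^+ r * g p.
    move=> _ pp; have p0' : 0 < p%:R :> R by rewrite ltr0n prime_gt0.
    have ker0 : 0 <= ker p by exact: sqr_ge0.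
    have ker1 : ker p <= 1 by exact: kernel_le1.
    have kg : 0 <= k ^+ r * g p.
      by rewrite mulr_ge0 // exprn_ge0 // ltW //; case/andP: k01.
    have gk : g p * ker p <= g p by rewrite ler_piMr.
    have [pT|Tp] := leqP p T.
      rewrite /= addr0 (le_trans gk) // -[leLHS]addr0 lerD //.
      rewrite /g ler_piMr ?ln_nat_ge0 //.
      by rewrite -[leRHS](powRr0 p%:R) ler_powR ?ler1n ?prime_gt0 // oppr_le0; lra.
    rewrite add0r /=; case: ifPn => hd.
      rewrite (le_trans gk) // -[leLHS]addr0 lerD //.
      have := ln_le_powR a0 p0' => hl.
      have := ler_wpM2r (powR_ge0 p%:R (- (1 + e))) hl => hl2.
      apply: (le_trans hl2); rewrite mulrAC ler_pM2r ?invr_gt0 //.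
      rewrite -powRD; last by apply/implyP => _; rewrite gt_eqF.
      by rewrite ler_powR ?ler1n ?prime_gt0 //; lra.
    rewrite add0r mulrC ler_wpM2r // /ker /k.
    apply: kernel_small => //; first exact: ltW.
    by rewrite ud (le_trans d'd) // leNgt.
  apply: (le_trans (ler_sum_nat_cond hp)).
  rewrite !big_split /= -big_distrr /= -/A lerD2r; apply: lerD.
    rewrite big_mkcond [leRHS]big_mkcond /=.
    have [TN|NT] := leqP T.+1 N.+1.
      rewrite (@big_cat_nat _ _ _ T.+1) //= [X in _ + X]big_nat [X in _ + X]big1 ?addr0.
        rewrite big_nat [leRHS]big_nat; apply: ler_sum => p /andP[_ pT].
        by rewrite -ltnS pT; case: ifP.
      by move=> p /andP[pT _]; rewrite leqNgt pT /= if_same.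
    rewrite [leRHS](@big_cat_nat _ _ _ N.+1) ?(ltnW NT) //= -[leLHS]addr0 lerD //.
      by apply: ler_sum => p _; case: ifP => // _; case: ifP => // _; exact: ln_nat_ge0.
    by apply: sumr_ge0 => p _; case: ifP => // _; exact: ln_nat_ge0.
  apply: le_trans (_ : _ <= (\sum_(T.+1 <= p < N.+1 | prime p && (normc (chi h p - w) < d))
    (p%:R `^ (- a) : R)) / (1 - a)) _; last first.
    by rewrite ler_pM2r ?invr_gt0.
  rewrite big_distrl /=.
  have [TN|NT] := leqP T.+1 N.+1; last first.
    rewrite big_nat_cond big1 ?big_geq ?(ltnW NT) // => p /andP[/andP[_ pN] _].
    by rewrite ltnNge -ltnS (leq_trans pN) // ltnW.
  rewrite (@big_cat_nat _ _ _ T.+1) //= big_nat_cond big1 ?add0r; last first.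
    by move=> p /andP[/andP[_ pT] _]; rewrite ltnNge -ltnS pT.
  rewrite big_mkcond [leRHS]big_mkcond /= big_nat [leRHS]big_nat.
  by apply: ler_sum => p /andP[-> _]; rewrite andTb; case: (prime p).
have A0 : 0 <= A by apply: sumr_ge0 => p _; exact: g0.
have r0 : 0 < r.+1%:R :> R by rewrite ltr0n.
have kr : k ^+ r <= 1 / 2 / r.+1%:R by rewrite ler_pdivlMr // mulrC.
have fin (A' S' c X y r1 : R) : 0 < r1 -> A' / r1 - c <= S' -> S' <= X + y * A' ->
    0 <= A' -> y <= 1 / 2 / r1 -> A' <= 2 * r1 * (c + X).
  move=> r10 l1 l2 A'0 hy; have := ler_wpM2r A'0 hy.
  have E : A' / r1 * r1 = A' by rewrite divfK // gt_eqF.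
  have -> : 1 / 2 / r1 * A' = A' / r1 / 2 by field; rewrite gt_eqF.
  move: l1 E; set q := A' / r1 => l1 E hq.
  have : q <= 2 * (c + X) by lra.
  by move=> /(ler_wpM2r (ltW r10)); lra.
have hAB := fin A S _ _ _ _ r0 lower upper A0 kr.
have := le_trans hA hAB; rewrite /B addrA.
by rewrite gerDl lt_geF.
Qed.

End PrimeClasses.

(** * Prescribing the Euler product at several points *)

Section Phases.
Variable R : realType.
Variable zeta : Cplx R -> Cplx R.
Hypothesis zetaP : is_riemann_zeta zeta.
Variables (s : R[i]) (h : R) (l : nat).
Hypothesis h_neq0 : h != 0.
Hypothesis s_strip : 1 / 2 < Re s < 1.

Let sk (k : nat) : R[i] := s + 'i%C * h%:C * k%:R.

Let sk_norm k p : (0 < p)%N -> normc (npow (sk k) p) = p%:R `^ (- Re s).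
Proof. by move=> p0; rewrite npow_shift normcM normc_npow // normcX normc_chi expr1n mulr1. Qed.

(* Greedy choice: each sign is taken so as not to increase the energy by more
   than the energy of the new vector. *)
Lemma balanced_signs (P : pred nat) (v : nat -> 'I_l -> R[i]) (T N : nat) :
  exists e : nat -> R[i], (forall p, normc (e p) = 1) /\
    \sum_(k < l) normc (\sum_(T <= p < N | P p) e p * v p k) ^+ 2 <=
    \sum_(T <= p < N | P p) \sum_(k < l) normc (v p k) ^+ 2.
Proof.
elim: N => [|N [e [e1 he]]].
  exists (fun=> 1); split=> [p|]; first exact: normc1.
  by rewrite big_geq // big1 // => k _; rewrite big_geq // normc0 expr0n.
have [TN|NT] := leqP T N; last first.
  exists (fun=> 1); split=> [p|]; first exact: normc1.
  by rewrite big_geq // big1 // => k _; rewrite big_geq // normc0 expr0n.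
case PN : (P N); last first.
  exists e; split=> //; rewrite [leRHS]big_mkcond big_nat_recr //= PN addr0 -big_mkcond.
  apply: le_trans he; apply: ler_sum => k _.
  by rewrite big_mkcond big_nat_recr //= PN addr0 -big_mkcond.
pose S k := \sum_(T <= p < N | P p) e p * v p k.
pose I := \sum_(k < l) (Re (S k) * Re (v N k) + Im (S k) * Im (v N k)).
pose sg : R := if 0 <= I then -1 else 1.
have sgI : sg * I <= 0.
  by rewrite /sg; case: ifPn => hI; rewrite ?mulN1r ?oppr_le0 // mul1r ltW // ltNge.
have sg2 : sg ^+ 2 = 1 by rewrite /sg; case: ifP; rewrite ?sqrrN expr1n.
exists (fun p => if p == N then sg%:C else e p); split.
  move=> p; case: ifP => // _; rewrite normc_real /sg.
  by case: ifP; rewrite ?normrN normr1.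
have E k : \sum_(T <= p < N.+1 | P p) (if p == N then sg%:C else e p) * v p k =
    S k + sg%:C * v N k.
  rewrite big_mkcond big_nat_recr //= PN eqxx -big_mkcond; congr (_ + _).
  rewrite big_nat_cond [RHS]big_nat_cond; apply: eq_bigr => p /andP[/andP[_ pN] _].
  by rewrite ltn_eqF.
rewrite [leRHS]big_mkcond big_nat_recr //= PN -big_mkcond.
apply: (@le_trans _ _ (\sum_(k < l) (normc (S k) ^+ 2 +
   (2 * sg * (Re (S k) * Re (v N k) + Im (S k) * Im (v N k)) + normc (v N k) ^+ 2)))).
  apply: ler_sum => k _; rewrite E le_eqVlt; apply/orP; left; apply/eqP.
  rewrite !normc_sqr; case: (S k) (v N k) => [a b] [c d] /=.
  rewrite !mul0r !subr0 !addr0.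
  have -> : c ^+ 2 + d ^+ 2 = sg ^+ 2 * (c ^+ 2 + d ^+ 2) by rewrite sg2 mul1r.
  by ring.
rewrite big_split /= big_split /= -big_distrr /= -/I.
by rewrite lerD // gerDr -mulrA pmulr_rle0.
Qed.

(** Stopping at the least [N] that reaches [y] overshoots by one term at most. *)
Lemma greedy_sum (P : pred nat) (g : nat -> R) (eta y : R) (T : nat) :
  (forall p, (T < p)%N -> 0 <= g p <= eta) -> 0 <= y -> 0 <= eta ->
  (exists N, y <= \sum_(T.+1 <= p < N.+1 | P p) g p) ->
  exists2 N, (T <= N)%N & y <= \sum_(T.+1 <= p < N.+1 | P p) g p <= y + eta.
Proof.
move=> hg y0 eta0 hex.
case: (ex_minnP hex) => N hN hmin.
have [NT|TN] := leqP N T.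
  exists T => //; have {}hN : y <= 0 by move: hN; rewrite big_geq.
  have yE : y = 0 by apply/eqP; rewrite eq_le hN.
  by rewrite big_geq // yE lexx add0r.
exists N; first exact: ltnW.
rewrite hN /=; case: N hN hmin TN => // N hN hmin TN.
rewrite big_mkcond big_nat_recr //= -big_mkcond /=.
apply: lerD.
  rewrite leNgt; apply/negP => hlt; have := hmin N (ltW hlt).
  by rewrite ltnn.
by case: ifP => // _; have /andP[] := hg N.+1 TN.
Qed.

Let a := Re s.

Let a0 : 0 < a. Proof. by case/andP: s_strip; rewrite -/a; lra. Qed.

Let npow_small T p : (0 < T)%N -> (T < p)%N -> p%:R `^ (- a) <= T%:R `^ (- a).
Proof.
move=> T0 Tp; have T0' : 0 < T%:R :> R by rewrite ltr0n.
have p0' : 0 < p%:R :> R by rewrite ltr0n (leq_trans _ Tp).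
rewrite !powRN lef_pV2 ?posrE ?powR_gt0 //.
by apply: ge0_ler_powR; rewrite ?nnegrE ?(ltW a0) ?(ltW T0') ?(ltW p0') // ler_nat ltnW.
Qed.

(* Primes with p ^ (- i h) close to w receive aligned phases until their total
   weight reaches |y|; the remaining primes of the block receive balanced signs. *)
Lemma phase_block (e : R) : 0 < e -> exists2 T0, (0 < T0)%N &
  forall T, (T0 <= T)%N -> forall y w : R[i], normc w = 1 ->
  exists2 N, (T <= N)%N & exists z : nat -> R[i], (forall p, normc (z p) = 1) /\
    forall k : 'I_l, normc (\sum_(T.+1 <= p < N.+1 | prime p) npow (sk k) p * z p -
      y * w ^+ k) <= e.
Proof.
move=> e0; have e3 : 0 < e / 3 by rewrite divr_gt0.
have a2 : 0 < 2 * a - 1 by case/andP: s_strip; rewrite -/a; lra.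
have [T1 T10 hT1] := powR_decay a0 e3.
have l1 : 0 < (l.+1)%:R :> R by rewrite ltr0n.
have d2 : 0 < (e / 3) ^+ 2 * (2 * a - 1) / l.+1%:R by rewrite divr_gt0 // mulr_gt0 // exprn_gt0.
have [T2 _ hT2] := powR_decay a2 d2.
exists (maxn T1 T2); first by rewrite leq_max T10.
move=> T; rewrite geq_max => /andP[T1T T2T] y w w1.
have T0 : (0 < T)%N := leq_trans T10 T1T.
have {}hT1 := hT1 T T1T; have {}hT2 := hT2 T T2T.
(* The direction of [y]; at [y = 0] any unimodular value would do. *)
pose phi : R[i] := if y == 0 then 1 else y / (normc y)%:C.
have phi1 : normc phi = 1.
  rewrite /phi; case: eqVneq => [_|y0]; first exact: normc1.
  by rewrite normcM normcV normc_real ger0_norm ?normc_ge0 // divff // normc_eq0.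
have yE : y = phi * (normc y)%:C.
  rewrite /phi; case: eqVneq => [->|y0]; first by rewrite normc0 mulr0.
  by rewrite divfK //; apply/eqP => -[/eqP]; rewrite normc_eq0 (negbTE y0).
have ny0 := normc_ge0 y.
pose Y := normc y + e / 3.
have Y0 : 0 < Y by rewrite ltr_wpDl.
(* [Y] bounds the total weight of the class and [chi h p ^+ k] is within [k d] of [w ^+ k], which
   costs [e / 3]. The other two thirds are the overshoot and the balanced remainder. *)
pose d : R := e / 3 / (l.+1%:R * Y).
have d0 : 0 < d by rewrite divr_gt0 // mulr_gt0.
pose P p := prime p && (normc (chi h p - w) < d).
have [||||N TN /andP[hN1 hN2]] := @greedy_sum P (fun p => p%:R `^ (- a)) (e / 3) (normc y) T.
- by move=> p Tp; rewrite powR_ge0 /= (le_trans (npow_small T0 Tp)).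
- exact: normc_ge0.
- exact: ltW.
- by apply: (prime_class zetaP (normc y) T h_neq0 w1 d0); case/andP: s_strip.
exists N => //.
have [eps [eps1 heps]] := balanced_signs (fun p => prime p && ~~ (normc (chi h p - w) < d))
  (fun p k => npow (sk k) p) T.+1 N.+1.
(* Dividing by [chi (Im s) p] cancels the argument of [p ^ (- s)], so that the class contributes
   [phi] times a sum with nearly equal directions. *)
pose z p := if normc (chi h p - w) < d then phi / chi (Im s) p else eps p.
exists z; split.
  move=> p; rewrite /z; case: ifP => // _.
  by rewrite normcM normcV phi1 normc_chi invr1 mulr1.
move=> k; rewrite (bigID (fun p => normc (chi h p - w) < d)) /=.
have tailsum : \sum_(T.+1 <= p < N.+1) (p%:R `^ (- (2 * a)) : R) <= (e / 3) ^+ 2 / l.+1%:R.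
  have a1 : 1 < 2 * a by lra.
  apply: (le_trans (sum_powR_tail N a1 T0)); rewrite ler_pdivrMr //.
  have -> : 1 - 2 * a = - (2 * a - 1) by ring.
  by apply: (le_trans hT2); rewrite mulrAC.
have B2 : normc (\sum_(T.+1 <= p < N.+1 | prime p && ~~ (normc (chi h p - w) < d))
    npow (sk k) p * z p) <= e / 3.
  rewrite -ler_sqr ?nnegrE ?normc_ge0 ?(ltW e3) //.
  have -> : \sum_(T.+1 <= p < N.+1 | prime p && ~~ (normc (chi h p - w) < d))
    npow (sk k) p * z p = \sum_(T.+1 <= p < N.+1 | prime p && ~~ (normc (chi h p - w) < d))
    eps p * npow (sk k) p.
    by apply: eq_bigr => p /andP[_ hp]; rewrite /z (negbTE hp) mulrC.
  apply: (@le_trans _ _ (\sum_(k < l) normc (\sum_(T.+1 <= p < N.+1 | prime p && ~~ (normc (chi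
    h p - w) < d))
     eps p * npow (sk k) p) ^+ 2)).
    by rewrite (bigD1 k) //= lerDl sumr_ge0 // => i _; exact: sqr_ge0.
  apply: (le_trans heps).
  apply: (@le_trans _ _ (\sum_(T.+1 <= p < N.+1) l%:R * (p%:R `^ (- (2 * a)) : R))).
    rewrite [leLHS]big_mkcond; rewrite !big_nat; apply: ler_sum => p /andP[Tp _].
    have p0 : (0 < p)%N by exact: leq_trans Tp.
    case: ifP => _; last by rewrite mulr_ge0 ?powR_ge0.
    have -> : l%:R * p%:R `^ (- (2 * a)) = \sum_(i < l) (p%:R `^ (- (2 * a)) : R).
      by rewrite sumr_const card_ord mulr_natl.
    apply: ler_sum => i _; rewrite sk_norm // -/a -powR_mulrn ?powR_ge0 // -powRrM.
    by have -> : - a * 2 = - (2 * a) by ring.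
  rewrite -big_distrr /=; apply: (le_trans (ler_wpM2l (ler0n _ l) tailsum)).
  by rewrite mulrCA ler_piMr ?sqr_ge0 // ler_pdivrMr // mul1r ler_nat.
have B1 : normc (\sum_(T.+1 <= p < N.+1 | P p) npow (sk k) p * z p - y * w ^+ k) <= e / 3 + e / 3.
  have -> : \sum_(T.+1 <= p < N.+1 | P p) npow (sk k) p * z p =
      phi * \sum_(T.+1 <= p < N.+1 | P p) (p%:R `^ (- a))%:C * chi h p ^+ k.
    rewrite big_distrr /= big_nat_cond [RHS]big_nat_cond.
    apply: eq_bigr => p /andP[/andP[Tp _] /andP[_ hp]].
    rewrite /z hp npow_shift (npow_real s) npow_realE ?(leq_trans _ Tp) //.
    have c0 := chi_neq0 (Im s) p.
    by field.
  rewrite {1}yE -mulrA -mulrBr normcM phi1 mul1r.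
  set G := \sum_(T.+1 <= p < N.+1 | P p) (p%:R `^ (- a) : R) in hN1 hN2.
  have -> : \sum_(T.+1 <= p < N.+1 | P p) (p%:R `^ (- a))%:C * chi h p ^+ k -
     (normc y)%:C * w ^+ k = \sum_(T.+1 <= p < N.+1 | P p) (p%:R `^ (- a))%:C * (chi h p ^+ k -
       w ^+ k) +
     (G - normc y)%:C * w ^+ k.
    rewrite /G rmorphB rmorph_sum /= mulrBl big_distrl /= addrA -big_split /=; congr (_ - _).
    by apply: eq_bigr => p _; ring.
  rewrite (le_trans (normcD _ _)) // lerD //; last first.
    rewrite normcM normcX w1 expr1n mulr1 normc_real ger0_norm ?subr_ge0 //.
    by rewrite lerBlDl.
  rewrite (le_trans (normc_sum _ _ _)) //.
  apply: (@le_trans _ _ (\sum_(T.+1 <= p < N.+1 | P p) (p%:R `^ (- a)) * (l.+1%:R * d))).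
    apply: ler_sum => p /andP[pp hp].
    rewrite normcM normc_real ger0_norm ?powR_ge0 // ler_wpM2l ?powR_ge0 //.
    have pk (n : nat) : normc (chi h p ^+ n - w ^+ n) <= n%:R * d.
      elim: n => [|n ih]; first by rewrite !expr0 subrr normc0 mul0r.
      have -> : chi h p ^+ n.+1 - w ^+ n.+1 =
         chi h p * (chi h p ^+ n - w ^+ n) + (chi h p - w) * w ^+ n.
        by rewrite !exprS; ring.
      rewrite (le_trans (normcD _ _)) // (normcM (chi h p)) (normcM (_ - _)) normcX w1
        normc_chi expr1n mul1r mulr1.
      by rewrite -natr1 mulrDl mul1r lerD // ltW.
    apply: (le_trans (pk k)); rewrite ler_wpM2r ?(ltW d0) // ler_nat ltnW //.
    by rewrite ltnS ltnW.
  rewrite -big_distrl /= -/G.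
  apply: (@le_trans _ _ (Y * (l.+1%:R * d))).
    by rewrite ler_wpM2r // mulr_ge0 // ltW.
  rewrite /d (_ : Y * (l.+1%:R * (e / 3 / (l.+1%:R * Y))) = e / 3) //.
  by field; rewrite !gt_eqF.
rewrite addrAC (le_trans (normcD _ _)) //.
have -> : e = e / 3 + e / 3 + e / 3 by field.
exact: lerD.
Qed.

(** Consecutive disjoint blocks of primes, one for each [j]; this works because [T0] depends neither
    on the target nor on the starting point. *)
Lemma phase_blocks (n : nat) (e : R) : 0 < e -> exists2 T0, (0 < T0)%N &
  forall T, (T0 <= T)%N -> forall y w : nat -> R[i], (forall j, normc (w j) = 1) ->
  exists2 N, (T <= N)%N & exists z : nat -> R[i], (forall p, normc (z p) = 1) /\
    forall k : 'I_l, normc (\sum_(T.+1 <= p < N.+1 | prime p) npow (sk k) p * z p -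
      \sum_(0 <= j < n) y j * w j ^+ k) <= n%:R * e.
Proof.
move=> e0; have [T0 T00 hT0] := phase_block e0; exists T0 => // T TT y w w1.
elim: n => [|n [N TN [z [z1 hz]]]].
  exists T => //; exists (fun=> 1); split=> [p|k]; first exact: normc1.
  by rewrite !big_geq // subrr normc0 mul0r.
have [N' NN' [z' [z1' hz']]] := hT0 N (leq_trans TT TN) (y n) (w n) (w1 n).
exists N'; first exact: leq_trans NN'.
exists (fun p => if (p <= N)%N then z p else z' p); split=> [p|k]; first by case: ifP.
rewrite (@big_cat_nat _ _ _ N.+1) //= big_nat_recr //=.
have -> : \sum_(T.+1 <= p < N.+1 | prime p) npow (sk k) p * (if (p <= N)%N then z p else z' p) =
   \sum_(T.+1 <= p < N.+1 | prime p) npow (sk k) p * z p.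
  rewrite big_nat_cond [RHS]big_nat_cond; apply: eq_bigr => p /andP[/andP[_ pN] _].
  by rewrite -ltnS pN.
have -> : \sum_(N.+1 <= p < N'.+1 | prime p) npow (sk k) p * (if (p <= N)%N then z p else z' p) =
   \sum_(N.+1 <= p < N'.+1 | prime p) npow (sk k) p * z' p.
  rewrite big_nat_cond [RHS]big_nat_cond; apply: eq_bigr => p /andP[/andP[Np _] _].
  by rewrite leqNgt Np.
rewrite opprD addrACA (le_trans (normcD _ _)) // -natr1 mulrDl mul1r.
by rewrite lerD.
Qed.

Lemma unit_interpolation : exists w : nat -> R[i], (forall j, normc (w j) = 1) /\
  forall W : 'I_l -> R[i], exists y : nat -> R[i],
    forall k : 'I_l, W k = \sum_(0 <= j < l) y j * w j ^+ k.
Proof.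
(* Distinct real parts in [[0, 1)], hence distinct points of the unit circle. *)
pose c (j : nat) : R := j%:R / (j%:R + 1).
have c01 j : 0 <= c j < 1.
  have j0 : 0 <= j%:R :> R by [].
  by rewrite divr_ge0 ?addr_ge0 //= ltr_pdivrMr; lra.
pose w (j : nat) : R[i] := c j +i* Num.sqrt (1 - c j ^+ 2).
have w1 j : normc (w j) = 1.
  have /andP[c0 c1] := c01 j.
  apply/eqP; rewrite -sqrp_eq1 ?normc_ge0 // normc_sqr /= sqr_sqrtr ?subrKC //.
  by rewrite subr_ge0 exprn_ile1 // ltW.
have winj i j : w i = w j -> i = j.
  move=> [+ _]; rewrite /c => /eqP.
  have n0 (n : nat) : n%:R + 1 != 0 :> R by rewrite natr1 pnatr_eq0.
  rewrite eqr_div // => /eqP E.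
  have : i%:R = j%:R :> R by move: E; rewrite !mulrDr; lra.
  by move=> /eqP; rewrite eqr_nat => /eqP.
exists w; split=> // W.
pose V := Vandermonde l (\row_(j < l) w j).
have Vu : V \in unitmx.
  rewrite unitmxE det_Vandermonde unitfE; apply/prodf_neq0 => i _.
  apply/prodf_neq0 => j ij; rewrite subr_eq0 !mxE; apply/eqP => /winj e.
  by rewrite e ltnn in ij.
pose y := invmx V *m \col_k W k.
exists (fun j => if insub j is Some j' then y j' 0 else 0) => k.
have : V *m y = \col_k W k by rewrite mulKVmx.
move=> /matrixP /(_ k 0); rewrite !mxE => <-.
rewrite big_mkord; apply: eq_bigr => j _; rewrite !mxE mulrC.
by rewrite valK /y mxE.
Qed.

(** [T0] has to be independent of [W]: in [phase_product] the targets are logarithms involving the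
    primes up to [T]. *)
Lemma phase_sums (e : R) : 0 < e -> exists2 T0, (0 < T0)%N &
  forall T, (T0 <= T)%N -> forall W : 'I_l -> R[i],
  exists2 N, (T <= N)%N & exists z : nat -> R[i], (forall p, normc (z p) = 1) /\
    forall k : 'I_l,
      normc (\sum_(T.+1 <= p < N.+1 | prime p) npow (sk k) p * z p - W k) <= e.
Proof.
move=> e0; have e1 : 0 < e / l.+1%:R by rewrite divr_gt0.
have [T0 T00 hT0] := phase_blocks l e1; exists T0 => // T TT W.
have [w [w1 hw]] := unit_interpolation; have [y hy] := hw W.
have [N TN [z [z1 hz]]] := hT0 T TT y w w1.
exists N => //; exists z; split=> // k; rewrite hy (le_trans (hz k)) //.
by rewrite mulrCA ler_piMr ?(ltW e0) // ler_pdivrMr // mul1r ler_nat.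
Qed.

Lemma prod_near1 (P : pred nat) (d : nat -> R[i]) (m n : nat) :
  \sum_(m <= p < n | P p) normc (d p) <= 1 / 2 ->
  normc (\prod_(m <= p < n | P p) (1 + d p) - 1) <= 2 * \sum_(m <= p < n | P p) normc (d p).
Proof.
have [mn|nm] := leqP n m; first by rewrite !big_geq // subrr normc0 mulr0.
rewrite -(subnKC (ltnW nm)); elim: (n - m)%N => [|k ih].
  by rewrite addn0 !big_geq // subrr normc0 mulr0.
rewrite addnS !(big_mkcond P) !big_nat_recr ?leq_addr //= -!(big_mkcond P) /=.
set S := \sum_(_ <= p < _ | P p) _ in ih *; set Pi := \prod_(_ <= p < _ | P p) _ in ih *.
case: ifP => _; last by rewrite addr0 mulr1.
have d0 := normc_ge0 (d (m + k)%N) => hS.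
have S1 : S <= 1 / 2 by lra.
have {}ih := ih S1.
have -> : Pi * (1 + d (m + k)%N) - 1 = (Pi - 1) + d (m + k)%N + (Pi - 1) * d (m + k)%N by ring.
rewrite (le_trans (normcD _ _)) // (normcM (Pi - 1)).
have h1 := normcD (Pi - 1) (d (m + k)%N).
have h2 : normc (Pi - 1) <= 1 by lra.
have := ler_wpM2r d0 h2; rewrite mul1r => h3; lra.
Qed.

(** The linear terms cancel; [3 / 2 * 8 + 1 = 13]. *)
Lemma one_sub_cexp (v : R[i]) : normc v <= 2^-1 ->
  normc ((1 - v) * cexp v - 1) <= 13 * normc v ^+ 2.
Proof.
move=> v2; have := cexp_bound v2; set rho := cexp v - 1 - v => hr.
have -> : (1 - v) * cexp v - 1 = (1 - v) * rho - v ^+ 2 by rewrite /rho; ring.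
rewrite (le_trans (normcB _ _)) // normcM normcX.
have h1 : normc (1 - v) <= 3 / 2.
  by rewrite (le_trans (normcB _ _)) // normc1; lra.
have : normc (1 - v) * normc rho <= 3 / 2 * (8 * normc v ^+ 2).
  by rewrite ler_pM ?normc_ge0.
lra.
Qed.

(** Primes up to some [T >= L] keep phase 1. The later ones make [\sum v p] approximate a logarithm
    of [c] times the product so far, where [v p = p ^ (- s_k) z_p]. Then
    [1 - v = e ^ (- v) ((1 - v) e ^ v)], and the last factors multiply to nearly 1 because the tail
    of [p ^ (- 2 Re s)] is small. *)
Lemma phase_product (c : R[i]) (e : R) (L : nat) : c != 0 -> 0 < e ->
  exists2 Q, (L <= Q)%N & exists z : nat -> R[i],
    [/\ forall p, normc (z p) = 1, forall p, (p <= L)%N -> z p = 1 &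
    forall k : 'I_l, normc (c * \prod_(0 <= p < Q.+1 | prime p)
      (1 - npow (sk k) p * z p) - 1) <= e].
Proof.
(* The exponential is off by [5 e1], the correcting product by [2 e1], and their interaction by
   [5 e1]. *)
move=> c0 e0; pose e1 : R := Num.min (2^-1) (e / 12).
have e10 : 0 < e1 by rewrite lt_min divr_gt0 // invr_gt0 ltr0n.
have e12 : e1 <= 2^-1 by rewrite ge_min lexx.
have e1e : 12 * e1 <= e by rewrite mulrC -ler_pdivlMr // ge_min lexx orbT.
have [T0 T00 hT0] := phase_sums e10.
have a2 : 0 < 2 * a - 1 by case/andP: s_strip; rewrite -/a; lra.
have e130 : 0 < e1 / 13 * (2 * a - 1) by rewrite mulr_gt0 // divr_gt0.
have [T1 _ hT1] := powR_decay a2 e130.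
have i20 : 0 < 2^-1 :> R by rewrite invr_gt0 ltr0n.
have [T2 T20 hT2] := powR_decay a0 i20.
(* [T1] makes the sum of the squares [p ^ (- 2 a)] small, [T2] brings each [v p] into the range of
   [one_sub_cexp]. *)
pose T := maxn (maxn L T0) (maxn T1 T2).
have LT : (L <= T)%N by rewrite !leq_max leqnn.
have T0T : (T0 <= T)%N by rewrite !leq_max leqnn orbT.
have T1T : (T1 <= T)%N by rewrite !leq_max leqnn !orbT.
have T2T : (T2 <= T)%N by rewrite !leq_max leqnn !orbT.
have Tp : (0 < T)%N := leq_trans T00 T0T.
pose B k := eulerD T (sk k).
have B0 k : B k != 0.
  by apply: eulerD_neq0; rewrite /sk Re_shift.
have hV (k : 'I_l) : exists V, cexp V = c * B k.
  by have [|w []] := @cexp_surj R (c * B k); [rewrite mulf_neq0|move=> w1 _; exists w].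
have [V hVE] := choice hV.
have [Q TQ [z [z1 hz]]] := hT0 T T0T V.
exists Q; first exact: leq_trans TQ.
exists (fun p => if (p <= T)%N then 1 else z p); split.
- by move=> p; case: ifP => // _; exact: normc1.
- by move=> p pL; rewrite (leq_trans pL LT).
move=> k; rewrite (@big_cat_nat _ _ _ T.+1) //=.
have -> : \prod_(0 <= p < T.+1 | prime p) (1 - npow (sk k) p * (if (p <= T)%N then 1 else z p))
  = B k.
  rewrite big_nat_cond /B /eulerD [RHS]big_nat_cond; apply: eq_bigr => p /andP[/andP[_ pT] _].
  by rewrite -ltnS pT mulr1.
pose v p := npow (sk k) p * z p.
have -> : \prod_(T.+1 <= p < Q.+1 | prime p) (1 - npow (sk k) p * (if (p <= T)%N then 1 else z p)) =
   \prod_(T.+1 <= p < Q.+1 | prime p) (1 - v p).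
  rewrite big_nat_cond [RHS]big_nat_cond; apply: eq_bigr => p /andP[/andP[pT _] _].
  by rewrite leqNgt pT.
rewrite mulrA -hVE.
pose dd p := (1 - v p) * cexp (v p) - 1.
have -> : cexp (V k) * \prod_(T.+1 <= p < Q.+1 | prime p) (1 - v p) =
   cexp (V k - \sum_(T.+1 <= p < Q.+1 | prime p) v p) *
   \prod_(T.+1 <= p < Q.+1 | prime p) (1 + dd p).
  rewrite cexpD -mulrA -sumrN cexp_sum -big_split /=; congr (_ * _).
  apply: eq_bigr => p _; rewrite /dd subrKC mulrCA cexpN mulVf ?mulr1 //.
  exact: cexp_neq0.
have vn p : (T < p)%N -> normc (v p) = p%:R `^ (- a).
  by move=> pT; rewrite normcM z1 mulr1 sk_norm // (leq_trans _ pT).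
have sd : \sum_(T.+1 <= p < Q.+1 | prime p) normc (dd p) <= e1.
  apply: (@le_trans _ _ (\sum_(T.+1 <= p < Q.+1) 13 * (p%:R `^ (- (2 * a)) : R))).
    rewrite [leLHS]big_mkcond !big_nat; apply: ler_sum => p /andP[pT _].
    case: ifP => _; last by rewrite mulr_ge0 ?powR_ge0.
    have := @one_sub_cexp (v p); rewrite vn // => hv.
    have -> : - (2 * a) = - a * 2 by ring.
    rewrite powRrM powR_mulrn ?powR_ge0 // hv //.
    exact: le_trans (npow_small Tp pT) (hT2 _ T2T).
  have a1 : 1 < 2 * a by lra.
  rewrite -big_distrr /=; have := sum_powR_tail Q a1 Tp.
  have := hT1 _ T1T; have -> : - (2 * a - 1) = 1 - 2 * a by ring.
  move=> h1 h2; rewrite mulrC -ler_pdivlMr // (le_trans h2) // ler_pdivrMr //.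
have sd2 : \sum_(T.+1 <= p < Q.+1 | prime p) normc (dd p) <= 1 / 2.
  by rewrite (le_trans sd) // div1r.
have := prod_near1 sd2; set Pi := \prod_(_ <= p < _ | _) _ => hPi.
have := hz k; rewrite -/v.
have -> : \sum_(T.+1 <= p < Q.+1 | prime p) npow (sk k) p * z p = \sum_(T.+1 <= p < Q.+1 |
  prime p) v p by [].
set S := \sum_(_ <= p < _ | _) v p; set Y := V k - S.
have -> : S - V k = - Y by rewrite opprB.
rewrite normcN => hY; have Y0 := normc_ge0 Y.
have Y2 : normc Y <= 2^-1 := le_trans hY e12.
have := cexp_bound Y2; set rho := cexp Y - 1 - Y => hrho.
have hY2 : normc Y ^+ 2 <= 2^-1 * e1 by rewrite expr2 ler_pM.
have x5 : normc (cexp Y - 1) <= 5 * e1.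
  have -> : cexp Y - 1 = rho + Y by rewrite /rho; ring.
  by rewrite (le_trans (normcD _ _)) //; lra.
have y2 : normc (Pi - 1) <= 2 * e1 by lra.
have -> : cexp Y * Pi - 1 = (cexp Y - 1) + (Pi - 1) + (cexp Y - 1) * (Pi - 1) by ring.
rewrite (le_trans (normcD _ _)) // (normcM (cexp Y - 1)).
have h3 := normcD (cexp Y - 1) (Pi - 1).
have h4 : normc (cexp Y - 1) * normc (Pi - 1) <= 5 * 1 * e1.
  apply: (@le_trans _ _ (5 * e1 * (2 * e1))); first by rewrite ler_pM ?normc_ge0.
  have := ler_wpM2l (ltW e10) e12; lra.
lra.
Qed.

End Phases.

(** * Simultaneous approximation of phases *)

Section Resonance.
Variable R : realType.
Implicit Types (h y : R).

Lemma cos_eq1 y : 0 <= y -> cos y = 1 -> exists n : nat, y = n%:R * (2 * pi).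
Proof.
move=> y0 cy; have p0 : 0 < 2 * pi :> R by rewrite mulr_gt0 // pi_gt0.
pose n := Num.truncn (y / (2 * pi)); exists n.
have yp : 0 <= y / (2 * pi) by rewrite divr_ge0 // ltW.
have /andP[n1 n2] := truncn_itv yp.
rewrite ler_pdivlMr // in n1; rewrite ltr_pdivrMr // -/n -natr1 mulrDl mul1r in n2.
pose x := y - n%:R * (2 * pi).
have cx : cos x = 1.
  rewrite -[RHS]cy; have P (m : nat) z : cos (z + (pi *+ 2) *+ m) = cos z :> R.
    by elim: m => [|m ih]; rewrite ?mulr0n ?addr0 // mulrSr addrA cosD2pi.
  by rewrite -(P n x); congr cos; rewrite /x -[pi *+ 2]mulr_natl -[_ *+ n]mulr_natr; ring.
have [x0|x0] := eqVneq x 0; first by move/eqP: x0; rewrite subr_eq0 => /eqP.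
have xp : 0 < x by rewrite lt_neqAle eq_sym x0 subr_ge0.
have x2 : 0 < x / 2 < pi by rewrite divr_gt0 //= ltr_pdivrMr // mulrC /x; lra.
have h2 := sin_gt0_pi x2.
have := cx; rewrite [in LHS](_ : x = x / 2 + x / 2); last by field.
rewrite cosD -!expr2 => h1; have h3 := cos2Dsin2 (x / 2).
have : sin (x / 2) ^+ 2 = 0 by lra.
by move/eqP; rewrite sqrf_eq0 => /eqP h4; rewrite h4 ltxx in h2.
Qed.

Lemma chi_eq_ln h (a b : nat) : (0 < a)%N -> (0 < b)%N -> chi h a = chi h b ->
  exists n : nat, `|h * (ln a%:R - ln b%:R)| = n%:R * (2 * pi) :> R.
Proof.
move=> a0 b0 E; apply: cos_eq1 => //.
have -> : cos `|h * (ln a%:R - ln b%:R)| = cos (h * (ln b%:R - ln a%:R)) :> R.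
  by case: ger0P => _; [rewrite -cosN|]; congr cos; ring.
have : cexp ('i%C * (h * (ln b%:R - ln a%:R))%:C) = 1.
  have -> : 'i%C * (h * (ln b%:R - ln a%:R))%:C =
    - ('i%C * h%:C) * (ln a%:R)%:C - (- ('i%C * h%:C) * (ln b%:R)%:C) :> R[i].
    by rewrite rmorphM rmorphB /=; ring.
  rewrite cexpD cexpN; have := E; rewrite /chi /npow /cpow => ->.
  by rewrite divff // cexp_neq0.
by rewrite cexp_i => -[].
Qed.

(* A non-trivial relation chi h a = chi h b says that 2 pi / h is a rational
   multiple of ln (a / b), so all such relations are commensurable and involve
   the same primes. *)
Lemma resonant_primes h : h != 0 -> exists P0, forall a b : nat,
  (0 < a)%N -> (0 < b)%N -> chi h a = chi h b ->
  forall p, prime p -> (P0 < p)%N -> logn p a = logn p b.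
Proof.
move=> h0.
have [|hno] := pselect (exists a b : nat, [/\ (0 < a)%N, (b < a)%N, (0 < b)%N & chi h a = chi h
  b]); last first.
  exists 0%N => a b a0 b0 E p _ _; have [ab|ba|-> //] := ltngtP a b.
    by exfalso; apply: hno; exists b, a.
  by exfalso; apply: hno; exists a, b.
move=> [a0 [b0 [a00 ba0 b00 E0]]]; exists a0 => a b ap bp E p pp pa0.
have lnlt (x y : nat) : (0 < x)%N -> (x <= y)%N -> ln x%:R <= ln y%:R :> R.
  by move=> x0 xy; rewrite ler_ln ?posrE ?ltr0n ?(leq_trans x0) // ler_nat.
wlog ab : a b ap bp E / (b <= a)%N.
  have [ba|ab] := leqP b a; first by apply.
  by move=> /(_ b a bp ap (esym E) (ltnW ab)).
have [n0 hn0] := chi_eq_ln a00 b00 E0; have [n hn] := chi_eq_ln ap bp E.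
have l0 : 0 <= ln a0%:R - ln b0%:R :> R by rewrite subr_ge0 lnlt // ltnW.
have l1 : 0 <= ln a%:R - ln b%:R :> R by rewrite subr_ge0 lnlt.
have p2 : 2 * pi != 0 :> R by rewrite gt_eqF // mulr_gt0 // pi_gt0.
have nh : `|h| != 0 by rewrite normr_eq0.
rewrite normrM (ger0_norm l0) in hn0; rewrite normrM (ger0_norm l1) in hn.
have key : n0%:R * (ln a%:R - ln b%:R) = n%:R * (ln a0%:R - ln b0%:R) :> R.
  apply: (mulfI nh); apply: (mulfI p2).
  by rewrite (mulrCA `|h| n0%:R) hn (mulrCA `|h| n%:R) hn0; ring.
have n0p : (0 < n0)%N.
  rewrite lt0n; apply/eqP => n00; move: hn0; rewrite n00 mul0r => /eqP.
  rewrite mulf_eq0 (negbTE nh) /= subr_eq0 => /eqP /ln_inj.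
  rewrite !posrE !ltr0n => /(_ a00 b00) /eqP; rewrite eqr_nat => /eqP e.
  by rewrite e ltnn in ba0.
have lnX (x k : nat) : (0 < x)%N -> ln (x ^ k)%:R = k%:R * ln x%:R :> R.
  by move=> x0; rewrite natrX lnXn ?ltr0n // mulr_natl.
(* The commensurability of the logarithms as an identity of integers. A prime [p > a0 > b0] divides
   neither [a0] nor [b0], so valuations give [n0 * logn p a = n0 * logn p b]. *)
have nE : (a ^ n0 * b0 ^ n = b ^ n0 * a0 ^ n)%N.
  have pos (x k : nat) : (0 < x)%N -> (0 < x ^ k)%N by rewrite expn_gt0 => ->.
  apply/eqP; rewrite -(eqr_nat R); apply/eqP; apply: ln_inj;
    rewrite ?posrE ?ltr0n ?muln_gt0 ?pos //.
  by rewrite !natrM !lnM ?posrE ?ltr0n ?pos // !lnX //; move: key; rewrite !mulrBr; lra.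
have big (x : nat) : (0 < x)%N -> (x < p)%N -> logn p x = 0%N.
  move=> x0 xp; case: (posnP (logn p x)) => //.
  by rewrite logn_gt0 mem_primes => /and3P[_ _ /(dvdn_leq x0)]; rewrite leqNgt xp.
have := congr1 (logn p) nE; rewrite !lognM ?expn_gt0 ?ap ?bp ?a00 ?b00 // !lognX.
rewrite (big a0) // (big b0) ?(ltn_trans ba0) // !muln0 !addn0 => /eqP.
by rewrite eqn_pmul2l // => /eqP.
Qed.

End Resonance.

Section MeanSquare.
Variable R : realType.
Implicit Types (z w : R[i]).

Lemma normc_geometric z n : normc z = 1 -> z != 1 ->
  normc (\sum_(0 <= k < n) z ^+ k) <= 2 / normc (1 - z).
Proof.
move=> z1 zn1; have z0 : 0 < normc (1 - z) by rewrite normc_gt0 subr_eq0 eq_sym.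
rewrite ler_pdivlMr // -normcM big_mkord mulrC -(opprB z) mulNr -subrX1 normcN.
by rewrite (le_trans (normcB _ _)) // normcX z1 expr1n normc1.
Qed.

Lemma normc_sqr_sum (I : finType) (x : I -> R[i]) :
  (normc (\sum_i x i) ^+ 2)%:C = \sum_i \sum_j x i * (x j)^*%C.
Proof.
rewrite normc_sqrC rmorph_sum /= big_distrl /=.
by apply: eq_bigr => i _; rewrite big_distrr.
Qed.

Lemma trig_sqr (I : finType) (c q : I -> R[i]) n : (forall i, normc (q i) = 1) ->
  (normc (\sum_i c i * q i ^+ n) ^+ 2)%:C =
  \sum_i \sum_j c i * (c j)^*%C * (q i / q j) ^+ n.
Proof.
move=> q1; rewrite normc_sqr_sum; apply: eq_bigr => i _; apply: eq_bigr => j _.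
have -> : (c j * q j ^+ n)^*%C = (c j)^*%C * (q j)^-1 ^+ n.
  by rewrite -(conjc_unit (q1 j)) rmorphM rmorphXn.
by rewrite exprMn; ring.
Qed.

(** Pairs of distinct frequencies give geometric sums bounded independently of [N]. [C] depends on
    the gaps between frequencies, so the statement serves a fixed family with [N] growing. *)
Lemma trig_mean_sqr (I : finType) (c q : I -> R[i]) : (forall i, normc (q i) = 1) ->
  exists2 C : R, 0 <= C & forall N : nat,
    normc ((\sum_(0 <= n < N) normc (\sum_i c i * q i ^+ n) ^+ 2)%:C -
      N%:R * \sum_i \sum_(j | q i == q j) c i * (c j)^*%C) <= C.
Proof.
move=> q1; have q0 i : q i != 0 by rewrite -normc_gt0 q1.
pose D i j : R := if q i == q j then 0 else normc (c i * (c j)^*%C) * (2 / normc (1 - q i / q j)).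
have D0 i j : 0 <= D i j.
  by rewrite /D; case: ifP => // _; rewrite mulr_ge0 ?divr_ge0 ?normc_ge0.
exists (\sum_i \sum_j D i j).
  by apply: sumr_ge0 => i _; apply: sumr_ge0 => j _.
move=> N; rewrite rmorph_sum /=.
under eq_bigr do rewrite trig_sqr //.
rewrite exchange_big /= big_distrr -sumrB /= (le_trans (normc_sum _ _ _)) //.
apply: ler_sum => i _; rewrite exchange_big /= big_distrr /= [X in _ - X]big_mkcond -sumrB.
rewrite (le_trans (normc_sum _ _ _)) //; apply: ler_sum => j _.
rewrite -big_distrr /= /D; case: eqVneq => [->|qij].
  under eq_bigr do rewrite divff // expr1n.
  by rewrite big_const_nat subn0 iter_addr addr0 mulrC subrr normc0.
rewrite subr0 normcM ler_wpM2l ?normc_ge0 // normc_geometric //.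
  by rewrite normcM normcV !q1 invr1 mulr1.
by apply: contra qij => /eqP e; rewrite -(divfK (q0 j) (q i)) e mul1r.
Qed.

End MeanSquare.

(** * The weight concentrated on shifts with the right phases *)

Section Concentration.
Variable R : realType.
Variables (h : R) (P0 : nat).
Hypothesis hP0 : forall a b : nat, (0 < a)%N -> (0 < b)%N -> chi h a = chi h b ->
  forall p, prime p -> (P0 < p)%N -> logn p a = logn p b.

Variables (Q : nat) (z : nat -> R[i]).
Hypothesis QP0 : (P0 <= Q)%N.
Hypothesis z_unit : forall p, normc (z p) = 1.
Hypothesis z_P0 : forall p, (p <= P0)%N -> z p = 1.

Let ps := [seq p <- iota 0 Q.+1 | prime p].
Let m := size ps.
Let pr (j : 'I_m) := nth 0%N ps j.

Let pr_prime j : prime (pr j).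
Proof. by have : pr j \in ps; [exact: mem_nth|rewrite mem_filter => /andP[]]. Qed.

Let pr_Q j : (pr j <= Q)%N.
Proof.
have : pr j \in ps by rewrite mem_nth.
by rewrite mem_filter mem_iota => /andP[_]; rewrite add0n ltnS.
Qed.

Let pr_inj : injective pr.
Proof.
move=> i j e; apply: val_inj; apply/eqP.
by rewrite -(nth_uniq 0%N (ltn_ord i) (ltn_ord j)) ?filter_uniq ?iota_uniq //; apply/eqP.
Qed.

Let prP p : prime p -> (p <= Q)%N -> exists j, pr j = p.
Proof.
move=> pp pQ; have pin : p \in ps by rewrite mem_filter pp mem_iota add0n ltnS.
by have hi : (index p ps < m)%N by [rewrite index_mem]; exists (Ordinal hi); exact: nth_index.
Qed.

Section Weight.
Variable r : nat.
Notation fam := {ffun 'I_m -> 'I_r.+1}.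

(** The product kernel [ker] expands over exponent vectors [f]: the term of [f] is [wt f * ph f]
    times [chi h (num f) ^+ n]. *)
Let num (f : fam) : nat := \prod_j pr j ^ f j.
Let wt (f : fam) : R := \prod_j kcoef R r (f j).
Let ph (f : fam) : R[i] := \prod_j (z (pr j))^-1 ^+ f j.
Let ker (n : nat) : R[i] := \prod_j (((1 + (z (pr j))^-1 * chi h (pr j) ^+ n) / 2) ^+ r).

Let num_gt0 f : (0 < num f)%N.
Proof. by apply: prodn_gt0 => j; rewrite expn_gt0 prime_gt0 ?pr_prime. Qed.

Let logn_num f p : prime p -> logn p (num f) = (\sum_(j | pr j == p) f j)%N.
Proof.
move=> pp; rewrite /num [RHS]big_mkcond /=.
suff : forall s : seq 'I_m, (0 < \prod_(j <- s) pr j ^ f j)%N /\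
   logn p (\prod_(j <- s) pr j ^ f j) = (\sum_(j <- s) if pr j == p then f j : nat else 0)%N.
  by move=> /(_ (index_enum 'I_m)) [].
elim=> [|j t [t0 ih]]; first by rewrite !big_nil logn1.
rewrite !big_cons; have pj : (0 < pr j ^ f j)%N by rewrite expn_gt0 prime_gt0 ?pr_prime.
rewrite muln_gt0 pj t0; split=> //; rewrite lognM // ih lognX logn_prime // eq_sym.
by case: (pr j == p); rewrite ?muln1 ?muln0.
Qed.

Let logn_num_pr f j : logn (pr j) (num f) = f j.
Proof.
rewrite logn_num ?pr_prime // (big_pred1 j) // => i /=.
by apply/eqP/eqP => [/pr_inj|->].
Qed.

Let logn_num_gt f p : prime p -> (Q < p)%N -> logn p (num f) = 0%N.
Proof.
move=> pp Qp; rewrite logn_num // big1 // => j /eqP e.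
by have := pr_Q j; rewrite e leqNgt Qp.
Qed.

Let ker_expand n : ker n = \sum_f (wt f)%:C * ph f * chi h (num f) ^+ n.
Proof.
rewrite /ker; under eq_bigr do rewrite kernel_expand.
rewrite bigA_distr_bigA /=; apply: eq_bigr => f _.
have -> : chi h (num f) = \prod_j chi h (pr j) ^+ f j.
  suff : forall s : seq 'I_m, (0 < \prod_(j <- s) pr j ^ f j)%N /\
     chi h (\prod_(j <- s) pr j ^ f j)%N = \prod_(j <- s) chi h (pr j) ^+ f j.
    by move=> /(_ (index_enum 'I_m)) [].
  elim=> [|j t [t0 ih]]; first by rewrite !big_nil chi1.
  rewrite !big_cons; have pj : (0 < pr j ^ f j)%N by rewrite expn_gt0 prime_gt0 ?pr_prime.
  by rewrite muln_gt0 pj t0; split=> //; rewrite chiM // ih /chi npowX // prime_gt0.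
rewrite /wt rmorph_prod /ph -prodrXl -!big_split /=; apply: eq_bigr => j _.
by rewrite exprMn -mulrA -!exprM (mulnC n).
Qed.

(** Coinciding frequencies differ only in the exponents of primes up to [P0], where the target phase
    is 1. Without this, colliding terms could cancel. *)
Let ph_eq f g : chi h (num f) = chi h (num g) -> ph f = ph g.
Proof.
move=> /(hP0 (num_gt0 _) (num_gt0 _)) E; apply: eq_bigr => j _.
have [jP|Pj] := leqP (pr j) P0; first by rewrite z_P0 // invr1 !expr1n.
by have := E _ (pr_prime j) Pj; rewrite !logn_num_pr => ->.
Qed.

Let ph_unit f : normc (ph f) = 1.
Proof.
by rewrite normc_prod big1 // => j _; rewrite normcX normcV z_unit invr1 expr1n.
Qed.

(** The mean of [normc (ker n) ^+ 2]. Its terms are non-negative, so the diagonal alone yields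
    [mu_ge]. *)
Let mu : R := \sum_f \sum_(g | chi h (num f) == chi h (num g)) wt f * wt g.

Let wt_ge0 f : 0 <= wt f.
Proof. by apply: prodr_ge0 => j _; exact: kcoef_ge0. Qed.

Let mu_ge : (r.+1%:R ^+ m)^-1 <= mu.
Proof.
apply: (@le_trans _ _ (\sum_f wt f ^+ 2)); last first.
  apply: ler_sum => f _; rewrite (bigD1 f) //= expr2 lerDl.
  by apply: sumr_ge0 => g _; rewrite mulr_ge0.
have -> : \sum_f wt f ^+ 2 = \prod_(j < m) \sum_(i < r.+1) kcoef R r i ^+ 2.
  by rewrite bigA_distr_bigA /=; apply: eq_bigr => f _; rewrite /wt -prodrXl.
rewrite prodr_const card_ord -exprVn lerXn2r ?nnegrE ?invr_ge0 //.
  by apply: sumr_ge0 => i _; exact: sqr_ge0.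
exact: sum_kcoef_sqr.
Qed.

Let wt_ph f g : chi h (num f) = chi h (num g) ->
  ((wt f)%:C * ph f) * ((wt g)%:C * ph g)^*%C = (wt f * wt g)%:C.
Proof.
move=> /ph_eq E; have -> : ((wt g)%:C * ph g)^*%C = (wt g)%:C * (ph g)^-1.
  rewrite -(conjc_unit (ph_unit g)) rmorphM; congr (_ * _); exact: conjc_real.
rewrite E.
have p0 : ph g != 0 by rewrite -normc_gt0 ph_unit.
by rewrite mulrACA divff // mulr1 rmorphM.
Qed.

(** Equal frequencies of [num f * u] and [num g * v] force [u = v]: primes up to [Q] divide neither
    [u] nor [v]; a larger one exceeds [P0], so its valuations agree, and it divides neither [num f]
    nor [num g]. Hence the mean factors into [mu] and the sum of squares. *)
Let weighted_mean (Y : nat) (a : nat -> R[i]) :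
  exists2 C : R, 0 <= C & forall N : nat,
  `|\sum_(0 <= n < N) normc (ker n) ^+ 2 *
     normc (\sum_(1 <= u < Y.+1 | coprime u (primorial Q)) a u * chi h u ^+ n) ^+ 2 -
   N%:R * (mu * \sum_(1 <= u < Y.+1 | coprime u (primorial Q)) normc (a u) ^+ 2)| <= C.
Proof.
pose b (u : 'I_Y.+1) : R[i] := if (0 < u)%N && coprime u (primorial Q) then a u else 0.
have bE (F : nat -> R[i]) : \sum_(1 <= u < Y.+1 | coprime u (primorial Q)) a u * F u =
    \sum_(u < Y.+1) b u * F u.
  rewrite -(big_mkord xpredT (fun u => (if (0 < u)%N && coprime u (primorial Q) then a u else
    0) * F u)).
  rewrite [RHS]big_nat_recl //= mul0r add0r big_mkcond big_add1 /=.
  by apply: eq_bigr => u _; case: ifP; rewrite ?mul0r.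
have bE2 : \sum_(1 <= u < Y.+1 | coprime u (primorial Q)) normc (a u) ^+ 2 =
    \sum_(u < Y.+1) normc (b u) ^+ 2.
  rewrite -(big_mkord xpredT (fun u => normc (if (0 < u)%N && coprime u (primorial Q) then a u
    else 0) ^+ 2)).
  rewrite [RHS]big_nat_recl //= normc0 expr0n add0r big_mkcond big_add1 /=.
  by apply: eq_bigr => u _; case: ifP; rewrite ?normc0 ?expr0n.
pose c (fu : fam * 'I_Y.+1) : R[i] := (wt fu.1)%:C * ph fu.1 * b fu.2.
pose q (fu : fam * 'I_Y.+1) : R[i] := chi h (num fu.1 * fu.2).
have q1 fu : normc (q fu) = 1 by exact: normc_chi.
have [C C0 hC] := trig_mean_sqr c q1; exists C => // N.
have sumE n : normc (ker n) ^+ 2 * normc (\sum_(1 <= u < Y.+1 | coprime u (primorial Q)) a u *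
  chi h u ^+ n) ^+ 2 =
    normc (\sum_fu c fu * q fu ^+ n) ^+ 2.
  rewrite -exprMn -normcM ker_expand bE big_distrl /=; congr (normc _ ^+ 2).
  have -> : \sum_fu c fu * q fu ^+ n = \sum_f \sum_u c (f, u) * q (f, u) ^+ n.
    by rewrite pair_bigA /=; apply: eq_bigr => -[].
  apply: eq_bigr => f _; rewrite big_distrr /=; apply: eq_bigr => u _.
  rewrite /c /q /= {1 2}/b; case: ifP => [/andP[u0 _]|_]; last by rewrite !(mulr0, mul0r).
  by rewrite chiM ?num_gt0 // [X in _ = _ * X]exprMn; ring.
under eq_bigr do rewrite sumE.
rewrite -normc_real rmorphB /= (_ : (N%:R * _)%:C = N%:R * \sum_i \sum_(j | q i == q j) c i *
  (c j)^*%C) //.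
rewrite rmorphM rmorph_nat; congr (_ * _).
have -> : \sum_i \sum_(j | q i == q j) c i * (c j)^*%C =
    \sum_f \sum_u \sum_g \sum_v (if q (f, u) == q (g, v) then c (f, u) * (c (g, v))^*%C else 0).
  rewrite pair_bigA /=; apply: eq_bigr => -[f u] _; rewrite big_mkcond pair_bigA /=.
  by apply: eq_bigr => -[g v].
rewrite bE2 /mu big_distrl rmorph_sum /=; apply: eq_bigr => f _.
rewrite big_distrr rmorph_sum /=; apply: eq_bigr => u _.
rewrite big_distrl rmorph_sum /= big_mkcond; apply: eq_bigr => g _.
rewrite (bigD1 u) //= [X in _ + X]big1 ?addr0.
  have [b0|b0] := eqVneq (b u) 0.
    by rewrite b0 normc0 expr0n mulr0 /c /= b0 mulr0 mul0r !if_same.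
  have u0 : (0 < u)%N by move: b0; rewrite /b; case: ifP => [/andP[]|]; rewrite ?eqxx.
  rewrite /q /= !chiM // (inj_eq (mulIf (chi_neq0 _ _))).
  case: eqVneq => [E|//].
  have -> : (wt f * wt g * normc (b u) ^+ 2)%:C = (wt f * wt g)%:C * (b u * (b u)^*%C) :> R[i].
    by rewrite -normc_sqrC -rmorphM.
  rewrite -wt_ph // /c /=.
  have -> : ((wt g)%:C * ph g * b u)^*%C = ((wt g)%:C * ph g)^*%C * (b u)^*%C by rewrite rmorphM.
  by ring.
move=> v vu; case: eqP => // E.
have [b0|b0] := eqVneq (b u) 0; first by rewrite /c /= b0 mulr0 mul0r.
have [b1|b1] := eqVneq (b v) 0; first by rewrite /c /= b1 mulr0 conjc0 mulr0.
have bP (w : 'I_Y.+1) : b w != 0 -> (0 < w)%N /\ coprime w (primorial Q).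
  by rewrite /b; case: ifP => [/andP[]|]; rewrite ?eqxx.
have [u0 uQ] := bP _ b0; have [v0 vQ] := bP _ b1.
case/eqP: vu; apply/val_inj/(eqn_from_log v0 u0) => p.
have [pp|np] := boolP (prime p); last by rewrite /logn (negbTE np).
have [pQ|Qp] := leqP p Q.
  have cop0 (w : 'I_Y.+1) : (0 < w)%N -> coprime w (primorial Q) -> logn p w = 0%N.
    move=> w0 /(coprime_primorialP _ w0) hw; apply/eqP; rewrite -leqn0 leqNgt logn_gt0.
    by apply/negP; rewrite mem_primes => /and3P[_ _ /(hw p pp)]; rewrite ltnNge pQ.
  by rewrite !cop0.
have := hP0 _ _ E pp (leq_ltn_trans QP0 Qp); rewrite !muln_gt0 !num_gt0 u0 v0 => /(_ isT isT).
by rewrite !lognM ?num_gt0 // !logn_num_gt // !add0n.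
Qed.

Lemma kernel_weight : exists mu (W : nat -> R),
  [/\ (r.+1%:R ^+ m)^-1 <= mu, forall n, 0 <= W n <= 1,
    forall n (d : R) p, 0 <= d -> prime p -> (p <= Q)%N ->
      d <= normc (chi h p ^+ n - z p) -> W n <= (1 - d ^+ 2 / 4) ^+ r &
    forall Y (a : nat -> R[i]), exists2 C : R, 0 <= C & forall N : nat,
    `|\sum_(0 <= n < N) W n *
      normc (\sum_(1 <= u < Y.+1 | coprime u (primorial Q)) a u * chi h u ^+ n) ^+ 2 -
      N%:R * (mu * \sum_(1 <= u < Y.+1 | coprime u (primorial Q)) normc (a u) ^+ 2)| <= C].
Proof.
exists mu, (fun n => normc (ker n) ^+ 2); split=> //.
- move=> n; rewrite sqr_ge0 /ker normc_prod -prodrXl.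
  by apply: prodr_ile1 => j _; rewrite sqr_ge0 kernel_le1 //
    normcM normcV z_unit normcX normc_chi expr1n invr1 mulr1.
- move=> n d p d0 pp pQ hd; have [j pj] := prP pp pQ.
  have z0 : z p != 0 by rewrite -normc_gt0 z_unit.
  have u1 i : normc ((z (pr i))^-1 * chi h (pr i) ^+ n) = 1.
    by rewrite normcM normcV z_unit normcX normc_chi expr1n invr1 mulr1.
  rewrite /ker normc_prod -prodrXl (bigD1 j) //=.
  apply: (@le_trans _ _ (normc (((1 + (z (pr j))^-1 * chi h (pr j) ^+ n) / 2) ^+ r) ^+ 2)).
    rewrite ler_piMr ?sqr_ge0 //; apply: prodr_ile1 => i _.
    by rewrite sqr_ge0 kernel_le1.
  apply: kernel_small => //; apply: (le_trans hd); rewrite pj.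
  have -> : (z p)^-1 * chi h p ^+ n - 1 = (z p)^-1 * (chi h p ^+ n - z p).
    by rewrite mulrBr mulVf.
  by rewrite normcM normcV z_unit invr1 mul1r.
Qed.

End Weight.

Lemma concentration (d : R) : 0 < d -> exists2 mu : R, 0 < mu & exists W : nat -> R,
  [/\ forall n, 0 <= W n <= 1,
    forall n, (forall p, prime p -> (p <= Q)%N -> normc (chi h p ^+ n - z p) < d) \/
      W n <= mu / 4 &
    forall Y (a : nat -> R[i]), exists2 C : R, 0 <= C & forall N : nat,
    `|\sum_(0 <= n < N) W n *
      normc (\sum_(1 <= u < Y.+1 | coprime u (primorial Q)) a u * chi h u ^+ n) ^+ 2 -
      N%:R * (mu * \sum_(1 <= u < Y.+1 | coprime u (primorial Q)) normc (a u) ^+ 2)| <= C].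
Proof.
move=> d0; pose d' := Num.min d 1.
have d'0 : 0 < d' by rewrite lt_min d0 ltr01.
have d'1 : d' <= 1 by rewrite ge_min lexx orbT.
have d'd : d' <= d by rewrite ge_min lexx.
have k01 : 0 < 1 - d' ^+ 2 / 4 < 1.
  have : 0 < d' ^+ 2 by rewrite exprn_gt0.
  have : d' ^+ 2 <= 1 by rewrite exprn_ile1 // ltW.
  by move=> ? ?; apply/andP; split; lra.
(* With one wrong phase W is at most the r-th power of [1 - d' ^+ 2 / 4], whereas [mu] is at least
   [(r + 1) ^- m]: a large [r] brings the former below [mu / 4]. *)
have [|r hr] := @expr_poly_decay R m _ 4^-1 k01; first by rewrite invr_gt0.
have [mu [W [hmu W01 Wbad Wmean]]] := kernel_weight r.
have rm : 0 < r.+1%:R ^+ m :> R by rewrite exprn_gt0 // ltr0n.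
exists mu; first by rewrite (lt_le_trans _ hmu) // invr_gt0.
exists W; split=> // n; have [hn|hn] := pselect (exists p, [/\ prime p, (p <= Q)%N &
   d' <= normc (chi h p ^+ n - z p)]).
  right; have [p [pp pQ hp]] := hn.
  rewrite (le_trans (Wbad n d' p (ltW d'0) pp pQ hp)) // ler_pdivlMr // mulrC.
  apply: le_trans hmu; rewrite -[leRHS]mul1r ler_pdivlMr //; lra.
left=> p pp pQ; rewrite ltNge; apply/negP => hd; apply: hn; exists p; split=> //.
exact: le_trans hd.
Qed.

End Concentration.

(** * Mean squares of Dirichlet polynomials *)

Section GridSums.
Variable R : realType.
Implicit Types (z w : R[i]).

Lemma normc_conj z : normc z^*%C = normc z.
Proof. by case: z => a b; rewrite /ComplexField.Normc.normc /= sqrrN. Qed.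

Lemma sqr_normcD z w : normc (z + w) ^+ 2 <= 2 * normc z ^+ 2 + 2 * normc w ^+ 2.
Proof.
apply: (@le_trans _ _ ((normc z + normc w) ^+ 2)).
  by rewrite lerXn2r ?nnegrE ?addr_ge0 ?normc_ge0 ?normcD.
have := sqr_ge0 (normc z - normc w); rewrite !expr2; lra.
Qed.

(** [S 0] is [S j] minus a sum of differences; square, use Cauchy-Schwarz, and add over [j]. *)
Lemma grid_sobolev (S : nat -> R[i]) (J : nat) :
  J.+1%:R * normc (S 0%N) ^+ 2 <= 2 * \sum_(0 <= j < J.+1) normc (S j) ^+ 2 +
    2 * J.+1%:R ^+ 2 * \sum_(0 <= j < J.+1) normc (S j.+1 - S j) ^+ 2.
Proof.
pose E := \sum_(0 <= j < J.+1) normc (S j.+1 - S j) ^+ 2.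
have hj j : (j < J.+1)%N -> normc (S 0%N) ^+ 2 <= 2 * normc (S j) ^+ 2 + 2 * J.+1%:R * E.
  move=> jJ; have -> : S 0%N = S j + (S 0%N - S j) by ring.
  apply: (le_trans (sqr_normcD _ _)); rewrite lerD2l -mulrA ler_wpM2l //.
  have -> : S 0%N - S j = - \sum_(0 <= i < j) (S i.+1 - S i).
    by rewrite telescope_sumr // opprB.
  rewrite normcN; have := @sum_sqr_ge R J (fun i => normc (S i.+1 - S i)).
  rewrite -(big_mkord xpredT (fun i => normc (S i.+1 - S i))).
  rewrite -(big_mkord xpredT (fun i => normc (S i.+1 - S i) ^+ 2)) -/E.
  apply: le_trans; rewrite lerXn2r ?nnegrE ?normc_ge0 //.
    by apply: sumr_ge0 => i _; exact: normc_ge0.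
  rewrite (le_trans (normc_sum _ _ _)) // [leRHS](@big_cat_nat _ _ _ j) ?(ltnW jJ) //= lerDl.
  by apply: sumr_ge0 => i _; exact: normc_ge0.
have -> : J.+1%:R * normc (S 0%N) ^+ 2 = \sum_(0 <= j < J.+1) normc (S 0%N) ^+ 2.
  by rewrite big_const_nat subn0 iter_addr addr0 mulr_natl.
apply: (@le_trans _ _ (\sum_(0 <= j < J.+1) (2 * normc (S j) ^+ 2 + 2 * J.+1%:R * E))).
  by rewrite !big_nat; apply: ler_sum => j /andP[_ /hj].
rewrite big_split /= -big_distrr /= lerD2l big_const_nat subn0 iter_addr addr0 -mulr_natl.
by rewrite -/E le_eqVlt; apply/orP; left; apply/eqP; ring.
Qed.

Lemma sum_grid (F : nat -> R) (N J : nat) :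
  \sum_(0 <= n < N) \sum_(0 <= j < J) F (n * J + j)%N = \sum_(0 <= k < N * J) F k.
Proof.
elim: N => [|N ih]; first by rewrite mul0n !big_geq.
rewrite big_nat_recr //= ih [RHS](@big_cat_nat _ _ _ (N * J)) //=; last by rewrite mulSn leq_addl.
congr (_ + _); rewrite -[X in _ = \sum_(X <= i < _) _]add0n big_addn mulSn addnK.
by apply: eq_bigr => j _; rewrite addnC.
Qed.

Lemma trig_sqr_bound (I : finType) (c q : I -> R[i]) (g : I -> I -> R) (K : nat) :
  (forall i, normc (q i) = 1) ->
  (forall i j, j != i -> q i != q j /\ 2 / normc (1 - q i / q j) <= g i j) ->
  \sum_(0 <= k < K) normc (\sum_i c i * q i ^+ k) ^+ 2 <=
  K%:R * \sum_i normc (c i) ^+ 2 + \sum_i \sum_(j | j != i) normc (c i) * normc (c j) * g i j.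
Proof.
move=> q1 hg; have q0 i : q i != 0 by rewrite -normc_gt0 q1.
have S0 : 0 <= \sum_(0 <= k < K) normc (\sum_i c i * q i ^+ k) ^+ 2.
  by apply: sumr_ge0 => k _; exact: sqr_ge0.
rewrite -(ger0_norm S0) -normc_real rmorph_sum /=.
under eq_bigr do rewrite trig_sqr //.
rewrite exchange_big /= big_distrr -big_split /= (le_trans (normc_sum _ _ _)) //.
apply: ler_sum => i _; rewrite exchange_big /= (bigD1 i) //=.
rewrite (le_trans (normcD _ _)) // lerD //.
  rewrite -big_distrr /= divff //; under eq_bigr do rewrite expr1n.
  by rewrite big_const_nat subn0 iter_addr addr0 !normcM normc_conj normc_nat mulrC expr2.
rewrite (le_trans (normc_sum _ _ _)) //; apply: ler_sum => j ji.
rewrite -big_distrr /= normcM (normcM (c i)) normc_conj ler_wpM2l ?mulr_ge0 ?normc_ge0 //.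
have [qij hq] := hg i j ji; apply: le_trans hq.
rewrite normc_geometric //; first by rewrite normcM normcV !q1 invr1 mulr1.
by apply: contra qij => /eqP e; rewrite -(divfK (q0 j) (q i)) e mul1r.
Qed.

Lemma cexp_i_gap (x : R) : `|x| <= 1 / 16 ->
  `|x| / 2 <= normc (cexp ('i%C * x%:C) - 1) <= 2 * `|x|.
Proof.
move=> hx; have E : normc ('i%C * x%:C) = `|x|.
  rewrite -[RHS]normc_real; apply/eqP.
  rewrite -(@eqrXn2 _ 2) ?normc_ge0 // !normc_sqr /=; apply/eqP; ring.
have := @cexp_bound R ('i%C * x%:C); rewrite E => hb.
have {hb} : normc (cexp ('i%C * x%:C) - 1 - 'i%C * x%:C) <= 8 * `|x| ^+ 2 by apply: hb; lra.
set rho := _ - _ - _ => hr.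
have x0 := normr_ge0 x.
have hx2 : 8 * `|x| ^+ 2 <= `|x| / 2.
  have := ler_wpM2l x0 hx; rewrite -expr2; lra.
have h1 := normcD rho ('i%C * x%:C).
have h2 : normc ('i%C * x%:C) <= normc (cexp ('i%C * x%:C) - 1) + normc rho.
  rewrite -[normc rho]normcN (le_trans _ (normcD _ _)) // /rho opprB addrCA subrr addr0 //.
have -> : cexp ('i%C * x%:C) - 1 = rho + 'i%C * x%:C by rewrite /rho; ring.
rewrite E in h1 h2; apply/andP; split; last by lra.
by rewrite /rho subrK; lra.
Qed.

Lemma chi_angle (t : R) m n : chi t m / chi t n = cexp ('i%C * (t * (ln n%:R - ln m%:R))%:C).
Proof.
rewrite /chi /npow -cpowN /cpow -cexpD; congr cexp.
by rewrite rmorphM rmorphB /=; ring.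
Qed.

Lemma ln_ratio (m n : nat) : (0 < n)%N -> (n < m)%N ->
  (m%:R - n%:R) / m%:R <= ln m%:R - ln n%:R :> R.
Proof.
move=> n0 nm; have n0' : 0 < n%:R :> R by rewrite ltr0n.
have m0' : 0 < m%:R :> R by rewrite ltr0n (leq_trans n0) // ltnW.
have h : -1 < n%:R / m%:R - 1 :> R by rewrite ltrBrDl subrr divr_gt0.
have := le_ln1Dx h; rewrite subrKC ln_div ?posrE //.
have -> : (m%:R - n%:R) / m%:R = 1 - n%:R / m%:R :> R by rewrite mulrBl divff // gt_eqF.
lra.
Qed.

(** An upper bound for the reciprocal of the distance between [ln m] and [ln n]. *)
Definition gap (m n : nat) : R := (maxn m n)%:R / `|m%:R - n%:R|.

Lemma gapC m n : gap m n = gap n m.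
Proof. by rewrite /gap maxnC distrC. Qed.

Lemma gap_ge0 m n : 0 <= gap m n.
Proof. by rewrite divr_ge0. Qed.

(** The bound on [t] keeps all angles [t ln (m / n)] within 1/16 of 0, so none comes near a non-zero
    multiple of [2 pi]. *)
Lemma chi_gap (t : R) (Y m n : nat) : 0 < t -> t * ln Y%:R <= 1 / 16 ->
  (0 < m <= Y)%N -> (0 < n <= Y)%N -> m != n ->
  chi t m != chi t n /\ 2 / normc (1 - chi t m / chi t n) <= 4 / t * gap m n.
Proof.
move=> t0 tY /andP[m0 mY] /andP[n0 nY] mn.
have Y0 : (0 < Y)%N := leq_trans m0 mY.
pose x := t * (ln n%:R - ln m%:R : R).
have xE : normc (1 - chi t m / chi t n) = normc (cexp ('i%C * x%:C) - 1).
  by rewrite normcBC chi_angle.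
have lnle (k : nat) : (0 < k)%N -> (k <= Y)%N -> (0 : R) <= ln (k%:R : R) <= ln (Y%:R : R).
  move=> k0 kY; rewrite ln_ge0 ?ler1n //= ler_ln ?posrE ?ltr0n // ler_nat //.
have /andP[lm0 lmY] := lnle m m0 mY; have /andP[ln0' lnY] := lnle n n0 nY.
have hgap : t / gap m n <= `|x|.
  have aux (k j : nat) : (0 < j)%N -> (j < k)%N -> t / gap k j <= t * (ln k%:R - ln j%:R : R).
    move=> j0 jk; rewrite ler_wpM2l ?(ltW t0) // /gap (maxn_idPl (ltnW jk)) invf_div.
    by rewrite ger0_norm ?subr_ge0 ?ler_nat ?(ltnW jk) // ln_ratio.
  rewrite /x; have [mlt|nlt|e] := ltngtP m n; last by rewrite e eqxx in mn.
    by rewrite gapC (le_trans (aux n m m0 mlt)) // ler_norm.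
  rewrite (le_trans (aux m n n0 nlt)) // -normrN (le_trans _ (ler_norm _)) //.
  by rewrite -mulrN opprB.
have g0 : 0 < gap m n.
  by rewrite divr_gt0 ?ltr0n ?leq_max ?m0 // normr_gt0 subr_eq0 eqr_nat.
have x0 : 0 < `|x| by rewrite (lt_le_trans _ hgap) // divr_gt0.
have hx : `|x| <= 1 / 16.
  apply: le_trans tY; rewrite /x normrM gtr0_norm // ler_wpM2l ?(ltW t0) // ler_norml.
  by apply/andP; split; lra.
have /andP[h1 _] := cexp_i_gap hx.
have h2 : 0 < normc (cexp ('i%C * x%:C) - 1) by rewrite (lt_le_trans _ h1) // divr_gt0.
split.
  apply/eqP => e; move: h2; rewrite -xE e divff ?chi_neq0 // subrr normc0 ltxx //.
rewrite xE ler_pdivrMr // (le_trans _ (ler_wpM2l _ h1)) //; last first.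
  by rewrite mulr_ge0 ?divr_ge0 // ltW.
have := ler_wpM2l (ltW (divr_gt0 g0 t0)) hgap.
have -> : gap m n / t * (t / gap m n) = 1 by field; rewrite !gt_eqF.
lra.
Qed.

End GridSums.

Section Hilbert.
Variable R : realType.

Lemma sum_powR_eta (a e : R) (Y : nat) : a <= 1 -> 0 < e ->
  \sum_(0 <= m < Y) (m.+1%:R `^ (- a) : R) <= (1 + e^-1) * Y%:R `^ (1 - a + e).
Proof.
move=> a1 e0; have e1 : 1 < 1 + e by rewrite ltrDl.
have := sum_powR_bound Y e1; rewrite addrAC subrr add0r big_add1 /= => hb.
apply: (@le_trans _ _ (\sum_(0 <= m < Y) (m.+1%:R `^ (- (1 + e)) * Y%:R `^ (1 - a + e)))).
  rewrite !big_nat; apply: ler_sum => m /andP[_ mY].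
  rewrite [in leLHS](_ : - a = - (1 + e) + (1 - a + e)); last by ring.
  rewrite powRD; last by rewrite pnatr_eq0 implybT.
  rewrite ler_wpM2l ?powR_ge0 // ge0_ler_powR ?nnegrE ?ler0n ?ler_nat //; lra.
by rewrite -big_distrl /= ler_wpM2r ?powR_ge0.
Qed.

Let H (Y : nat) : R := \sum_(0 <= j < Y) j.+1%:R^-1.

Lemma sum_inv_dist (Y : nat) (i : 'I_Y) :
  \sum_(j < Y | j != i) `|i.+1%:R - j.+1%:R|^-1 <= 2 * \sum_(0 <= j < Y) (j.+1%:R^-1 : R).
Proof.
have iY := ltn_ord i.
have -> : \sum_(j < Y | j != i) `|i.+1%:R - j.+1%:R|^-1 =
   \sum_(0 <= j < Y | j != i) `|i.+1%:R - j.+1%:R|^-1 :> R by rewrite big_mkord.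
rewrite (@big_cat_nat _ _ _ i) ?(ltnW iY) //= (@big_cat_nat _ _ _ i.+1 i) //=.
rewrite big_mkcond [X in _ + (X + _)]big_mkcond [X in _ + (_ + X)]big_mkcond /= big_nat1 eqxx add0r.
have -> : 2 * \sum_(0 <= j < Y) (j.+1%:R^-1 : R) = \sum_(0 <= j < Y) j.+1%:R^-1 + \sum_(0 <= j
  < Y) j.+1%:R^-1 by ring.
apply: lerD.
  rewrite big_nat_rev /= [leRHS](@big_cat_nat _ _ _ i) ?(ltnW iY) //= -[leLHS]addr0 lerD //;
    last first.
    by apply: sumr_ge0.
  rewrite !big_nat; apply: ler_sum => j /andP[_ ji]; rewrite add0n.
  case: ifP => _; last by rewrite invr_ge0.
  have -> : i.+1%:R - (i - j.+1).+1%:R = j.+1%:R :> R.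
    by rewrite -natrB; [congr _%:R|]; lia.
  by rewrite ger0_norm.
rewrite -[X in \sum_(X <= k < _) _]add0n big_addn [leRHS](@big_cat_nat _ _ _ (Y - i.+1))
  ?leq_subr //=.
rewrite -[leLHS]addr0 lerD //; last by apply: sumr_ge0.
apply: ler_sum => j _; case: ifP => _; last by rewrite invr_ge0.
have -> : `|i.+1%:R - (j + i.+1).+1%:R| = j.+1%:R :> R.
  by rewrite distrC -natrB; [rewrite ger0_norm //; congr _%:R|]; lia.
by [].
Qed.

(** The larger index satisfies [m ^ (- a) * m <= Y ^ (1 - a)], which leaves harmonic sums of
    [1 / |i - j|]. The logarithms are paid for by [Y ^ (2 e)]. *)
Lemma hilbert_sum (a e : R) : 0 < a < 1 -> 0 < e -> exists2 C : R, 0 <= C &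
  forall Y : nat, \sum_(i < Y) \sum_(j < Y | j != i)
    i.+1%:R `^ (- a) * j.+1%:R `^ (- a) * gap R i.+1 j.+1 <= C * Y%:R `^ (2 - 2 * a + 2 * e).
Proof.
move=> /andP[a0 a1] e0; exists (4 * (1 + e^-1) * (1 + e^-1)).
  by rewrite !mulr_ge0 ?addr_ge0 ?invr_ge0 // ltW.
move=> Y; pose x (i : 'I_Y) : R := i.+1%:R `^ (- a); pose V := Y%:R `^ (1 - a) : R.
have V0 : 0 <= V by exact: powR_ge0.
have x0 i : 0 <= x i by exact: powR_ge0.
have big (i : 'I_Y) : x i * i.+1%:R <= V.
  rewrite -[X in x i * X]powRr1 // -powRD; last by rewrite pnatr_eq0 implybT.
  by rewrite addrC ge0_ler_powR ?nnegrE ?ler0n ?ler_nat ?subr_ge0 // ltW.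
apply: (@le_trans _ _ (\sum_(i < Y) \sum_(j < Y | j != i)
   (V * x i * `|i.+1%:R - j.+1%:R|^-1 + V * x j * `|j.+1%:R - i.+1%:R|^-1))).
  apply: ler_sum => i _; apply: ler_sum => j _.
  rewrite (distrC j.+1%:R) -mulrDl -mulrDr /gap mulrA ler_wpM2r ?invr_ge0 //.
  have [ij|ji] := leqP i.+1 j.+1.
    rewrite -mulrA mulrC; apply: (le_trans (ler_wpM2r (x0 i) (big j))).
    by rewrite ler_wpM2l // lerDl.
  rewrite mulrAC; apply: (le_trans (ler_wpM2r (x0 j) (big i))).
  by rewrite ler_wpM2l // lerDr.
have sym : \sum_(i < Y) \sum_(j < Y | j != i) V * x j * `|j.+1%:R - i.+1%:R|^-1 =
   \sum_(i < Y) \sum_(j < Y | j != i) V * x i * `|i.+1%:R - j.+1%:R|^-1.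
  rewrite (exchange_big_dep xpredT) //=; apply: eq_bigr => i _; apply: eq_bigl => j.
  by rewrite eq_sym.
have -> : \sum_(i < Y) \sum_(j < Y | j != i)
   (V * x i * `|i.+1%:R - j.+1%:R|^-1 + V * x j * `|j.+1%:R - i.+1%:R|^-1) =
   2 * \sum_(i < Y) \sum_(j < Y | j != i) V * x i * `|i.+1%:R - j.+1%:R|^-1.
  rewrite [2]mulr2n mulrDl mul1r -{2}sym -big_split /=.
  by apply: eq_bigr => i _; rewrite -big_split.
pose HY : R := \sum_(0 <= j < Y) j.+1%:R^-1.
have HY0 : 0 <= HY by apply: sumr_ge0.
have HYe : HY <= (1 + e^-1) * Y%:R `^ e.
  have := sum_powR_eta Y (lexx 1) e0; rewrite subrr add0r; apply: le_trans.
  by apply: ler_sum => j _; rewrite -powR_inv1.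
have SX : \sum_(i < Y) x i <= (1 + e^-1) * Y%:R `^ (1 - a + e).
  have := sum_powR_eta Y (ltW a1) e0; apply: le_trans.
  by rewrite big_mkord.
apply: (@le_trans _ _ (2 * \sum_(i < Y) V * x i * (2 * HY))).
  rewrite ler_wpM2l //; apply: ler_sum => i _; rewrite -big_distrr /= ler_wpM2l ?mulr_ge0 //.
  exact: sum_inv_dist.
rewrite -big_distrl /= -big_distrr /=.
have S0 : 0 <= \sum_(i < Y) x i by apply: sumr_ge0.
have -> : Y%:R `^ (2 - 2 * a + 2 * e) = V * Y%:R `^ (1 - a + e) * Y%:R `^ e :> R.
  have -> : 2 - 2 * a + 2 * e = (1 - a) + (1 - a + e) + e by ring.
  have h1 : 0 < 1 - a by rewrite subr_gt0.
  have pD (b c : R) : 0 < b -> 0 < c -> Y%:R `^ (b + c) = Y%:R `^ b * Y%:R `^ c :> R.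
    by move=> b0 c0; rewrite powRD // gt_eqF ?addr_gt0.
  have h2 : 0 < 1 - a + e by lra.
  by rewrite (pD (1 - a + (1 - a + e)) e) // ?(pD (1 - a)) // addr_gt0.
have h3 := ler_pM S0 HY0 SX HYe.
have := ler_wpM2l V0 h3; lra.
Qed.

End Hilbert.

(** * Mean squares over shifts by multiples of h *)

Section MeanSquareBound.
Variable R : realType.

Lemma ln_sqr_le (b : R) (m : nat) : 0 < b -> (0 < m)%N ->
  ln (m%:R : R) ^+ 2 <= 4 / b ^+ 2 * m%:R `^ b.
Proof.
move=> b0 m0; have m0' : 0 < m%:R :> R by rewrite ltr0n.
have b2 : 0 < b / 2 by rewrite divr_gt0.
have h := ln_le_powR b2 m0'.
have -> : 4 / b ^+ 2 * m%:R `^ b = (m%:R `^ (b / 2) / (b / 2)) ^+ 2 :> R.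
  rewrite expr_div_n -(powR_mulrn 2 (powR_ge0 _ _)) -powRrM divfK //.
  by field; rewrite gt_eqF.
by rewrite lerXn2r ?nnegrE ?ln_nat_ge0 // divr_ge0 ?powR_ge0 // ltW.
Qed.

(* Sampling at a step h / J small compared with 1 / ln Y removes the resonances
   h ln (m / n) close to a non-zero multiple of 2 pi; the discrete Sobolev
   inequality pays for the refinement with a factor (ln m) ^ 2. *)
Lemma mean_square (h a : R) : 0 < h -> 1 / 2 < a < 1 -> exists2 C : R, 0 <= C &
  forall (Y N : nat) (c : nat -> R[i]), (0 < Y)%N ->
    (forall m, (0 < m)%N -> normc (c m) <= m%:R `^ (- a)) ->
  \sum_(0 <= n < N) normc (\sum_(1 <= m < Y.+1) c m * chi h m ^+ n) ^+ 2 <=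
  C * (N%:R * \sum_(1 <= m < Y.+1) normc (c m) ^+ 2 * m%:R `^ (a - 1 / 2) + Y%:R `^ (3 / 2 - a)).
Proof.
move=> h0 /andP[a2 a1]; pose k := a - 1 / 2.
have k0 : 0 < k by rewrite subr_gt0.
have k4 : 0 < k / 4 by rewrite divr_gt0.
have k2 : 0 < k / 2 by rewrite divr_gt0.
have a01 : 0 < a < 1 by apply/andP; split; lra.
have [D D0 hD] := hilbert_sum a01 k4.
pose Lk := 4 / k ^+ 2; pose Lk2 := 4 / (k / 2) ^+ 2.
have Lk0 : 0 <= Lk by rewrite divr_ge0 ?sqr_ge0.
have Lk20 : 0 <= Lk2 by rewrite divr_ge0 ?sqr_ge0.
exists (2 + 8 * h ^+ 2 * Lk + D * (8 / h + 32 * h * Lk2)).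
  have h8 : 0 <= 8 / h by rewrite divr_ge0 // ltW.
  have h32 : 0 <= 32 * h by rewrite mulr_ge0 // ltW.
  by rewrite addr_ge0 // ?mulr_ge0 // addr_ge0 // mulr_ge0 // mulr_ge0 // sqr_ge0.
move=> Y N c Y0 hc; have Y1 : 1 <= Y%:R :> R by rewrite ler1n.
(* With [t = h / (J + 1)] this ensures [t ln Y <= 1 / 16], the hypothesis of [chi_gap]. *)
pose J := Num.truncn (16 * h * ln Y%:R : R).
pose t := h / J.+1%:R.
have J0 : 0 < J.+1%:R :> R by rewrite ltr0n.
have t0 : 0 < t by rewrite divr_gt0.
have tJ : t * J.+1%:R = h by rewrite /t divfK // gt_eqF.
have lY0 : 0 <= ln Y%:R :> R := ln_nat_ge0 R Y.
have tY : t * ln Y%:R <= 1 / 16.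
  rewrite /t mulrAC ler_pdivrMr //.
  have : 16 * h * ln Y%:R <= J.+1%:R by rewrite ltW // truncnS_gt.
  lra.
(* The sum on the finer grid; the wanted values are those at multiples of [J + 1]. *)
pose S (x : nat) : R[i] := \sum_(i < Y) c i.+1 * chi t i.+1 ^+ x.
have SE n : \sum_(1 <= m < Y.+1) c m * chi h m ^+ n = S (n * J.+1)%N.
  rewrite big_add1 /= big_mkord; apply: eq_bigr => i _; congr (_ * _).
  have := chi_ratio t i.+1 J.+1 0; rewrite expr0 mulr1 subr0 tJ => <-.
  by rewrite -exprM mulnC.
have A (F : nat -> R) : \sum_(1 <= m < Y.+1) F m = \sum_(i < Y) F i.+1.
  by rewrite big_add1 /= big_mkord.
rewrite A; under eq_bigr do rewrite SE.
pose P := Y%:R `^ (2 - 2 * a + k / 2) : R.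
have P0 : 0 <= P by exact: powR_ge0.
have unit (i : 'I_Y) : normc (chi t i.+1) = 1 by exact: normc_chi.
have gapP (i j : 'I_Y) : j != i -> chi t i.+1 != chi t j.+1 /\
    2 / normc (1 - chi t i.+1 / chi t j.+1) <= 4 / t * gap R i.+1 j.+1.
  have le (x : 'I_Y) : (0 < x.+1 <= Y)%N by exact: ltn_ord.
  by move=> ji; apply: (chi_gap t0 tY (le i) (le j)); apply: contra ji; rewrite eqSS eq_sym.
have offdiag (b : nat -> R[i]) (B : R) : 0 <= B ->
    (forall i : 'I_Y, normc (b i.+1) <= B * i.+1%:R `^ (- a)) ->
    \sum_(i < Y) \sum_(j < Y | j != i) normc (b i.+1) * normc (b j.+1) * (4 / t * gap R i.+1
      j.+1) <=
    B ^+ 2 * (4 / t) * (D * P).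
  move=> B0 hb; apply: (@le_trans _ _ (\sum_(i < Y) \sum_(j < Y | j != i)
    (B ^+ 2 * (4 / t)) * (i.+1%:R `^ (- a) * j.+1%:R `^ (- a) * gap R i.+1 j.+1))).
    apply: ler_sum => i _; apply: ler_sum => j _.
    have -> : B ^+ 2 * (4 / t) * (i.+1%:R `^ (- a) * j.+1%:R `^ (- a) * gap R i.+1 j.+1) =
      (B * i.+1%:R `^ (- a)) * (B * j.+1%:R `^ (- a)) * (4 / t * gap R i.+1 j.+1) by ring.
    rewrite ler_wpM2r ?mulr_ge0 ?gap_ge0 ?invr_ge0 ?(ltW t0) //.
    by rewrite ler_pM ?normc_ge0.
  under eq_bigr do rewrite -big_distrr /=.
  rewrite -big_distrr /= ler_wpM2l ?mulr_ge0 ?sqr_ge0 ?invr_ge0 ?(ltW t0) //.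
  have := hD Y; rewrite /P; have -> : 2 * (k / 4) = k / 2 by field.
  exact.
pose K := (N * J.+1)%N.
have KE : K%:R = N%:R * J.+1%:R :> R by rewrite natrM.
pose E1 : R := \sum_(i < Y) normc (c i.+1) ^+ 2.
pose E2 : R := \sum_(i < Y) normc (c i.+1) ^+ 2 * i.+1%:R `^ k.
have E12 : E1 <= E2.
  apply: ler_sum => i _; rewrite ler_peMr ?sqr_ge0 //.
  by rewrite -[leLHS](powRr0 i.+1%:R) ler_powR ?ler1n // ltW.
have b1 : \sum_(0 <= x < K) normc (S x) ^+ 2 <= K%:R * E1 + 4 / t * (D * P).
  apply: (le_trans (trig_sqr_bound _ _ unit gapP)); rewrite lerD2l.
  have := @offdiag c 1 ler01; rewrite expr1n mul1r; apply=> i.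
  by rewrite mul1r hc.
pose c' (m : nat) : R[i] := c m * (chi t m - 1).
have step (m : nat) : (0 < m <= Y)%N -> normc (chi t m - 1) <= 2 * t * ln m%:R.
  move=> /andP[m0 mY]; have lm : 0 <= ln (m%:R : R) <= ln (Y%:R : R).
    by rewrite ln_nat_ge0 ler_ln ?posrE ?ltr0n // ler_nat.
  have /andP[lm0 lmY] := lm.
  have tl0 : 0 <= t * ln m%:R := mulr_ge0 (ltW t0) lm0.
  have hx : `|t * (ln (1%:R : R) - ln m%:R)| <= 1 / 16.
    rewrite ln1 sub0r mulrN normrN ger0_norm //.
    by apply: le_trans tY; rewrite ler_wpM2l // ltW.
  have /andP[_] := cexp_i_gap hx; rewrite -chi_angle chi1 divr1 ln1 sub0r mulrN normrN.
  by rewrite ger0_norm // mulrA.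
have dS x : S x.+1 - S x = \sum_(i < Y) c' i.+1 * chi t i.+1 ^+ x.
  by rewrite /S -sumrB; apply: eq_bigr => i _; rewrite /c' exprS; ring.
have b2 : \sum_(0 <= x < K) normc (S x.+1 - S x) ^+ 2 <=
    K%:R * (4 * t ^+ 2 * Lk * E2) + (2 * t * ln Y%:R) ^+ 2 * (4 / t) * (D * P).
  under eq_bigr do rewrite dS.
  apply: (le_trans (trig_sqr_bound _ _ unit gapP)); apply: lerD.
    rewrite ler_wpM2l // /E2 big_distrr /=; apply: ler_sum => i _.
    rewrite /c' normcM exprMn.
    have -> : 4 * t ^+ 2 * Lk * (normc (c i.+1) ^+ 2 * i.+1%:R `^ k) =
      normc (c i.+1) ^+ 2 * (4 * t ^+ 2 * (Lk * i.+1%:R `^ k)) by ring.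
    rewrite ler_wpM2l ?sqr_ge0 //.
    have hs : normc (chi t i.+1 - 1) <= 2 * t * ln i.+1%:R by apply: step; exact: ltn_ord.
    apply: (@le_trans _ _ ((2 * t * ln i.+1%:R) ^+ 2)).
      by rewrite lerXn2r ?nnegrE ?normc_ge0 // mulr_ge0 ?mulr_ge0 ?ln_nat_ge0 ?ltW.
    have -> : (2 * t * ln i.+1%:R) ^+ 2 = 4 * t ^+ 2 * ln i.+1%:R ^+ 2 by ring.
    by apply: ler_wpM2l; [exact: mulr_ge0 (ler0n R 4) (sqr_ge0 t)|exact: ln_sqr_le].
  apply: offdiag; first by rewrite mulr_ge0 // mulr_ge0 // ltW.
  move=> i; rewrite /c' normcM mulrC ler_pM ?normc_ge0 ?hc //.
  apply: (@le_trans _ _ (2 * t * ln i.+1%:R)); first by apply: step; exact: ltn_ord.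
  rewrite ler_wpM2l //; first by rewrite mulr_ge0 // ltW.
  by rewrite ler_ln ?posrE ?ltr0n // ler_nat ltn_ord.
have sob : J.+1%:R * \sum_(0 <= n < N) normc (S (n * J.+1)%N) ^+ 2 <=
    2 * \sum_(0 <= x < K) normc (S x) ^+ 2 +
    2 * J.+1%:R ^+ 2 * \sum_(0 <= x < K) normc (S x.+1 - S x) ^+ 2.
  rewrite -!sum_grid !big_distrr -big_split /=; apply: ler_sum => n _.
  have := grid_sobolev (fun j => S (n * J.+1 + j)%N) J; rewrite addn0.
  by under [X in _ + _ * X]eq_bigr do rewrite addnS.
(* One [k / 2] comes from [hilbert_sum], the other pays for [ln Y ^+ 2]; together
   [2 - 2 a + k = 3 / 2 - a]. *)
have PY : P * Y%:R `^ (k / 2) = Y%:R `^ (3 / 2 - a).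
  rewrite /P -powRD; last by rewrite pnatr_eq0 -lt0n Y0 implybT.
  by congr (_ `^ _); rewrite /k; field.
have Yk1 : 1 <= Y%:R `^ (k / 2) :> R.
  by rewrite -[leLHS](powRr0 Y%:R) ler_powR // ltW.
have lnY : ln Y%:R ^+ 2 <= Lk2 * Y%:R `^ (k / 2) :> R by exact: ln_sqr_le.
rewrite -/k -/E2 -PY -(ler_pM2l J0); apply: (le_trans sob).
have P2 : P <= P * Y%:R `^ (k / 2) by rewrite ler_peMr.
set PP := P * _ in P2 *; set X1 := \sum_(0 <= x < K) _ in b1 *;
  set X2 := \sum_(0 <= x < K) _ in b2 *.
have PP0 : 0 <= PP by rewrite mulr_ge0 ?powR_ge0.
have lnP : ln Y%:R ^+ 2 * P <= Lk2 * PP.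
  by have := ler_wpM2r P0 lnY; rewrite /PP; lra.
have E20 : 0 <= E2.
  by apply: sumr_ge0 => i _; rewrite mulr_ge0 ?sqr_ge0 ?powR_ge0.
have tn : t != 0 by rewrite gt_eqF.
have Jn : J.+1%:R != 0 :> R by rewrite gt_eqF.
have hn : h != 0 by rewrite gt_eqF.
apply: (@le_trans _ _ (J.+1%:R * (N%:R * (2 * E1 + 8 * h ^+ 2 * Lk * E2) +
   D * (8 / h * P + 32 * h * (ln Y%:R ^+ 2 * P))))).
  have e1 : J.+1%:R ^+ 2 * (4 * t ^+ 2 * Lk * E2) = 4 * h ^+ 2 * Lk * E2 by rewrite -tJ; ring.
  have e2 : 2 * (4 / t * (D * P)) = J.+1%:R * (D * (8 / h * P)).
    rewrite -tJ.
    have e (u j x : R) : u != 0 -> j != 0 -> 2 * (4 / u * (D * x)) = j * (D * (8 / (u * j) * x)).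
      by move=> u0 j0; field; rewrite u0 j0.
    exact: e.
  have e3 : 2 * J.+1%:R ^+ 2 * ((2 * t * ln Y%:R) ^+ 2 * (4 / t) * (D * P)) =
     J.+1%:R * (D * (32 * h * (ln Y%:R ^+ 2 * P))) by rewrite -tJ; field; rewrite tn.
  have J2 : 0 <= 2 * J.+1%:R ^+ 2 :> R by rewrite mulr_ge0 ?sqr_ge0.
  apply: (@le_trans _ _ (2 * (K%:R * E1 + 4 / t * (D * P)) + 2 * J.+1%:R ^+ 2 *
    (K%:R * (4 * t ^+ 2 * Lk * E2) + (2 * t * ln Y%:R) ^+ 2 * (4 / t) * (D * P)))).
    by apply: lerD; rewrite ler_wpM2l.
  rewrite !mulrDr e2 e3 KE le_eqVlt; apply/orP; left; apply/eqP.
  have -> : 2 * J.+1%:R ^+ 2 * (N%:R * J.+1%:R * (4 * t ^+ 2 * Lk * E2)) =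
     2 * N%:R * J.+1%:R * (J.+1%:R ^+ 2 * (4 * t ^+ 2 * Lk * E2)) by ring.
  by rewrite e1; ring.
rewrite ler_pM2l //.
have h8 : 0 <= 8 / h by rewrite divr_ge0 // ltW.
have h32 : 0 <= 32 * h by rewrite mulr_ge0 // ltW.
have q1 : 8 / h * P + 32 * h * (ln Y%:R ^+ 2 * P) <= (8 / h + 32 * h * Lk2) * PP.
  by have := ler_wpM2l h8 P2; have := ler_wpM2l h32 lnP; lra.
have q2 : 2 * E1 + 8 * h ^+ 2 * Lk * E2 <= (2 + 8 * h ^+ 2 * Lk) * E2 by lra.
have q3 := ler_wpM2l D0 q1; have q4 := ler_wpM2l (ler0n R N) q2.
have g1 : 0 <= 2 + 8 * h ^+ 2 * Lk by exact: addr_ge0 (ler0n R 2) (mulr_ge0 (mulr_ge0 (ler0n R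
  8) (sqr_ge0 h)) Lk0).
have g2 : 0 <= D * (8 / h + 32 * h * Lk2) by exact: mulr_ge0 D0 (addr_ge0 h8 (mulr_ge0 h32 Lk20)).
set G1 := 2 + _ in g1 q4 *; set G2 := D * (_ + _ * Lk2) in g2 *.
have q5 : D * ((8 / h + 32 * h * Lk2) * PP) = G2 * PP by rewrite /G2 mulrA.
have g3 : 0 <= G1 * PP by exact: mulr_ge0.
have g4 : 0 <= G2 * (N%:R * E2) by exact: mulr_ge0 g2 (mulr_ge0 (ler0n R N) E20).
rewrite (_ : (G1 + G2) * (N%:R * E2 + PP) =
  N%:R * (G1 * E2) + G2 * PP + (G1 * PP + G2 * (N%:R * E2))); last by ring.
by apply: (le_trans (lerD q4 q3)); rewrite q5 lerDl addr_ge0.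
Qed.

End MeanSquareBound.

(** * Finding a good shift *)

Section ProductContinuity.
Variable R : realType.
Implicit Types (a x z : nat -> R[i]).

Lemma prod_lipschitz (P : pred nat) a x z (d : R) (n : nat) :
  0 <= d -> (forall p, normc (x p) = 1) -> (forall p, normc (z p) = 1) ->
  (forall p, P p -> normc (a p) <= 1) ->
  (forall p, P p -> (p < n)%N -> normc (x p - z p) <= d) ->
  normc (\prod_(0 <= p < n | P p) (1 - a p * x p) -
         \prod_(0 <= p < n | P p) (1 - a p * z p)) <= n%:R * 2 ^+ n * d.
Proof.
move=> d0 x1 z1 ha; elim: n => [|n ih] hd.
  by rewrite !big_geq // subrr normc0 !mul0r.
have fac y p : P p -> normc (y p : R[i]) = 1 -> normc (1 - a p * y p) <= 2.
  move=> Pp y1; rewrite (le_trans (normcB _ _)) // normc1 normcM y1 mulr1.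
  by have := ha p Pp; lra.
have {}ih := ih (fun p Pp pn => hd p Pp (ltnW pn)).
have bd : normc (\prod_(0 <= p < n | P p) (1 - a p * x p)) <= 2 ^+ n.
  rewrite big_mkcond /= normc_prod.
  have -> : 2 ^+ n = \prod_(0 <= p < n) (2 : R) by rewrite prodr_const_nat subn0.
  apply: ler_prod => p _; rewrite normc_ge0 /=; case: ifP => [Pp|_]; first exact: fac.
  by rewrite normc1; lra.
rewrite big_mkcond big_nat_recr //= -big_mkcond [X in _ - X]big_mkcond big_nat_recr //= -[X in
  _ - X * _]big_mkcond.
set X := \prod_(0 <= p < n | P p) (1 - a p * x p) in ih bd *.
set Z := \prod_(0 <= p < n | P p) (1 - a p * z p) in ih bd *.
have n0 : 0 <= n%:R * 2 ^+ n * d by rewrite !mulr_ge0 ?exprn_ge0.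
have p0 : 0 <= 2 ^+ n * d by rewrite mulr_ge0 ?exprn_ge0.
have E : n.+1%:R * 2 ^+ n.+1 * d = 2 * (n%:R * 2 ^+ n * d) + 2 * (2 ^+ n * d).
  by rewrite -natr1 exprS; ring.
rewrite E; case: ifP => Pn; last by rewrite !mulr1; lra.
have -> : X * (1 - a n * x n) - Z * (1 - a n * z n) =
   (X - Z) * (1 - a n * z n) - X * (a n * (x n - z n)) by ring.
rewrite (le_trans (normcB _ _)) // lerD //.
  by rewrite normcM mulrC ler_pM ?normc_ge0 // fac.
apply: (@le_trans _ _ (2 ^+ n * (1 * d))); last by rewrite mul1r ler_peMl // ler1n.
rewrite normcM ler_pM ?normc_ge0 // normcM ler_pM ?normc_ge0 ?ha //.
by apply: hd.
Qed.

End ProductContinuity.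

(** * Comparison of weighted means *)

Section Assembly.
Variable R : realType.
Variable zeta : Cplx R -> Cplx R.
Hypothesis zetaP : is_riemann_zeta zeta.
Variables (s : R[i]) (h : R) (l : nat).
Hypothesis h_gt0 : 0 < h.
Hypothesis s_strip : 1 / 2 < Re s < 1.

Let a := Re s.
Let ka := a - 1 / 2.
Let st (n k : nat) : R[i] := s + 'i%C * h%:C * (n + k)%:R.
Let cf (k m : nat) : R[i] := npow (s + 'i%C * h%:C * k%:R) m.

Let ka_gt0 : 0 < ka. Proof. by case/andP: s_strip; rewrite -/a /ka; lra. Qed.
Let a_gt0 : 0 < a. Proof. by case/andP: s_strip; rewrite -/a; lra. Qed.
Let a_lt1 : a < 1. Proof. by case/andP: s_strip. Qed.

Let npow_st n k m : npow (st n k) m = cf k m * chi h m ^+ n.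
Proof. by rewrite /st /cf !npow_shift exprD; ring. Qed.

Let cf_norm k m : (0 < m)%N -> normc (cf k m) = m%:R `^ (- a).
Proof. by move=> m0; rewrite /cf normc_npow // Re_shift. Qed.

Let Im_st n k : Im (st n k) = Im s + h * (n + k)%:R.
Proof. by rewrite /st -!mulrA -(rmorph_nat (real_complex R)) -rmorphM; case: s => x y /=; ring. Qed.

(** A lower bound for the modulus of [1 - 2 ^ (1 - s)] on the line [Re s = a], positive since
    [a < 1]. *)
Let k0 : R := 2 * 2 `^ (- a) - 1.

Let k0_gt0 : 0 < k0.
Proof.
rewrite subr_gt0 -[X in X * _](powRr1 (ler0n R 2)) -powRD ?pnatr_eq0 ?implybT //.
rewrite /powR pnatr_eq0 expR_gt1 mulr_gt0 ?subr_gt0 // ln_gt0 //; lra.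
Qed.

(** The part up to [Q1] of the series of [D zeta - 1]; the coefficient at 1 is set to zero because
    it is the main term. *)
Let head Q Q1 n k : R[i] :=
  \sum_(1 <= u < Q1.+1 | coprime u (primorial Q)) (if (1 < u)%N then cf k u else 0) * chi h u ^+ n.

Let tail Q Q1 Y n k : R[i] :=
  \sum_(1 <= m < Y.+1) (if (Q1 < m)%N then cop R Q m * cf k m else 0) * chi h m ^+ n.

Let dsum_split Q Q1 Y n k : (0 < Q1 <= Y)%N ->
  dsum (@cop R Q) (st n k) Y = 1 + head Q Q1 n k + tail Q Q1 Y n k.
Proof.
move=> /andP[Q10 Q1Y]; rewrite /dsum /tail.
rewrite (@big_cat_nat _ _ _ Q1.+1) //= [X in _ = _ + X](@big_cat_nat _ _ _ Q1.+1) //=.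
rewrite [X in _ = _ + (X + _)]big_nat [X in _ = _ + (X + _)]big1 ?add0r; last first.
  by move=> m /andP[_ mQ]; rewrite ltnNge -ltnS mQ mul0r.
congr (_ + _); last first.
  rewrite big_nat [RHS]big_nat; apply: eq_bigr => m /andP[mQ _].
  by rewrite mQ npow_st mulrA.
rewrite /head [X in 1 + X]big_mkcond big_ltn // [X in 1 + X]big_ltn //=.
rewrite mul0r if_same add0r npow1 mulr1 /cop coprime1n; congr (_ + _).
rewrite big_nat [RHS]big_nat; apply: eq_bigr => m /andP[m1 _].
by rewrite m1 npow_st; case: (coprime m _); rewrite ?mul1r ?mul0r.
Qed.

(** By [dsum_acop] the approximating sum of length [2 Y] is one of length [2 Y] minus [2 w] times
    one of length [Y]. Both contain [1 + head], which therefore appears with the factor [1 - 2 w]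
    and is freed by dividing by it. *)
Let euler_zeta_dist Q Q1 Y n k (e : R) : (0 < Q1 <= Y)%N ->
  normc ((1 - 2 * npow (st n k) 2) * eulerD Q (st n k) * zeta (st n k) -
     dsum (fun m => (acop R Q m)%:C) (st n k) (2 * Y)) <= e ->
  normc (eulerD Q (st n k) * zeta (st n k) - 1) <= normc (head Q Q1 n k) +
    (normc (tail Q Q1 (2 * Y) n k) + 2 * normc (tail Q Q1 Y n k) + e) / k0.
Proof.
move=> hQ; have Q1Y := hQ; case/andP: Q1Y => Q10 Q1Y.
rewrite dsum_acop mulKn // !(@dsum_split Q Q1) // ?Q10 ?(leq_trans Q1Y) ?leq_pmull //.
set w := npow _ 2; set D := eulerD _ _ * zeta _.
set A := head _ _ _ _; set T2 := tail _ _ (2 * Y) _ _; set T1 := tail _ _ Y _ _.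
have w2 : normc w = 2 `^ (- a) by rewrite normc_npow // Re_shift.
have w21 : normc w <= 1.
  by rewrite w2 -[leRHS](powRr0 2) ler_powR ?ler1n // oppr_le0 ltW.
have kw : k0 <= normc (1 - 2 * w).
  have := normcD (1 - 2 * w - 1) 1; have := normcB (1 - 2 * w) 1.
  have -> : 1 - 2 * w - 1 = - (2 * w) by ring.
  by rewrite normcN normcM normc_nat normc1 w2 /k0; lra.
rewrite -mulrA -/D; set E := _ - _ => hE.
have id : (1 - 2 * w) * (D - 1 - A) = E + T2 - 2 * w * T1 by rewrite /E; ring.
have h1 : normc (D - 1 - A) * k0 <= e + normc T2 + 2 * normc T1.
  apply: (@le_trans _ _ (normc (D - 1 - A) * normc (1 - 2 * w))).
    by rewrite ler_wpM2l ?normc_ge0.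
  rewrite mulrC -normcM id (le_trans (normcB _ _)) // lerD //.
    by rewrite (le_trans (normcD _ _)) // lerD.
  by rewrite (normcM (2 * w)) (normcM 2) normc_nat -mulrA ler_wpM2l // ler_piMl ?normc_ge0.
have -> : D - 1 = A + (D - 1 - A) by ring.
rewrite (le_trans (normcD _ _)) // lerD2l ler_pdivlMr //; lra.
Qed.

Let sqr_dist (A x y e : R) : 0 <= A -> 0 <= x -> 0 <= y -> 0 <= e ->
  (A + (x + 2 * y + e) / k0) ^+ 2 <= 2 * A ^+ 2 + 6 / k0 ^+ 2 * (x ^+ 2 + 4 * y ^+ 2 + e ^+ 2).
Proof.
move=> A0 x0 y0 e0; set u := (x + 2 * y + e) / k0.
apply: (@le_trans _ _ (2 * A ^+ 2 + 2 * u ^+ 2)).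
  by have := sqr_ge0 (A - u); rewrite !expr2; lra.
rewrite lerD2l /u expr_div_n.
have -> : 2 * ((x + 2 * y + e) ^+ 2 / k0 ^+ 2) = 2 * (x + 2 * y + e) ^+ 2 / k0 ^+ 2 by rewrite
  mulrA.
rewrite [leRHS]mulrAC ler_wpM2r ?invr_ge0 ?sqr_ge0 //.
have := sqr_ge0 (x - 2 * y); have := sqr_ge0 (x - e); have := sqr_ge0 (2 * y - e).
rewrite !expr2; lra.
Qed.

(** In [mean_square] the squared coefficients carry [m ^ ka], and [- 2 a + ka = - (1 + ka)] still
    converges, with tail of order [Q1 ^ (- ka)]. *)
Let tail_mean : exists2 C : R, 0 <= C & forall Q Q1 Y N k, (0 < Q1)%N -> (0 < Y)%N ->
  \sum_(0 <= n < N) normc (tail Q Q1 Y n k) ^+ 2 <=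
  C * (N%:R * Q1%:R `^ (- ka) + Y%:R `^ (1 - ka)).
Proof.
have [C C0 hC] := mean_square h_gt0 s_strip.
exists (C * (1 + ka^-1)); first by rewrite mulr_ge0 // addr_ge0 // invr_ge0 ltW.
move=> Q Q1 Y N k Q10 Y0.
have cop1 m : normc (cop R Q m) <= 1.
  by rewrite /cop normc_nat; case: (coprime _ _).
have cm m : (0 < m)%N -> normc (if (Q1 < m)%N then cop R Q m * cf k m else 0) <= m%:R `^ (- a).
  move=> m0; case: ifP => _; last by rewrite normc0 powR_ge0.
  by rewrite normcM cf_norm // ler_piMl ?powR_ge0.
apply: (le_trans (hC Y N _ Y0 cm)); rewrite -mulrA ler_wpM2l // mulrDr -/a -/ka.
have -> : 3 / 2 - a = 1 - ka by rewrite /ka; field.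
have hk : 1 <= 1 + ka^-1 by rewrite lerDl invr_ge0 ltW.
apply: lerD; last by rewrite ler_peMl ?powR_ge0.
rewrite mulrCA ler_wpM2l //.
apply: (@le_trans _ _ (ka^-1 * Q1%:R `^ (- ka))); last first.
  by rewrite ler_wpM2r ?powR_ge0 // lerDr.
have ka1 : 1 < 1 + ka by rewrite ltrDl.
have := @sum_powR_tail R (1 + ka) Q1 Y ka1 Q10.
have -> : 1 - (1 + ka) = - ka by ring.
have -> : 1 + ka - 1 = ka by ring.
rewrite mulrC; apply: le_trans.
have [YQ|QY] := leqP Y Q1.
  rewrite [leRHS]big_geq // big_nat big1 // => m /andP[_ mY].
  by rewrite ltnNge (leq_trans _ YQ) // normc0 expr0n mul0r.
rewrite (@big_cat_nat _ _ _ Q1.+1) ?ltnS ?(ltnW QY) //= big_nat big1 ?add0r.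
  rewrite !big_nat; apply: ler_sum => m /andP[mQ _]; rewrite mQ.
  have m0 : (0 < m)%N by exact: leq_trans mQ.
  have -> : - (1 + ka) = - a * 2 + ka by rewrite /ka; field.
  rewrite [leRHS]powRD ?pnatr_eq0 -?lt0n ?m0 ?implybT // ler_wpM2r ?powR_ge0 //.
  rewrite powRrM powR_mulrn ?powR_ge0 // lerXn2r ?nnegrE ?normc_ge0 ?powR_ge0 //.
  by rewrite normcM cf_norm // ler_piMl ?powR_ge0.
by move=> m /andP[_ mQ]; rewrite ltnNge -ltnS mQ normc0 expr0n mul0r.
Qed.

(** At height of order [M ^ b] and length [2 M ^ (b + 1)] the ratio [y] is at most [c / M], so
    [X y ^+ (b + 1)] is bounded and only the prefactor matters. *)
Let tail_bound_le (b : nat) : exists2 C : R, 0 <= C & forall M n k, (0 < M)%N ->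
  (n < M ^ b)%N -> (k < l)%N ->
  tail_bound b.+1 (st n k) (2 * M ^ b.+1) <= C * M%:R `^ (- a).
Proof.
pose c := normc s + h * (l.+1)%:R + b.+1%:R.
have c0 : 0 <= c by rewrite !addr_ge0 ?normc_ge0 // mulr_ge0 // ltW.
exists ((1 + c) ^+ b.+1 + 2 * c ^+ b.+1).
  by rewrite addr_ge0 ?mulr_ge0 ?exprn_ge0 // addr_ge0.
move=> M n k M0 nM kl; have M0' : 0 < M%:R :> R by rewrite ltr0n.
have Mb (j : nat) : (0 < M ^ j)%N by rewrite expn_gt0 M0.
have X0 : 0 < (2 * M ^ b.+1)%:R :> R by rewrite ltr0n muln_gt0 Mb.
rewrite /tail_bound Re_shift; set y := 2 * _ / _.
have Mb1 : 1 <= (M ^ b)%:R :> R by rewrite ler1n.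
have nst : normc (st n k) <= normc s + h * (n + k)%:R.
  rewrite (le_trans (normcD _ _)) // lerD2l -mulrA -(rmorph_nat (real_complex R)) -rmorphM.
  have -> : normc ('i%C * (h * (n + k)%:R)%:C) = h * (n + k)%:R.
    rewrite normcM normc_real ger0_norm ?mulr_ge0 ?(ltW h_gt0) //.
    by rewrite [X in X * _](_ : _ = 1) ?mul1r //; apply/eqP; rewrite -sqrp_eq1 ?normc_ge0 //
      normc_sqr /=; apply/eqP; ring.
  by [].
have nc : normc (st n k) + b.+1%:R <= c * (M ^ b)%:R.
  have h1 : (n + k)%:R <= l.+1%:R * (M ^ b)%:R :> R.
    by rewrite -natrM ler_nat mulSn leq_add ?(ltnW nM) // (leq_trans (ltnW kl)) // leq_pmulr.
  have h2 := ler_wpM2l (ltW h_gt0) h1.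
  have h3 := ler_wpM2l (normc_ge0 s) Mb1.
  have h4 := ler_wpM2l (ler0n R b.+1) Mb1.
  by rewrite /c !mulrDl; lra.
have y0 : 0 <= y by rewrite divr_ge0 ?mulr_ge0 ?addr_ge0 ?normc_ge0.
have yc : y <= c / M%:R.
  rewrite /y ler_pdivrMr // expnS !natrM.
  have -> : c / M%:R * (2 * (M%:R * (M ^ b)%:R)) = 2 * (c * (M ^ b)%:R) :> R.
    by field; rewrite gt_eqF.
  by rewrite ler_wpM2l.
have yc1 : y <= c by rewrite (le_trans yc) // ler_pdivrMr // ler_peMr // ler1n.
rewrite mulrC ler_pM ?powR_ge0 //.
- by rewrite addr_ge0 ?mulr_ge0 ?exprn_ge0 ?addr_ge0.
- have yc2 : 1 + y <= 1 + c by rewrite lerD2l.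
  have y1 : 0 <= 1 + y := addr_ge0 ler01 y0.
  have c1 : 0 <= 1 + c := addr_ge0 ler01 c0.
  apply: lerD; first by rewrite lerXn2r.
  apply: (@le_trans _ _ ((2 * M ^ b.+1)%:R * (c / M%:R) ^+ b.+1)).
    by rewrite ler_wpM2l // lerXn2r ?nnegrE // divr_ge0.
  rewrite expr_div_n natrM natrX le_eqVlt; apply/orP; left; apply/eqP.
  by field; rewrite expf_neq0 // gt_eqF.
rewrite !powRN lef_pV2 ?posrE ?powR_gt0 //.
rewrite ge0_ler_powR ?nnegrE ?(ltW a_gt0) ?(ltW M0') ?(ltW X0) // ler_nat.
by rewrite expnS mulnCA leq_pmulr // muln_gt0 Mb.
Qed.

(** Only numbers above [Q] contribute, so the bound is uniform in [Q1]. *)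
Let head_sqr Q Q1 k : (0 < Q)%N ->
  \sum_(1 <= u < Q1.+1 | coprime u (primorial Q))
     normc (if (1 < u)%N then cf k u else 0) ^+ 2 <= Q%:R `^ (- (2 * a - 1)) / (2 * a - 1).
Proof.
move=> Q0; have a2 : 1 < 2 * a by have := ka_gt0; rewrite /ka; lra.
have := @sum_powR_tail R (2 * a) Q Q1 a2 Q0.
have -> : 1 - 2 * a = - (2 * a - 1) by ring.
apply: le_trans; rewrite big_mkcond.
have z u : (0 < u)%N -> (u <= Q)%N -> (if coprime u (primorial Q)
    then normc (if (1 < u)%N then cf k u else 0) ^+ 2 else 0) = 0.
  move=> u0 uQ; case: ifP => // cu; case: ifPn => [u1|_]; last by rewrite normc0 expr0n.
  have /(coprime_primorialP _ u0) hc := cu.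
  have := hc _ (pdiv_prime u1) (pdiv_dvd u).
  by rewrite ltnNge (leq_trans _ uQ) // dvdn_leq // pdiv_dvd.
have [YQ|QY] := leqP Q1 Q.
  rewrite [leRHS]big_geq // big_nat big1 // => m /andP[m0 mY].
  by apply: z => //; apply: leq_trans YQ.
rewrite (@big_cat_nat _ _ _ Q.+1) ?ltnS ?(ltnW QY) //= big_nat big1 ?add0r; last first.
  by move=> m /andP[m0 mQ]; apply: z.
rewrite !big_nat; apply: ler_sum => m /andP[mQ _].
have m0 : (0 < m)%N by exact: leq_trans mQ.
case: ifP => _; last by exact: powR_ge0.
case: ifP => _; last by rewrite normc0 expr0n powR_ge0.
rewrite cf_norm // -powR_mulrn ?powR_ge0 // -powRrM le_eqVlt; apply/orP; left; apply/eqP.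
by congr (_ `^ _); ring.
Qed.

(** With [D = eulerD Q], both [c D] and [D zeta] are near 1, so [D (zeta - c)] is at most [3 e],
    while [normc c * normc D >= 1 / 2]. This gives [6 e normc c]; the 7 makes the final inequality
    strict. *)
Let hit_of_near (c : R[i]) (e d rad : R) Q (z : nat -> R[i]) n k :
  c != 0 -> 0 < e -> e <= 1 / 4 -> 7 * (e * normc c) <= rad -> 0 <= d ->
  Q.+1%:R * 2 ^+ Q.+1 * d <= e / normc c ->
  (forall p, normc (z p) = 1) ->
  normc (c * \prod_(0 <= p < Q.+1 | prime p) (1 - cf k p * z p) - 1) <= e ->
  (forall p, prime p -> (p <= Q)%N -> normc (chi h p ^+ n - z p) < d) ->
  normc (eulerD Q (st n k) * zeta (st n k) - 1) <= e ->
  normc (zeta (st n k) - c) < rad.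
Proof.
move=> c0 e0 e4 erad d0 hd z1 hz hn hD.
have nc0 : 0 < normc c by rewrite normc_gt0.
have cont : normc (eulerD Q (st n k) - \prod_(0 <= p < Q.+1 | prime p) (1 - cf k p * z p)) <= e
  / normc c.
  apply: le_trans hd; rewrite /eulerD; under eq_bigr do rewrite npow_st.
  apply: prod_lipschitz => // p; first by rewrite normcX normc_chi expr1n.
    move=> pp; rewrite cf_norm ?prime_gt0 // -[leRHS](powRr0 p%:R).
    by rewrite ler_powR ?ler1n ?prime_gt0 // oppr_le0 ltW.
  by move=> pp; rewrite ltnS => pQ; apply/ltW/hn.
move: hD hz cont; set D := eulerD _ _; set Z := zeta _; set P := \prod_(_ <= _ < _ | _) _.
move=> hD hz; rewrite ler_pdivlMr // mulrC -normcM => cont.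
have cD : normc (c * D - 1) <= 2 * e.
  have -> : c * D - 1 = c * (D - P) + (c * P - 1) by ring.
  by rewrite (le_trans (normcD _ _)) //; lra.
have h1 : normc (D * (Z - c)) <= 3 * e.
  have -> : D * (Z - c) = (D * Z - 1) - (c * D - 1) by ring.
  by rewrite (le_trans (normcB _ _)) //; lra.
have h2 : 1 / 2 <= normc c * normc D.
  rewrite -normcM; have := normcB (c * D) (c * D - 1).
  have -> : c * D - (c * D - 1) = 1 by ring.
  by rewrite normc1; lra.
rewrite normcM in h1; have x0 := normc_ge0 (Z - c).
have h3 := ler_wpM2r x0 h2; have h4 := ler_wpM2l (ltW nc0) h1.
have en : 0 < e * normc c by rewrite mulr_gt0.
by move: h3 h4 en erad; set x := normc (Z - c); set y := normc c; set w := normc D; lra.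
Qed.

(** By contradiction: if no [n >= N0] is good, W is at most [mu / 4] or the distances [Z n] exceed
    [e ^+ 2], and the weighted mean of [Z] is too small for that. *)
Lemma zeta_hits (c : R[i]) (rad : R) (N0 : nat) : c != 0 -> 0 < rad ->
  exists2 n, (N0 <= n)%N & forall k, (k < l)%N ->
    normc (zeta (s + 'i%C * h%:C * (n + k)%:R) - c) < rad.
Proof.
move=> c0 rad0; apply: contrapT => hno.
have nc0 : 0 < normc c by rewrite normc_gt0.
have n7 : 0 < 7 * normc c by rewrite mulr_gt0.
pose e := Num.min (1 / 4) (rad / (7 * normc c)).
have e0 : 0 < e by rewrite lt_min !divr_gt0.
have e4 : e <= 1 / 4 by rewrite ge_min lexx.
have erad : 7 * (e * normc c) <= rad.
  have : e <= rad / (7 * normc c) by rewrite ge_min lexx orbT.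
  by rewrite ler_pdivlMr //; lra.
clearbody e.
have e20 : 0 < e ^+ 2 by rewrite exprn_gt0.
have h_neq0 : h != 0 by rewrite gt_eqF.
have l1 : 0 < l.+1%:R :> R by rewrite ltr0n.
have [P0 hP0] := resonant_primes h_neq0.
have a2 : 0 < 2 * a - 1 by have := ka_gt0; rewrite /ka; lra.
have t1 : 0 < e ^+ 2 / 16 / l.+1%:R * (2 * a - 1) by rewrite mulr_gt0 // !divr_gt0.
have [L1 L10 hL1] := powR_decay a2 t1.
(* [P0] forces phase 1 on the resonant primes, [L1] makes the head small relative to [mu]. *)
have [Q LQ [z [z1 zL hz]]] :=
  @phase_product R zeta zetaP s h l h_neq0 s_strip c e (maxn P0 L1) c0 e0.
have PQ : (P0 <= Q)%N by apply: leq_trans LQ; rewrite leq_maxl.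
have L1Q : (L1 <= Q)%N by apply: leq_trans LQ; rewrite leq_maxr.
have Q0 : (0 < Q)%N := leq_trans L10 L1Q.
have zP p : (p <= P0)%N -> z p = 1 by move=> hp; apply: zL; rewrite leq_max hp.
have q2 : 0 < Q.+1%:R * 2 ^+ Q.+1 :> R by rewrite mulr_gt0 ?exprn_gt0.
pose d := e / normc c / (Q.+1%:R * 2 ^+ Q.+1).
have d0 : 0 < d by rewrite !divr_gt0.
have hd : Q.+1%:R * 2 ^+ Q.+1 * d <= e / normc c by rewrite /d mulrC divfK // gt_eqF.
have [mu mu0 [W [W01 Wbad Wmean]]] := concentration hP0 PQ z1 zP d0.
have W0 n : 0 <= W n by case/andP: (W01 n).
have W1 n : W n <= 1 by case/andP: (W01 n).
pose dist n k := normc (eulerD Q (st n k) * zeta (st n k) - 1).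
pose Z n := \sum_(k < l) dist n k ^+ 2.
have Z0 n : 0 <= Z n by apply: sumr_ge0 => k _; exact: sqr_ge0.
have key1 n : (N0 <= n)%N -> W n * e ^+ 2 <= mu / 4 * e ^+ 2 + W n * Z n.
  move=> nN; have m4 : 0 <= mu / 4 * e ^+ 2 by rewrite mulr_ge0 ?sqr_ge0 // divr_ge0 // ltW.
  have [ph|hW] := Wbad n; last first.
    by rewrite (le_trans (ler_wpM2r (ltW e20) hW)) // lerDl mulr_ge0.
  have [hk|hk] := pselect (forall k : 'I_l, dist n k <= e).
    exfalso; apply: hno; exists n => // k kl.
    exact: (hit_of_near c0 e0 e4 erad (ltW d0) hd z1 (hz (Ordinal kl)) ph (hk (Ordinal kl))).
  have [k hk'] : exists k : 'I_l, e < dist n k.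
    by apply: contrapT => hk'; apply: hk => k; rewrite leNgt; apply/negP => ?; apply: hk'; exists k.
  apply: (@le_trans _ _ (W n * Z n)); last by rewrite lerDr.
  rewrite ler_wpM2l // /Z (bigD1 k) //= -[leLHS]addr0 lerD //.
    by rewrite lerXn2r ?nnegrE ?normc_ge0 ?(ltW e0) // ltW.
  by apply: sumr_ge0 => i _; exact: sqr_ge0.
pose G := 6 / k0 ^+ 2.
have G0 : 0 < G by rewrite divr_gt0 // exprn_gt0.
have [CT CT0 hCT] := tail_mean.
have CT1 : 0 < CT + 1 by rewrite ltr_wpDl.
have me : 0 < mu * e ^+ 2 by exact: mulr_gt0.
have gg : 0 < l.+1%:R * G * (CT + 1) by exact: mulr_gt0 (mulr_gt0 l1 G0) CT1.
(* [Q1] is chosen after [mu]. The two tails count 1 + 4 = 5 times, and 5/40 is the share 1/8 used in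
   [tls]. *)
have t2 : 0 < mu * e ^+ 2 / 40 / (l.+1%:R * G * (CT + 1)).
  exact: divr_gt0 (divr_gt0 me (ltr0Sn R 39)) gg.
have [Q1 Q10 /(_ Q1 (leqnn _)) hQ1] := powR_decay ka_gt0 t2.
pose fh k (u : nat) : R[i] := if (1 < u)%N then cf k u else 0.
have [CA hCA] := choice (fun k : 'I_l => let: ex_intro2 C C0 hC := Wmean Q1 (fh k) in ex_intro
  _ C (conj C0 hC)).
(* With the single term [u = 1] this is the mean of W itself. *)
have [C0 C00 hC0] := Wmean 1%N (fun=> 1).
have {}hC0 N : N%:R * mu - C0 <= \sum_(0 <= n < N) W n.
  have one (V : nmodType) (F : nat -> V) :
      \sum_(1 <= u < 2 | coprime u (primorial Q)) F u = F 1%N.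
    by rewrite big_mkcond big_nat1 coprime1n.
  have := hC0 N; rewrite one normc1 expr1n mulr1.
  have -> : \sum_(0 <= n < N) W n * normc (\sum_(1 <= u < 2 | coprime u (primorial Q)) 1 * chi
    h u ^+ n) ^+ 2 =
     \sum_(0 <= n < N) W n.
    by apply: eq_bigr => n _; rewrite one mul1r chi1 expr1n normc1 expr1n mulr1.
  by rewrite ler_norml => /andP[]; lra.
(* [ka (b + 2) >= 2] gives [Y ^ (1 - ka) <= M ^ b = N / M] for [Y = M ^ (b + 2)]; the number of
   summations by parts is also [b + 2]. *)
pose b := Num.truncn (2 / ka).
have hb : 2 <= ka * b.+2%:R.
  have : 2 / ka < b.+1%:R by exact: truncnS_gt.
  rewrite ltr_pdivrMr // mulrC => /ltW /le_trans; apply; rewrite ler_wpM2l ?(ltW ka_gt0) //.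
  by rewrite ler_nat.
have [CZ CZ0 hCZ] := zeta_approx zetaP Q (isT : (2 <= b.+2)%N).
have [CB CB0 hCB] := tail_bound_le b.+1.
pose CE := (CZ * CB) ^+ 2.
have CE0 : 0 <= CE by exact: sqr_ge0.
pose n1 := (Num.truncn ((9 / 4 - Im s) / h)).+1.
have hn1 n k : (n1 <= n)%N -> 9 / 4 < Im (st n k).
  move=> nn; rewrite Im_st -ltrBlDl (mulrC h) -ltr_pdivrMr //.
  have : (9 / 4 - Im s) / h < n1%:R by exact: truncnS_gt.
  by move=> /lt_le_trans; apply; rewrite ler_nat (leq_trans nn) // leq_addr.
pose N2 := maxn N0 n1.
pose SA := \sum_(k < l) 2 * CA k.
have SA0 : 0 <= SA by apply: sumr_ge0 => k _; rewrite mulr_ge0 //; case: (hCA k).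
pose KG := l%:R * G * (10 * CT + CE).
have KG0 : 0 <= KG.
  exact: mulr_ge0 (mulr_ge0 (ler0n R l) (ltW G0)) (addr_ge0 (mulr_ge0 (ler0n R 10) CT0) CE0).
pose K := e ^+ 2 * (C0 + N2%:R) + SA + KG.
(* [K] collects everything that is to be beaten by one factor [M]; none of its constants depends on
   [M]. *)
pose M := maxn (maxn N2 Q1) (Num.truncn (2 * K / (mu * e ^+ 2))).+1.
have M0 : (0 < M)%N by rewrite !leq_max orbT.
have N2M : (N2 <= M)%N by exact: leq_trans (leq_maxl _ _) (leq_maxl _ _).
have Q1M : (Q1 <= M)%N by exact: leq_trans (leq_maxr _ _) (leq_maxl _ _).
have KM : 2 * K < M%:R * (mu * e ^+ 2).
  rewrite -ltr_pdivrMr //.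
  have : 2 * K / (mu * e ^+ 2) < (Num.truncn (2 * K / (mu * e ^+ 2))).+1%:R by exact: truncnS_gt.
  by move=> /lt_le_trans; apply; rewrite ler_nat leq_maxr.
clearbody M.
have M0' : 0 < M%:R :> R by rewrite ltr0n.
have M1 : 1 <= M%:R :> R by rewrite ler1n.
pose N := (M ^ b.+1)%N; pose nu := (M ^ b)%N; pose Y := (M ^ b.+2)%N.
have nu0 : (0 < nu)%N by rewrite expn_gt0 M0.
have nu1 : 1 <= nu%:R :> R by rewrite ler1n.
have NE : N%:R = M%:R * nu%:R :> R by rewrite /N expnS natrM.
have MN : (M <= N)%N by rewrite /N expnS leq_pmulr.
have N2N : (N2 <= N)%N := leq_trans N2M MN.
have Y0 : (0 < Y)%N by rewrite expn_gt0 M0.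
have Q1Y : (Q1 <= Y)%N by rewrite (leq_trans (leq_trans Q1M MN)) // /Y expnS leq_pmull.
have powY (X : nat) : (X <= 2 * Y)%N -> X%:R `^ (1 - ka) <= 2 * nu%:R :> R.
  move=> XY; have ka1 : 0 <= 1 - ka by have := a_lt1; rewrite /ka; lra.
  apply: (@le_trans _ _ ((2 * Y)%:R `^ (1 - ka))).
    by rewrite ge0_ler_powR ?nnegrE ?ler_nat.
  rewrite natrM powRM //; apply: ler_pM; rewrite ?powR_ge0 //.
    by rewrite -[leRHS](powRr1 (ler0n R 2)) ler_powR ?ler1n // gerBl ltW.
  rewrite /Y /nu !natrX -!powR_mulrn // -powRrM ler_powR //.
  have b2 : b.+2%:R = b%:R + 2 :> R by rewrite -addn2 natrD.
  by move: hb; rewrite b2; lra.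
pose tl := CT * (N%:R * Q1%:R `^ (- ka) + 2 * nu%:R).
have tmean X k : (0 < X)%N -> (X <= 2 * Y)%N ->
    \sum_(0 <= n < N) normc (tail Q Q1 X n k) ^+ 2 <= tl.
  move=> X0 XY; apply: (le_trans (hCT Q Q1 X N k Q10 X0)).
  by rewrite ler_wpM2l // lerD2l powY.
pose eM := CZ * (CB * M%:R `^ (- a)).
have eM0 : 0 <= eM by exact: mulr_ge0 CZ0 (mulr_ge0 CB0 (powR_ge0 _ _)).
have CEM : 0 <= CE / M%:R by exact: divr_ge0.
(* [2 a >= 1], so over [n < N] this error adds up to [nu CE] only. *)
have eM2 : eM ^+ 2 <= CE / M%:R.
  rewrite /eM mulrA exprMn -/CE ler_wpM2l // -powR_mulrn ?powR_ge0 // -powRrM.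
  rewrite -powR_inv1 // ler_powR //; lra.
pose B n := \sum_(k < l) (2 * normc (head Q Q1 n k) ^+ 2 + G * (normc (tail Q Q1 (2 * Y) n k) ^+ 2 +
  4 * normc (tail Q Q1 Y n k) ^+ 2 + CE / M%:R)).
have key2 n : (n1 <= n)%N -> (n < N)%N -> Z n <= B n.
  move=> nn nN; apply: ler_sum => k _.
  have hd' : dist n k <= normc (head Q Q1 n k) +
    (normc (tail Q Q1 (2 * Y) n k) + 2 * normc (tail Q Q1 Y n k) + eM) / k0.
    apply: euler_zeta_dist; first by rewrite Q10.
    apply: le_trans (hCZ (st n k) (2 * Y)%N _ (hn1 n k nn) _) _.
    - by rewrite Re_shift; case/andP: s_strip => /ltW.
    - by rewrite muln_gt0.
    - by rewrite /eM ler_wpM2l // hCB.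
  have h1 : dist n k ^+ 2 <= (normc (head Q Q1 n k) +
    (normc (tail Q Q1 (2 * Y) n k) + 2 * normc (tail Q Q1 Y n k) + eM) / k0) ^+ 2.
    by rewrite lerXn2r ?nnegrE ?(le_trans (normc_ge0 _) hd') ?normc_ge0.
  apply: (le_trans h1).
  apply: (le_trans (sqr_dist (normc_ge0 _) (normc_ge0 _) (normc_ge0 _) eM0)).
  by rewrite lerD2l ler_wpM2l ?(ltW G0) // lerD2l.
have B1 n k : 0 <= normc (tail Q Q1 (2 * Y) n k) ^+ 2 + 4 * normc (tail Q Q1 Y n k) ^+ 2 + CE /
  M%:R.
  exact: addr_ge0 (addr_ge0 (sqr_ge0 _) (mulr_ge0 (ler0n R 4) (sqr_ge0 _))) CEM.
have B0 n : 0 <= B n.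
  apply: sumr_ge0 => k _; apply: addr_ge0; first exact: mulr_ge0 (ler0n R 2) (sqr_ge0 _).
  exact: mulr_ge0 (ltW G0) (B1 n k).
have upper : e ^+ 2 * \sum_(0 <= n < N) W n <=
    N2%:R * e ^+ 2 + (N%:R * (mu / 4 * e ^+ 2) + \sum_(0 <= n < N) W n * B n).
  rewrite (@big_cat_nat _ _ _ N2) //= mulrDr; apply: lerD.
    rewrite mulrC ler_wpM2r ?(ltW e20) //.
    have -> : N2%:R = \sum_(0 <= n < N2) (1 : R) by rewrite big_const_nat subn0 iter_addr addr0.
    exact: ler_sum.
  have -> : N%:R * (mu / 4 * e ^+ 2) = \sum_(0 <= n < N) mu / 4 * e ^+ 2.
    by rewrite big_const_nat subn0 iter_addr addr0 mulr_natl.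
  rewrite -big_split /= [leRHS](@big_cat_nat _ _ _ N2) //= -[leLHS]add0r lerD //.
    apply: sumr_ge0 => n _; apply: addr_ge0 (mulr_ge0 (W0 n) (B0 n)).
    exact: mulr_ge0 (divr_ge0 (ltW mu0) (ler0n R 4)) (ltW e20).
  rewrite big_distrr /= !big_nat; apply: ler_sum => n /andP[nN2 nN].
  have N0n : (N0 <= n)%N by rewrite (leq_trans _ nN2) // leq_maxl.
  have n1n : (n1 <= n)%N by rewrite (leq_trans _ nN2) // leq_maxr.
  rewrite mulrC (le_trans (key1 n N0n)) // lerD2l ler_wpM2l //; exact: key2.
pose tq := Q%:R `^ (- (2 * a - 1)) / (2 * a - 1).
have Wk (k : 'I_l) : \sum_(0 <= n < N) W n * normc (head Q Q1 n k) ^+ 2 <= CA k + N%:R * (mu * tq).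
  have [_ /(_ N)] := hCA k; rewrite ler_norml => /andP[_ hh].
  rewrite -lerBlDr; apply: le_trans hh; rewrite lerD2l lerN2 ler_wpM2l // ler_wpM2l ?(ltW mu0) //.
  exact: head_sqr.
have sumB : \sum_(0 <= n < N) W n * B n <=
    \sum_(k < l) (2 * (CA k + N%:R * (mu * tq)) + G * (tl + 4 * tl + nu%:R * CE)).
  under eq_bigr do rewrite big_distrr /=.
  rewrite exchange_big /=; apply: ler_sum => k _.
  (* W is kept on the head, where it yields the factor [mu], and replaced by 1 on the rest. *)
  apply: (@le_trans _ _ (\sum_(0 <= n < N) (2 * (W n * normc (head Q Q1 n k) ^+ 2) +
     G * (normc (tail Q Q1 (2 * Y) n k) ^+ 2 + 4 * normc (tail Q Q1 Y n k) ^+ 2 + CE / M%:R)))).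
    apply: ler_sum => n _; rewrite mulrDr mulrCA lerD2l ler_piMl //.
    exact: mulr_ge0 (ltW G0) (B1 n k).
  rewrite big_split /= -!big_distrr /= !big_split /= -big_distrr /=.
  apply: lerD; first by rewrite ler_wpM2l.
  rewrite ler_wpM2l ?(ltW G0) //; apply: lerD.
    have Y2 : (0 < 2 * Y)%N by rewrite muln_gt0.
    have Y1 : (Y <= 2 * Y)%N by exact: leq_pmull.
    exact: lerD (tmean _ k Y2 (leqnn _)) (ler_wpM2l (ler0n R 4) (tmean _ k Y0 Y1)).
  rewrite big_const_nat subn0 iter_addr addr0 -[_ *+ N]mulr_natr NE le_eqVlt; apply/orP; left;
    apply/eqP.
  by field; rewrite gt_eqF.
have tqs : l%:R * (2 * (N%:R * (mu * tq))) <= N%:R * (mu * e ^+ 2) / 8.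
  have h1 : tq * l.+1%:R <= e ^+ 2 / 16.
    by rewrite /tq -ler_pdivlMr // ler_pdivrMr // hL1.
  have tq0 : 0 <= tq by rewrite divr_ge0 ?powR_ge0 // ltW.
  have h2 : l%:R * tq <= e ^+ 2 / 16.
    by apply: le_trans h1; rewrite mulrC ler_wpM2l // ler_nat.
  have Nm : 0 <= N%:R * mu by rewrite mulr_ge0 // ltW.
  have := ler_wpM2l Nm h2; lra.
have tls : l%:R * (G * (5 * (CT * (N%:R * Q1%:R `^ (- ka))))) <= N%:R * (mu * e ^+ 2) / 8.
  rewrite ler_pdivlMr // in hQ1.
  have q0 : 0 <= Q1%:R `^ (- ka) by exact: powR_ge0.
  have h1 : l%:R * G * CT <= l.+1%:R * G * (CT + 1).
    apply: ler_pM; [exact: mulr_ge0 (ler0n R l) (ltW G0) | exact: CT0 | | by rewrite lerDl].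
    by apply: (ler_wpM2r (ltW G0)); rewrite ler_nat.
  have h2 := ler_wpM2l q0 h1.
  have h3 := ler_wpM2l (ler0n R N) (le_trans h2 hQ1).
  move: h3; set q := Q1%:R `^ _; lra.
(* In units of [N mu e ^+ 2] the main terms are 1 on the left and 1/4 + 1/8 + 1/8 on the right. The
   remaining half would be at most [nu K], against the choice of [M]. *)
have : e ^+ 2 * (N%:R * mu - C0) <= N2%:R * e ^+ 2 + (N%:R * (mu / 4 * e ^+ 2) +
    (SA + (l%:R * (2 * (N%:R * (mu * tq))) + l%:R * (G * (5 * (CT * (N%:R * Q1%:R `^ (- ka)))))
      + nu%:R * KG))).
  apply: le_trans (ler_wpM2l (ltW e20) (hC0 N)) _; apply: (le_trans upper).
  rewrite lerD2l lerD2l (le_trans sumB) // le_eqVlt; apply/orP; left; apply/eqP.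
  under eq_bigr do rewrite mulrDr -addrA.
  rewrite big_split /= -/SA; congr (_ + _); rewrite sumr_const card_ord -[LHS]mulr_natl /tl
    /KG; ring.
move=> fin.
have nuK : e ^+ 2 * (C0 + N2%:R) + SA + nu%:R * KG <= nu%:R * K.
  have A0 : 0 <= e ^+ 2 * (C0 + N2%:R) + SA by rewrite addr_ge0 // mulr_ge0 ?(ltW e20) // addr_ge0.
  by rewrite /K (mulrDr nu%:R (_ + SA)) lerD2r ler_peMl.
have nuK2 : nu%:R * (2 * K) < nu%:R * (M%:R * (mu * e ^+ 2)) by rewrite ltr_pM2l // ltr0n.
have NE2 : nu%:R * (M%:R * (mu * e ^+ 2)) = N%:R * (mu * e ^+ 2) by rewrite NE; ring.
rewrite NE2 in nuK2.
lra.
Qed.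

End Assembly.

Theorem theorem3 (R : realType) (zeta : Cplx R -> Cplx R)
    (zetaP : is_riemann_zeta zeta) (h : R) (h_gt0 : 0 < h) (l : nat)
    (M : set (riemann_sphere R)) (M_int : interior M !=set0)
    (s : R[i]) (s_strip : 1 / 2 < complex.Re s < 1) :
  exists N : set nat,
    [/\ N `<=` [set n | (0 < n)%N],
        infinite_set N
      & forall n k : nat, N n -> (1 <= k <= l)%N ->
          M (to_sphere (zeta (s + 'i%C * h%:C * (n%:R + k%:R - 1))))].
Proof.
have [c [r [c0 r0 hM]]] := sphere_interior M_int.
exists [set n | (0 < n)%N /\ forall k, (1 <= k <= l)%N ->
   M (to_sphere (zeta (s + 'i%C * h%:C * (n%:R + k%:R - 1))))]; split.
- by move=> n [].
- move=> /finite_seqP[t ht].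
  (* A good shift beyond the maximum of a supposed finite list; the successor also makes it
     positive. The index [k] of the statement becomes [k.-1 < l]. *)
  have [n nt hn] := @zeta_hits R zeta zetaP s h l h_gt0 s_strip c r (\max_(i <- t) i).+1 c0 r0.
  have : n \in t.
    suff : [set` t] n by [].
    rewrite -ht; split; first exact: leq_trans nt.
    move=> k /andP[k1 kl]; apply: hM.
    have -> : n%:R + k%:R - 1 = (n + k.-1)%:R :> R[i].
      by rewrite -{1}(prednK k1) -natr1 natrD; ring.
    by apply: hn; rewrite prednK.
  by move=> nin; have := @leq_bigmax_seq _ t xpredT id n nin isT; rewrite leqNgt nt.
by move=> n k [_ hn] /hn.
Qed.
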